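(* Let $\frac23<\alpha<1$. Suppose we have a family of functions $\{v(\cdot,x)\}_{x\in\mathbb{R}^2}$ of class $C^\alpha$ parameterized by points $x$, a distribution $f$, and a family of distributions $\{v(\cdot,x)\diamond f\}_x$, both of class $C^{\alpha-2}$, satisfying for all points $x,x'$ and some constants $N,N_1$ $$[v(\cdot,x)-v(\cdot,x')]_\alpha\le N\,d^\alpha(x,x'),\qquad\|f\|_{\alpha-2}\le N_1,$$ $$\|[v(\cdot,x),(\cdot)]\diamond f-[v(\cdot,x'),(\cdot)]\diamond f\|_{2\alpha-2}\le NN_1\,d^\alpha(x,x').$$ Let $u$ be a function such that, for some constant $M$ and some function $\nu$, $$|(u(y)-u(x))-(v(y,x)-v(x,x))-\nu(x)(y-x)_1|\le M\,d^{2\alpha}(y,x)\quad\text{for all }x,y.$$ Then there exists a unique distribution $u\diamond f$ such that $$\sup_{0<T\le1}(T^{1/4})^{2-3\alpha}\big\|[u,(\cdot)_T]\diamond f-E_{\mathrm{diag}}[v,(\cdot)_T]\diamond f-\nu[x_1,(\cdot)_T]f\big\|\le C(M+N)N_1,$$ where $E_{\mathrm{diag}}$ stands for evaluation of the continuous function $(x,y)\mapsto([v(\cdot,x),(\cdot)_T]\diamond f)(y)$ on the diagonal $y=x$. If moreover all functions and distributions are space-time periodic and $$[v(\cdot,x)]_\alpha\le N,\qquad\|[v(\cdot,x),(\cdot)]\diamond f\|_{2\alpha-2}\le NN_1\quad\text{for all }x,$$ then also $$\|[u,(\cdot)]\diamond f\|_{2\alpha-2}\le C(M+N)N_1 .$$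 Here $C$ depends only on $\alpha$.
   Context: Points are $x=(x_1,x_2)\in\mathbb{R}^2$; $d(x,y):=|x_1-y_1|+\sqrt{|x_2-y_2|}$; $[u]_\alpha:=\sup_{x\neq y}|u(x)-u(y)|/d^\alpha(x,y)$, and $u$ is of class $C^\alpha$ if this is finite; $\|\cdot\|$ is the supremum norm. Space-time periodic: $1$-periodic in $x_1$ and $x_2$. For $T>0$, $\psi_T$ is the Schwartz function with Fourier transform $\exp(-T(k_1^4+k_2^2))$ and $f_T=(f)_T:=f*\psi_T$. $\|f\|_{\alpha-2}:=\sup_{0<T\le1}(T^{1/4})^{2-\alpha}\|f_T\|$; $f$ is of class $C^{\alpha-2}$ if this is finite. For a function $h$ and distribution $g$, $h\diamond g$ denotes a given (or constructed) distribution playing the role of the product, not determined by $h$ and $g$; $[h,(\cdot)_T]\diamond g:=h\,g_T-(h\diamond g)_T$, and $\|[h,(\cdot)]\diamond g\|_{2\alpha-2}:=\sup_{0<T\le1}(T^{1/4})^{2-2\alpha}\|[h,(\cdot)_T]\diamond g\|$, with the same definition for differences of commutators. $[x_1,(\cdot)_T]f:=x_1f_T-(x_1f)_T$ is the classical commutator with multiplication by the coordinate $x_1$. *)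

(* Defs.v *)
From HB Require Import structures.
From mathcomp Require Import all_boot all_order all_algebra.
From mathcomp Require Import complex ring.
From mathcomp Require Import all_classical all_reals all_analysis.

Set Implicit Arguments.
Unset Strict Implicit.
Unset Printing Implicit Defensive.

Import Order.TTheory GRing.Theory Num.Theory.
Import numFieldNormedType.Exports.

Local Open Scope classical_set_scope.
Local Open Scope complex_scope.
Local Open Scope ring_scope.

Section schwartz_space.
Variable R : realType.
Implicit Types (f g : R * R -> R) (x y h : R * R) (w : seq bool).

Definition supnorm f : \bar R := ereal_sup [set `|f x|%:E | x in setT].

(* false stands for the direction x_1, true for x_2. *)
Definition unit_vec (i : bool) : R * R := if i then (0, 1) else (1, 0).

(* Iterated partial derivative along a word in the two coordinate directions;
   words, rather than multi-indices, so that no order of differentiation is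
   privileged. *)
Definition pderivs w f : R * R -> R :=
  foldr (fun i g => 'D_(unit_vec i) g) f w.

Definition schwartz_seminorm (p : nat * nat * seq bool) f : \bar R :=
  supnorm (fun x => x.1 ^+ p.1.1 * x.2 ^+ p.1.2 * pderivs p.2 f x).

Definition is_schwartz f : Prop :=
  (forall w x, differentiable (pderivs w f) x) /\
  (forall p, (schwartz_seminorm p f < +oo)%E).

Lemma supnorm_ltyP f :
  (supnorm f < +oo)%E <-> exists C : R, forall x, `|f x| <= C.
Proof.
split=> [fy|[C fC]].
  have f0 : (0 <= supnorm f)%E.
    by apply: (@le_trans _ _ (`|f 0|%:E)); [rewrite lee_fin|apply: ereal_sup_ubound; exists 0].
  exists (fine (supnorm f)) => x.
  rewrite -lee_fin fineK ?ge0_fin_numE//.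
  by apply: ereal_sup_ubound; exists x.
apply: (@le_lt_trans _ _ C%:E); last exact: ltry.
by apply: ge_ereal_sup => _ [x _ <-]; rewrite lee_fin.
Qed.

Let bnd f := exists C : R, forall x, `|f x| <= C.

Let bnd_lin (a b : R) f g : bnd f -> bnd g -> bnd (fun x => a * f x + b * g x).
Proof.
move=> [C fC] [D gD]; exists (`|a| * C + `|b| * D) => x.
by rewrite (le_trans (ler_normD _ _))// !normrM lerD// ler_wpM2l.
Qed.

Lemma is_schwartzP f : is_schwartz f <->
  forall w, (forall x, differentiable (pderivs w f) x) /\
    forall m n, exists C : R, forall x, `|x.1 ^+ m * x.2 ^+ n * pderivs w f x| <= C.
Proof.
split=> [[df sf] w|H].
  by split=> // m n; apply/supnorm_ltyP; exact: (sf (m, n, w)).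
split=> [w|[[m n] w]]; first exact: (H w).1.
by apply/supnorm_ltyP; exact: (H w).2.
Qed.

Lemma pderivsD (a : R) f g w : is_schwartz f -> is_schwartz g ->
  pderivs w (a *: f + g) = a *: pderivs w f + pderivs w g.
Proof.
move=> [df _] [dg _]; elim: w => [//|i w IH] /=.
rewrite IH; apply/funext => x.
rewrite deriveD ?deriveZ//; apply/diff_derivable => //.
exact: differentiableZ.
Qed.

Lemma schwartz_lin (a : R) f g :
  is_schwartz f -> is_schwartz g -> is_schwartz (a *: f + g).
Proof.
move=> sf sg; apply/is_schwartzP => w; rewrite pderivsD//.
move/is_schwartzP : (sf) => /(_ w)[df bf].
move/is_schwartzP : (sg) => /(_ w)[dg bg].
split=> [x|m n]; first by apply: differentiableD => //; exact: differentiableZ.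
have [C hC] := bnd_lin a 1 (bf m n) (bg m n).
exists C => x; apply: le_trans (hC x).
by rewrite mul1r mulrDr !fctE/= mulrCA.
Qed.

Lemma pderivs_cst0 w : pderivs w (0 : R * R -> R) = 0.
Proof.
elim: w => [//|i w IH] /=; rewrite IH.
by apply/funext => x; rewrite derive_cst.
Qed.

Lemma schwartz0 : is_schwartz (0 : R * R -> R).
Proof.
apply/is_schwartzP => w; rewrite pderivs_cst0; split.
  by move=> x; exact: differentiable_cst.
by move=> m n; exists 0 => x; rewrite mulr0 normr0.
Qed.

Lemma derive_affine h (s : R) g v y : (forall z, differentiable g z) ->
  differentiable (fun z => g (h + s *: z)) y /\
  'D_v (fun z => g (h + s *: z)) y = s * 'D_v g (h + s *: y).
Proof.
move=> dg.
have da z : differentiable (fun z : R * R => h + s *: z) z.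
  by apply: differentiableD => //; exact: differentiableZ.
have dga : differentiable (g \o (fun z => h + s *: z)) y.
  exact: differentiable_comp.
split=> //; rewrite (deriveE _ dga) diff_comp//= deriveE//.
have H : is_diff y (cst h + s *: id) (0 + s *: id) by exact: is_diffD.
have -> : 'd (fun z => h + s *: z) y v = s *: v.
  by rewrite [LHS](congr1 (@^~ v) (@diff_val _ _ _ _ _ _ _ H))/= fctE add0r.
by rewrite linearZ.
Qed.

Lemma pderivs_affine h (s : R) f w : is_schwartz f ->
  pderivs w (fun y => f (h + s *: y)) =
  (s ^+ size w) *: (fun y => pderivs w f (h + s *: y)).
Proof.
move=> [df _]; elim: w => [|i w IH] /=; first by rewrite scale1r.
rewrite IH; apply/funext => y.
have [d1 e1] := derive_affine h s (unit_vec i) y (df w).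
rewrite deriveZ; last exact/diff_derivable.
by rewrite e1 fctE exprSr -scalerA.
Qed.

Lemma schwartz_affine h (s : R) f : s * s = 1 ->
  is_schwartz f -> is_schwartz (fun y => f (h + s *: y)).
Proof.
move=> ss sf; apply/is_schwartzP => w; rewrite pderivs_affine//.
move/is_schwartzP : (sf) => /(_ w)[df bf]; split=> [x|m n].
  by apply: differentiableZ; exact: (derive_affine h s 0 x df).1.
set a := fun y : R * R => h + s *: y.
have s0 : s != 0 by apply: contra_eq_neq ss => ->; rewrite mul0r eq_sym oner_eq0.
have ay1 (y : R * R) : y.1 = s * (a y).1 - s * h.1.
  by rewrite /a/= mulrDr addrAC subrr add0r mulrA ss mul1r.
have ay2 (y : R * R) : y.2 = s * (a y).2 - s * h.2.
  by rewrite /a/= mulrDr addrAC subrr add0r mulrA ss mul1r.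
have H m1 n1 m2 n2 : bnd (fun y => (y.1 ^+ m1 * y.2 ^+ n1) *
    ((a y).1 ^+ m2 * (a y).2 ^+ n2 * pderivs w f (a y))).
  elim: m1 m2 n2 => [|m1 IH] m2 n2; last first.
    have [C hC] := bnd_lin s (- (s * h.1)) (IH m2.+1 n2) (IH m2 n2).
    exists C => y; apply: le_trans (hC y); rewrite le_eqVlt; apply/orP; left.
    by apply/eqP; congr `|_|; rewrite [in y.1 ^+ m1.+1]exprS {1}ay1 exprS; ring.
  elim: n1 m2 n2 => [|n1 IH] m2 n2; last first.
    have [C hC] := bnd_lin s (- (s * h.2)) (IH m2 n2.+1) (IH m2 n2).
    exists C => y; apply: le_trans (hC y); rewrite le_eqVlt; apply/orP; left.
    by apply/eqP; congr `|_|; rewrite [in y.2 ^+ n1.+1]exprS {1}ay2 exprS; ring.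
  have [C hC] := bf m2 n2.
  by exists C => y; rewrite !expr0 !mul1r; exact: hC.
have [C hC] := bnd_lin (s ^+ size w) 0 (H m n 0%N 0%N) (H m n 0%N 0%N).
exists C => y; apply: le_trans (hC y); rewrite le_eqVlt; apply/orP; left.
by apply/eqP; congr `|_|; rewrite fctE/= /GRing.scale/= !expr0; ring.
Qed.

Lemma schwartz_pderivs w f : is_schwartz f -> is_schwartz (pderivs w f).
Proof.
move=> /is_schwartzP sf; apply/is_schwartzP => w'.
by rewrite /pderivs -foldr_cat; exact: sf.
Qed.

Let continuous_coord1 : continuous (fst : R * R -> R).
Proof. by move=> [a b]; exact: cvg_fst. Qed.

Lemma differentiable_coord1 y : differentiable (fst : R * R -> R) y.
Proof. exact/linear_differentiable/continuous_coord1. Qed.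

Lemma derive_coord1 v y : 'D_v (fst : R * R -> R) y = v.1.
Proof.
rewrite deriveE; last exact: differentiable_coord1.
by rewrite diff_lin//; exact: continuous_coord1.
Qed.

Definition pderivs_sum (ws : seq (seq bool)) f : R * R -> R :=
  \sum_(w <- ws) pderivs w f.

Lemma schwartz_pderivs_sum ws f : is_schwartz f -> is_schwartz (pderivs_sum ws f).
Proof.
move=> sf; rewrite /pderivs_sum; elim: ws => [|w ws IH].
  by rewrite big_nil; exact: schwartz0.
rewrite big_cons -[pderivs w f]scale1r.
by apply: schwartz_lin => //; exact: schwartz_pderivs.
Qed.

Lemma pderivs_sum_cons i ws f : is_schwartz f ->
  pderivs [:: i] (pderivs_sum ws f) = pderivs_sum (map (cons i) ws) f.
Proof.
move=> sf; rewrite /pderivs_sum; elim: ws => [|w ws IH].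
  by rewrite !big_nil pderivs_cst0.
rewrite !big_cons -IH -[pderivs w f]scale1r pderivsD ?scale1r//.
  exact: schwartz_pderivs.
exact: schwartz_pderivs_sum.
Qed.

Lemma pderivs_coord1 w : exists ws, forall f, is_schwartz f ->
  pderivs w (fun y => y.1 * f y) =
  (fun y => y.1 * pderivs w f y + pderivs_sum ws f y).
Proof.
elim: w => [|i w [ws IH]] /=.
  exists [::] => f sf; apply/funext => y.
  by rewrite /pderivs_sum big_nil addr0.
exists ((if i then [::] else [:: w]) ++ map (cons i) ws) => f sf.
have [df _] := schwartz_pderivs w sf; have {}df := df [::].
have [dg _] := schwartz_pderivs_sum ws sf; have {}dg := dg [::].
have d1 y := differentiable_coord1 y.
rewrite IH//; apply/funext => y.
rewrite [LHS](@deriveD _ _ _ ((fst : R * R -> R) * pderivs w f)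
  (pderivs_sum ws f)); last 2 first.
- by apply/diff_derivable; exact: differentiableM.
- exact/diff_derivable/dg.
rewrite deriveM; [|exact/diff_derivable|exact/diff_derivable/df].
have addE (a b : R * R -> R) : (a + b) y = a y + b y by [].
rewrite derive_coord1 /pderivs_sum big_cat/= addE addrA.
congr (_ + _); last first.
  by have /(congr1 (@^~ y)) := pderivs_sum_cons i ws sf.
congr (_ + _); rewrite [LHS]mulrC.
by case: i => /=; rewrite ?big_nil ?mul0r// big_seq1 mul1r.
Qed.

Lemma schwartz_mulx1 f : is_schwartz f -> is_schwartz (fun y => y.1 * f y).
Proof.
move=> sf; apply/is_schwartzP => w.
have [ws /(_ _ sf) ->] := pderivs_coord1 w.
move/is_schwartzP : (sf) => /(_ w)[df bf].
move/is_schwartzP : (schwartz_pderivs_sum ws sf) => /(_ [::])[dg bg].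
split=> [x|m n].
  apply: (@differentiableD _ _ _ ((fst : R * R -> R) * pderivs w f)
    (pderivs_sum ws f)) => //.
  by apply: differentiableM => //; exact: differentiable_coord1.
have [C hC] := bnd_lin 1 1 (bf m.+1 n) (bg m n).
exists C => y; apply: le_trans (hC y); rewrite le_eqVlt; apply/orP; left.
by apply/eqP; congr `|_|; rewrite exprS/=; ring.
Qed.

Lemma schwartz_seminorm_ge0 p f : (0 <= schwartz_seminorm p f)%E.
Proof.
apply: le_trans (ereal_sup_ubound _); last by exists 0.
by rewrite lee_fin.
Qed.

Lemma schwartz_seminorm_mulx1 p : exists s, forall f, is_schwartz f ->
  (schwartz_seminorm p (fun y => y.1 * f y)%R
     <= \sum_(q <- s) schwartz_seminorm q f)%E.
Proof.
case: p => [[m n] w]; have [ws H] := pderivs_coord1 w.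
exists ((m.+1, n, w) :: [seq (m, n, w') | w' <- ws]) => f sf.
apply: ge_ereal_sup => _ [x _ <-] /=; rewrite H//.
rewrite big_cons big_map mulrDr.
apply: (@le_trans _ _ (`|x.1 ^+ m * x.2 ^+ n * (x.1 * pderivs w f x)|%:E +
    `|x.1 ^+ m * x.2 ^+ n * pderivs_sum ws f x|%:E)%E).
  by rewrite -EFinD lee_fin ler_normD.
apply: leeD.
  apply: ereal_sup_ubound; exists x => //=; congr (`|_|%:E).
  by rewrite exprS; ring.
rewrite /pderivs_sum; elim: ws {H} => [|w' ws IH].
  by rewrite !big_nil mulr0 normr0.
rewrite !big_cons mulrDr.
apply: (@le_trans _ _ (`|x.1 ^+ m * x.2 ^+ n * pderivs w' f x|%:E +
    `|x.1 ^+ m * x.2 ^+ n * (\sum_(j <- ws) pderivs j f) x|%:E)%E).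
  by rewrite -EFinD lee_fin ler_normD.
by apply: leeD => //; apply: ereal_sup_ubound; exists x.
Qed.

Lemma schwartz_seminorms_mulx1 s : exists s', forall f, is_schwartz f ->
  (\sum_(p <- s) schwartz_seminorm p (fun y => y.1 * f y)%R
     <= \sum_(q <- s') schwartz_seminorm q f)%E.
Proof.
elim: s => [|p s [s' IH]]; first by exists [::] => f _; rewrite !big_nil.
have [t ht] := schwartz_seminorm_mulx1 p.
exists (t ++ s') => f sf; rewrite big_cons big_cat/=.
by apply: leeD; [exact: ht|exact: IH].
Qed.

Definition schwartz_pred : {pred R * R -> R} := fun f => `[< is_schwartz f >].

Lemma schwartz_submod_closed : submod_closed schwartz_pred.
Proof.
split; first exact/asboolP/schwartz0.
by move=> a f g /asboolP sf /asboolP sg; apply/asboolP/schwartz_lin.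
Qed.

HB.instance Definition _ :=
  GRing.isSubmodClosed.Build R (R * R -> R) schwartz_pred schwartz_submod_closed.

Record schwartz := Schwartz {
  schwartz_fun :> R * R -> R;
  schwartz_funP : schwartz_fun \in schwartz_pred }.

HB.instance Definition _ := [isSub for schwartz_fun].
HB.instance Definition _ := [Choice of schwartz by <:].
HB.instance Definition _ := [SubChoice_isSubLmodule of schwartz by <:].

Lemma schwartzP (phi : schwartz) : is_schwartz phi.
Proof. exact/asboolP/schwartz_funP. Qed.

Fact schwartz_reflect_subproof x (phi : schwartz) :
  (fun y => phi (x - y)) \in schwartz_pred.
Proof.
apply/asboolP; rewrite (_ : (fun _ => _) = fun y => phi (x + (-1) *: y)).
  by apply: schwartz_affine; [rewrite mulrNN mulr1|exact: schwartzP].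
by apply/funext => y; rewrite scaleN1r.
Qed.

Definition schwartz_reflect x (phi : schwartz) : schwartz :=
  Schwartz (schwartz_reflect_subproof x phi).

Fact schwartz_shift_subproof h (phi : schwartz) :
  (fun y => phi (y + h)) \in schwartz_pred.
Proof.
apply/asboolP; rewrite (_ : (fun _ => _) = fun y => phi (h + 1 *: y)).
  by apply: schwartz_affine; [rewrite mulr1|exact: schwartzP].
by apply/funext => y; rewrite scale1r addrC.
Qed.

Definition schwartz_shift h (phi : schwartz) : schwartz :=
  Schwartz (schwartz_shift_subproof h phi).

Fact schwartz_coord1_subproof (phi : schwartz) :
  (fun y => y.1 * phi y) \in schwartz_pred.
Proof. exact/asboolP/schwartz_mulx1/schwartzP. Qed.

Definition schwartz_coord1 (phi : schwartz) : schwartz :=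
  Schwartz (schwartz_coord1_subproof phi).

End schwartz_space.

(* Distributions are tempered, since they are tested against the non compactly
   supported kernels psi_T. *)
Record tempered_distribution (R : realType) := Distribution {
  pairing :> schwartz R -> R;
  pairing_linear : forall (a : R) (phi chi : schwartz R),
    pairing (a *: phi + chi) = a * pairing phi + pairing chi;
  pairing_tempered : exists (C : R) (s : seq (nat * nat * seq bool)),
    forall phi : schwartz R,
      (`|pairing phi|%:E <= C%:E * \sum_(p <- s) schwartz_seminorm p phi)%E }.

Section distributions.
Variable R : realType.
Implicit Types (f g : tempered_distribution R) (phi : schwartz R).

Fact mulx1_linear f (a : R) (phi chi : schwartz R) :
  f (schwartz_coord1 (a *: phi + chi)) =
  a * f (schwartz_coord1 phi) + f (schwartz_coord1 chi).
Proof.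
rewrite -pairing_linear; congr (pairing f _); apply/val_inj => /=.
by apply/funext => y; rewrite !fctE/= mulrDr mulrCA.
Qed.

Fact mulx1_tempered f : exists (C : R) (s : seq (nat * nat * seq bool)),
  forall phi, (`|f (schwartz_coord1 phi)|%:E
    <= C%:E * \sum_(p <- s) schwartz_seminorm p phi)%E.
Proof.
have [C [s Hs]] := pairing_tempered f.
have [s' Hs'] := schwartz_seminorms_mulx1 R s.
exists `|C|, s' => phi; apply: (le_trans (Hs _)).
apply: (@le_trans _ _ (`|C|%:E *
    \sum_(p <- s) schwartz_seminorm p (schwartz_coord1 phi))%E).
  apply: lee_wpmul2r; last by rewrite lee_fin ler_norm.
  by apply: sume_ge0 => p _; exact: schwartz_seminorm_ge0.
by apply: lee_wpmul2l => //; exact/Hs'/schwartzP.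
Qed.

Definition distr_mulx1 f : tempered_distribution R :=
  Distribution (mulx1_linear f) (mulx1_tempered f).

Definition distr_conv f phi (x : R * R) : R := f (schwartz_reflect x phi).

(* Real and imaginary parts of \int e^{-i k.x} phi(x) dx. *)
Definition fourier_transform phi (k : R * R) : R[i] :=
  let mu := (@lebesgue_measure R \x @lebesgue_measure R)%E in
  (\int[mu]_x (cos (k.1 * x.1 + k.2 * x.2) * phi x))%R +i*
  (- \int[mu]_x (sin (k.1 * x.1 + k.2 * x.2) * phi x))%R.

Definition is_kernel (psi : R -> schwartz R) : Prop :=
  forall T, 0 < T -> forall k,
    fourier_transform (psi T) k = (expR (- (T * (k.1 ^+ 4 + k.2 ^+ 2))))%:C.

Definition fun_periodic (u : R * R -> R) : Prop :=
  forall i x, u (x + unit_vec R i) = u x.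

Definition distr_periodic f : Prop :=
  forall i phi, f (schwartz_shift (unit_vec R i) phi) = f phi.

Definition pdist (x y : R * R) : R :=
  `|x.1 - y.1| + Num.sqrt `|x.2 - y.2|.

Definition holder_seminorm (alpha : R) (u : R * R -> R) : \bar R :=
  ereal_sup [set (`|u z.1 - u z.2| / pdist z.1 z.2 `^ alpha)%:E
            | z in [set z : (R * R) * (R * R) | z.1 != z.2]].

Definition scaled_sup (beta : R) (F : R -> R * R -> R) : \bar R :=
  ereal_sup [set (((T `^ 4^-1) `^ beta)%:E * supnorm (F T))%E
            | T in [set T : R | 0 < T <= 1]].

Section kernel.
Variable psi : R -> schwartz R.

Definition mollify f (T : R) : R * R -> R := distr_conv f (psi T).

Definition neg_norm (alpha : R) f : \bar R :=
  scaled_sup (2 - alpha) (mollify f).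

(* [h, (.)_T] <> g; the distribution hg plays the role of h <> g. *)
Definition commutator (h : R * R -> R) g (hg : tempered_distribution R)
    (T : R) (y : R * R) : R :=
  h y * mollify g T y - mollify hg T y.

End kernel.

End distributions.

(* Main.v *)
Require Import Defs.
From HB Require Import structures.
From mathcomp Require Import all_boot all_order all_algebra.
From mathcomp Require Import complex ring lra.
From mathcomp Require Import all_classical all_reals all_analysis.
From mathcomp Require Import measurable_realfun.

Set Implicit Arguments.
Unset Strict Implicit.
Unset Printing Implicit Defensive.

Import Order.TTheory GRing.Theory Num.Theory.
Import numFieldNormedType.Exports.

Local Open Scope classical_set_scope.
Local Open Scope ring_scope.

(** Write [G_T(x) = u(x) f_T(x) - ([v(.,x),(.)_T] <> f)(x) - nu(x) ([x_1,(.)_T] f)(x)].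
Then [G_T(x)] is the value at [x] of the mollification of a distribution [W_x]
frozen at [x], so that, by the semigroup property,
[(psi_s * G_t)(x) - G_(s+t)(x)] is the integral over [h] of
[psi_s(h) (W_(x-h) - W_x)_t(x-h)].  For [s <= 2t] the three-point hypotheses and the
Hoelder continuity of exponent [2 alpha - 1] that they force on [nu] bound this by
[t^((3 alpha - 2)/4)], a positive power.  Summing along doublings of [t] removes the
restriction on [s]; hence the functions [G_(2^-n)] converge as distributions, to [uf],
with [G_T - uf_T] of the same order.  A distribution is the limit of its
mollifications, which gives uniqueness.

The kernel is known only through its Fourier transform.  Since
[exp(-T(k_1^4 + k_2^2))] is itself the Fourier transform of [psi_T], Fubini's theorem
shows that a function with vanishing Fourier transform is orthogonal to all translates
of these exponentials, and letting [T] tend to infinity that it vanishes.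
So [psi_T] is determined, even, a semigroup in [T] and a parabolic dilation of
[psi_1], whose absolute moments provide the constant. *)

(** * Integration over the plane *)

(** The germ may blow up like [t^((alpha - 2)/4)] as [t] tends to zero, so its values need not
    converge; its pairings with test functions do. Replacing [G_(2t)] by [psi_t * G_t] costs the
    defect, a positive power of [t] because [alpha > 2/3]. Moving [psi_t] onto the test function
    [phi] costs [psi_t * phi - phi], of order [t^(2/4)] because the even kernel has no first moment
    in [x_1]; this compensates the blow-up and leaves [t^(alpha/4)].

    The three contributions to the defect scale alike: [2 alpha + (alpha - 2)],
    [alpha + (2 alpha - 2)] and [(2 alpha - 1) + (alpha - 1)] all equal [3 alpha - 2].

    Two kinds of constants are kept apart. Those for the growth of the germ in space and its
    continuity in [t] depend on all the data, and disappear in the limit. Only the defect enters the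
    final constant.

    The technical obstacle is the semigroup property for mollified distributions, which exchanges a
    distribution with an integral. It is derived from seminorm bounds by subdividing squares,
    without integrals of Schwartz-valued functions. *)

Section plane_measure.
Variable R : realType.
Local Notation mR := (measurableTypeR R).
Local Notation lam := (@lebesgue_measure R).

(** A name for the product measure, to which the measure and sigma-finiteness instances attach; the
    latter let it serve as a factor in Fubini's theorem on pairs of points. *)
Definition plane_measure : set (mR * mR)%type -> \bar R := (lam \x lam)%E.
HB.instance Definition _ := Measure.on plane_measure.

Let plane_measure_sigma_finite : sigma_finite setT plane_measure.
Proof.
have /sigma_finiteP[F [TF ndF Foo]] := sigma_finiteT lam.
exists (fun n => F n `*` F n).
  rewrite predeqE => -[x y]; split=> // _.
  have : (\bigcup_i F i) x by rewrite -TF.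
  have : (\bigcup_i F i) y by rewrite -TF.
  move=> [m _ Fy] [n _ Fx]; exists (maxn m n) => //; split=> /=.
    by move: Fx; apply/subsetPset/ndF/leq_maxr.
  by move: Fy; apply/subsetPset/ndF/leq_maxl.
move=> k; have [mk fk] := Foo k.
split; first exact: measurableX.
rewrite /plane_measure product_measure1E// lte_mul_pinfty// ge0_fin_numE//.
Qed.

HB.instance Definition _ := @Measure_isSigmaFinite.Build _ _ _ plane_measure
  plane_measure_sigma_finite.

Definition plane_integral (F : R * R -> R) : R :=
  \int[plane_measure]_x F x.

Definition measurable2 (F : R * R -> R) :=
  measurable_fun [set: mR * mR] (F : mR * mR -> R).

(** The product sigma-algebra is generated by rectangles, not by open sets. An open set is the union
    of the countably many boxes with rational centre and radius that it contains, hence it is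
    measurable. *)
Lemma continuous_measurable2 (F : R * R -> R) : continuous F -> measurable2 F.
Proof.
move=> cF.
have mo (O : set (R * R)) : open O -> measurable (O : set (mR * mR)).
  move=> oO.
  pose box (p : rat * rat * rat) : set (R * R) :=
    `]ratr p.1.1 - ratr p.2, ratr p.1.1 + ratr p.2[ `*`
    `]ratr p.1.2 - ratr p.2, ratr p.1.2 + ratr p.2[.
  have -> : O = \bigcup_(p : rat * rat * rat)
      (if `[< box p `<=` O >] then box p else set0).
    apply/seteqP; split=> [x Ox|x [p _]]; last by case: asboolP => // pO /pO.
    have /nbhs_ballP[e /= e0 eO] := open_nbhs_nbhs (conj oO Ox).
    (* The centre is taken within [e / 3] of [x] and the radius between [e / 3] and [e / 2]: the box
       then contains [x] and stays in the ball, as [e / 3 + e / 2 < e]. *)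
    have e3 : 0 < e / 3 by rewrite divr_gt0.
    have /rat_in_itvoo[q] : e / 3 < e / 2 by lra.
    rewrite in_itv/= => /andP[q1 q2].
    have /rat_in_itvoo[p1] : x.1 < x.1 + e / 3 by lra.
    rewrite in_itv/= => /andP[p11 p12].
    have /rat_in_itvoo[p2] : x.2 < x.2 + e / 3 by lra.
    rewrite in_itv/= => /andP[p21 p22].
    exists (p1, p2, q) => //; case: asboolP; last first.
      case=> y; rewrite /box/= !in_itv/= => -[/andP[a b] /andP[c d]].
      by apply: eO; split; rewrite /ball/= ltr_norml; apply/andP; split; lra.
    by move=> _; rewrite /box/= !in_itv/=; split; apply/andP; split; lra.
  apply: countable_bigcupT_measurable => // p; case: asboolP => // _.
  by apply: measurableX; exact: measurable_itv.
apply: (measurability (@RGenOpens.G R)); first exact: RGenOpens.measurableE.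
move=> _ [_ [a [b ->]] <-].
rewrite setTI; apply: mo.
by apply: open_comp => // x _; exact: cF.
Qed.

(** By uniqueness of Lebesgue measure, it suffices to evaluate the rescaled image measure on
    half-open intervals. *)
Lemma lebesgue_measure_affine (a c : R) (A : set mR) : a != 0 -> measurable A ->
  lam A = (`|a|%:E * lam ((fun x : mR => (a * x + c)%R) @^-1` A))%E.
Proof.
move=> a0 mA.
have mf : measurable_fun setT (fun x : mR => a * x + c : mR).
  by apply: measurable_funD => //; exact: measurable_funM.
pose f := fun x : mR => a * x + c : mR.
have a'0 : 0 <= `|a| by [].
pose m : {measure set mR -> \bar R} := mscale (NngNum a'0) (pushforward lam f).
rewrite (@lebesgue_measure_unique _ (m mf)) => // _ [[l r]] _ <- /=.
rewrite /m/= /mscale/= /pushforward.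
have [lr|rl] := ltP l r; last first.
  rewrite set_itv_ge ?bnd_simp -?leNgt//.
  by rewrite preimage_set0 !measure0 mule0.
have [a_gt0|a_lt0|/eqP] := ltgtP 0 a; last by rewrite eq_sym (negbTE a0).
  have -> : f @^-1` `]l, r]%classic = `](l - c) / a, (r - c) / a]%classic.
    apply/seteqP; split=> x /=; rewrite /f !in_itv/= ltr_pdivrMr// ler_pdivlMr//;
    by move=> /andP[H1 H2]; apply/andP; split; lra.
  rewrite !lebesgue_measure_itv/= !lte_fin lr ltr_pM2r ?invr_gt0// ltrD2r lr.
  by rewrite -EFinB -EFinM gtr0_norm//; congr (_%:E); field.
(* A negative factor exchanges the ends, so the preimage is closed on the left. *)
have -> : f @^-1` `]l, r]%classic = `[(r - c) / a, (l - c) / a[%classic.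
  apply/seteqP; split=> x /=; rewrite /f !in_itv/= ler_ndivrMr// ltr_ndivlMr//;
  by move=> /andP[H1 H2]; apply/andP; split; lra.
rewrite !lebesgue_measure_itv/= !lte_fin lr ltr_nM2r ?invr_lt0// ltrD2r lr.
by rewrite -EFinB -EFinM ltr0_norm//; congr (_%:E); field.
Qed.

(** Product measures are determined by rectangles, which reduces the claim to one dimension.
    Diagonal affine maps cover every substitution used below: translations, reflections and
    parabolic dilations. *)
Lemma plane_measure_affine (a c : R * R) (A : set (mR * mR)) :
  a.1 != 0 -> a.2 != 0 -> measurable A ->
  plane_measure A = (`|a.1 * a.2|%:E * plane_measure
    ((fun x : mR * mR => (a.1 * x.1 + c.1, a.2 * x.2 + c.2)%R : mR * mR) @^-1` A))%E.
Proof.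
move=> a10 a20 mA.
pose f := fun x : mR * mR => (a.1 * x.1 + c.1, a.2 * x.2 + c.2)%R : mR * mR.
have mf1 (b d : R) : measurable_fun setT (fun x : mR => b * x + d : mR).
  by apply: measurable_funD => //; exact: measurable_funM.
have mf : measurable_fun setT f.
  apply: measurable_fun_pair; apply: measurable_funD => //;
  by apply: measurable_funM.
have a'0 : 0 <= `|a.1 * a.2| by [].
pose m : {measure set (mR * mR) -> \bar R} := mscale (NngNum a'0) (pushforward plane_measure f).
rewrite /plane_measure (@product_measure_unique _ _ _ _ _ _ _ (m mf)) => // X Y mX mY.
rewrite /m/= /mscale/= /pushforward/=.
have -> : f @^-1` (X `*` Y) = ((fun x : mR => (a.1 * x + c.1)%R) @^-1` X) `*`
    ((fun x : mR => (a.2 * x + c.2)%R) @^-1` Y) by [].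
rewrite /plane_measure product_measure1E; last 2 first.
- by rewrite -[X in measurable X]setTI; exact: mf1.
- by rewrite -[X in measurable X]setTI; exact: mf1.
rewrite [LHS](_ : _ = lam X * lam Y)%E // (lebesgue_measure_affine c.1 a10 mX).
rewrite (lebesgue_measure_affine c.2 a20 mY) normrM EFinM.
by rewrite muleACA.
Qed.
End plane_measure.
Arguments plane_measure {R}.

(** * The polynomial weight and dominated functions *)

Section weight.
Variable R : realType.
Implicit Types (x y z : R * R) (F G : R * R -> R) (m n : nat).
Local Notation mR := (measurableTypeR R).
Local Notation lam := (@lebesgue_measure R).

(** Submultiplicative under addition with constant one ([weightD]), so that its powers pass through
    translations and convolutions without further constants. *)
Definition weight z : R := 1 + `|z.1| + `|z.2|.

Lemma weight_ge1 z : 1 <= weight z.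
Proof. by rewrite /weight -addrA lerDl addr_ge0. Qed.

Lemma weight_gt0 z : 0 < weight z.
Proof. exact: lt_le_trans (weight_ge1 z). Qed.

Lemma weight_neq0 z : weight z != 0.
Proof. by rewrite gt_eqF// weight_gt0. Qed.

Lemma weightX_gt0 z n : 0 < weight z ^+ n.
Proof. by rewrite exprn_gt0// weight_gt0. Qed.

Lemma weightX_ge1 z n : 1 <= weight z ^+ n.
Proof. by rewrite exprn_ege1// weight_ge1. Qed.

Lemma weightX_ge0 z n : 0 <= weight z ^+ n.
Proof. exact/ltW/weightX_gt0. Qed.

Lemma weightX_le z m n : (m <= n)%N -> weight z ^+ m <= weight z ^+ n.
Proof. by move=> mn; rewrite ler_weXn2l// weight_ge1. Qed.

Lemma weightN z : weight (- z) = weight z.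
Proof. by rewrite /weight/= !normrN. Qed.

Lemma weightD y z : weight (y + z) <= weight y * weight z.
Proof.
rewrite /weight/=; have := ler_normD y.1 z.1; have := ler_normD y.2 z.2.
set a := `|y.1|; set b := `|y.2|; set c := `|z.1|; set d := `|z.2|.
have [a0 b0 c0 d0] : [/\ 0 <= a, 0 <= b, 0 <= c & 0 <= d] by split; exact: normr_ge0.
move=> h1 h2.
have := mulr_ge0 a0 c0; have := mulr_ge0 a0 d0; have := mulr_ge0 b0 c0.
have := mulr_ge0 b0 d0; lra.
Qed.

Lemma weightDX y z n : weight (y + z) ^+ n <= weight y ^+ n * weight z ^+ n.
Proof.
rewrite -exprMn lerXn2r ?nnegrE ?mulr_ge0//; try exact/ltW/weight_gt0.
exact: weightD.
Qed.

Lemma weightBX y z n : weight y ^+ n <= weight (y - z) ^+ n * weight z ^+ n.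
Proof. by have := weightDX (y - z) z n; rewrite subrK. Qed.

Lemma measurable2_fst : measurable2 (fst : R * R -> R).
Proof. exact: measurable_fst. Qed.

Lemma measurable2_snd : measurable2 (snd : R * R -> R).
Proof. exact: measurable_snd. Qed.

Lemma measurable2_cst (c : R) : measurable2 (fun=> c).
Proof. exact: measurable_cst. Qed.

Lemma measurable2D F G : measurable2 F -> measurable2 G ->
  measurable2 (fun x => F x + G x).
Proof. exact: measurable_funD. Qed.

Lemma measurable2B F G : measurable2 F -> measurable2 G ->
  measurable2 (fun x => F x - G x).
Proof. exact: measurable_funB. Qed.

Lemma measurable2M F G : measurable2 F -> measurable2 G ->
  measurable2 (fun x => F x * G x).
Proof. exact: measurable_funM. Qed.

Lemma measurable2_norm F : measurable2 F -> measurable2 (fun x => `|F x|).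
Proof. by move=> mF; apply: (measurableT_comp (@normr_measurable R setT)). Qed.

Lemma measurable2X F n : measurable2 F -> measurable2 (fun x => F x ^+ n).
Proof. exact: measurable_funX. Qed.

Lemma continuous_weight : continuous weight.
Proof.
move=> -[x1 x2]; rewrite /weight; apply: cvgD; last first.
  by apply: cvg_norm; exact: cvg_snd.
by apply: cvgD; [exact: cvg_cst|apply: cvg_norm; exact: cvg_fst].
Qed.

Lemma measurable2_weight : measurable2 weight.
Proof.
exact: continuous_measurable2 continuous_weight.
Qed.

Lemma integral_oneDsqrV_lty :
  (\int[lam]_x ((1 + x ^+ 2)^-1)%:E < +oo)%E.
Proof.
rewrite ge0_symfun_integralT.
- rewrite (_ : [set x : R | 0 <= x] = `[0, +oo[%classic); last first.
    by rewrite set_itvcy.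
  by rewrite [X in (_ * X)%E]integral0y_oneDsqr -EFinM ltry.
- by move=> x; rewrite invr_ge0 addr_ge0// sqr_ge0.
- exact: (@continuous_oneDsqrV R).
- by move=> x /=; rewrite sqrrN.
Qed.

(* [weight ^- 4] is integrable on the plane. *)
Definition dominated F :=
  measurable2 F /\ exists C, forall x, `|F x| * weight x ^+ 4 <= C.

(** Reduces the integrability of [weight ^- 4] to a product of two one-dimensional integrals of
    [1 / (1 + t ^+ 2)]. *)
Lemma weight4 x : (1 + x.1 ^+ 2) * (1 + x.2 ^+ 2) <= weight x ^+ 4.
Proof.
rewrite -[4%N]/(2 + 2)%N exprD /weight.
rewrite -(real_normK (num_real x.1)) -(real_normK (num_real x.2)).
set a := `|_|; set b := `|x.2|; have a0 : 0 <= a by exact: normr_ge0.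
have b0 : 0 <= b by exact: normr_ge0.
by apply: ler_pM; rewrite ?addr_ge0// ?sqr_ge0//; have := mulr_ge0 a0 b0; nra.
Qed.

Lemma dominated_integrable F : dominated F ->
  plane_measure.-integrable setT (EFin \o F).
Proof.
move=> [mF [C CF]].
have C0 : 0 <= C.
  by apply: le_trans (CF 0); rewrite mulr_ge0// ltW// weightX_gt0.
pose h (t : R) := (1 + t ^+ 2)^-1.
have h0 t : 0 <= h t by rewrite invr_ge0 addr_ge0// sqr_ge0.
have mh : measurable_fun [set: mR] h.
  by apply: continuous_measurable_fun; exact: (@continuous_oneDsqrV R).
have mh2 : measurable2 (fun x => C * (h x.1 * h x.2)).
  apply: measurable2M; first exact: measurable2_cst.
  by apply: (@measurable2M (h \o fst) (h \o snd)); apply: measurableT_comp.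
apply: (@le_integrable _ _ _ plane_measure setT measurableT _ (fun x => (C * (h x.1 * h x.2))%:E)) => //.
- exact/measurable_EFinP.
- move=> x _; rewrite lee_fin [leRHS]ger0_norm; last by rewrite !mulr_ge0.
  rewrite -invfM ler_pdivlMr; last first.
    by rewrite mulr_gt0// ltr_pwDl// sqr_ge0.
  by apply: le_trans (CF x); rewrite ler_wpM2l// weight4.
apply/integrable12ltyP; first exact/measurable_EFinP.
have [K KE] : exists K : R, (\int[lam]_y (h y)%:E = K%:E)%E.
  exists (fine (\int[lam]_y (h y)%:E)); rewrite fineK// ge0_fin_numE.
    exact: integral_oneDsqrV_lty.
  by apply: integral_ge0 => y _; rewrite lee_fin.
under eq_integral => x _.
  under eq_integral => y _ do rewrite /= ger0_norm ?mulr_ge0// mulrA EFinM.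
  rewrite ge0_integralZl//; last 3 first.
  - exact/measurable_EFinP.
  - by move=> y _; rewrite lee_fin.
  - by rewrite lee_fin mulr_ge0.
  rewrite KE -EFinM mulrAC EFinM.
  over.
rewrite /= ge0_integralZl//; last 3 first.
- exact/measurable_EFinP.
- by move=> y _; rewrite lee_fin.
- rewrite lee_fin mulr_ge0// -lee_fin -KE.
  by apply: integral_ge0 => y _; rewrite lee_fin.
by rewrite KE -EFinM ltry.
Qed.

Lemma measurable2_weightV n : measurable2 (fun x => (weight x ^+ n)^-1).
Proof.
apply: continuous_measurable2 => x; apply: cvgV; first exact/lt0r_neq0/weightX_gt0.
exact: (cvg_comp _ _ (continuous_weight (x := x)) (@exprn_continuous R n (weight x))).
Qed.

End weight.
#[global] Hint Extern 0 (is_true (0 < weight _)) => solve [apply: weight_gt0] : core.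
#[global] Hint Extern 0 (is_true (1 <= weight _)) => solve [apply: weight_ge1] : core.
#[global] Hint Extern 0 (is_true (0 < weight _ ^+ _)) => solve [apply: weightX_gt0] : core.
#[global] Hint Extern 0 (is_true (0 <= weight _ ^+ _)) => solve [apply: weightX_ge0] : core.
#[global] Hint Extern 0 (is_true (1 <= weight _ ^+ _)) => solve [apply: weightX_ge1] : core.

(** * Integrals of dominated functions and changes of variables *)

Section plane_integral.
Variable R : realType.
Implicit Types (x : R * R) (F G : R * R -> R) (n : nat).
Local Notation mR := (measurableTypeR R).
Local Notation I2 := (@plane_integral R).

Lemma dominated_le F G : measurable2 F -> (forall x, `|F x| <= `|G x|) ->
  dominated G -> dominated F.
Proof.
move=> mF FG [mG [C GC]]; split=> //; exists C => x.
by apply: le_trans (GC x); rewrite ler_wpM2r// ltW// weightX_gt0.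
Qed.

Lemma dominatedZ (c : R) F : dominated F -> dominated (fun x => c * F x).
Proof.
move=> [mF [C FC]]; split; first exact: (measurable2M (measurable2_cst c)).
by exists (`|c| * C) => x; rewrite normrM -mulrA ler_wpM2l.
Qed.

Lemma dominatedD F G : dominated F -> dominated G ->
  dominated (fun x => F x + G x).
Proof.
move=> [mF [C FC]] [mG [D GD]]; split; first exact: measurable2D.
exists (C + D) => x; apply: le_trans (lerD (FC x) (GD x)).
by rewrite -mulrDl ler_wpM2r ?ler_normD// ltW// weightX_gt0.
Qed.

Lemma dominatedN F : dominated F -> dominated (fun x => - F x).
Proof.
by move=> /(dominatedZ (-1)); under eq_fun do rewrite mulN1r.
Qed.

Lemma dominatedB F G : dominated F -> dominated G ->
  dominated (fun x => F x - G x).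
Proof. by move=> dF /dominatedN; exact: dominatedD. Qed.

Lemma dominated_norm F : dominated F -> dominated (fun x => `|F x|).
Proof.
move=> dF; apply: (dominated_le _ _ dF); last by move=> x; rewrite normr_id.
by apply: measurable2_norm; case: dF.
Qed.

Lemma eq_plane_integral F G : (forall x, F x = G x) -> I2 F = I2 G.
Proof. by move=> /funext ->. Qed.

Lemma plane_integralD F G : dominated F -> dominated G ->
  I2 (fun x => F x + G x) = I2 F + I2 G.
Proof.
by move=> dF dG; apply: RintegralD => //; exact: dominated_integrable.
Qed.

Lemma plane_integralB F G : dominated F -> dominated G ->
  I2 (fun x => F x - G x) = I2 F - I2 G.
Proof.
by move=> dF dG; apply: RintegralB => //; exact: dominated_integrable.
Qed.

Lemma plane_integralZ (c : R) F : dominated F ->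
  I2 (fun x => c * F x) = c * I2 F.
Proof. by move=> dF; apply: RintegralZl => //; exact: dominated_integrable. Qed.

Lemma plane_integral_ge0 F : (forall x, 0 <= F x) -> 0 <= I2 F.
Proof. by move=> F0; exact: Rintegral_ge0. Qed.

Lemma le_plane_integral F G : dominated F -> dominated G ->
  (forall x, F x <= G x) -> I2 F <= I2 G.
Proof.
by move=> dF dG FG; apply: le_Rintegral => //; exact: dominated_integrable.
Qed.

Lemma ler_norm_plane_integral F G : dominated F -> dominated G ->
  (forall x, `|F x| <= G x) -> `|I2 F| <= I2 G.
Proof.
move=> dF dG FG; apply: le_trans (le_plane_integral (dominated_norm dF) dG FG).
by apply: le_normr_Rintegral => //; exact: dominated_integrable.
Qed.

Lemma measurable2_affine (a c : R * R) F : measurable2 F ->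
  measurable2 (fun x => F (a.1 * x.1 + c.1, a.2 * x.2 + c.2)).
Proof.
move=> mF; apply: (measurableT_comp mF); apply: measurable_fun_pair;
by apply: measurable_funD => //; apply: measurable_funM.
Qed.

Lemma weight_affine (a c : R * R) : a.1 != 0 -> a.2 != 0 ->
  exists2 K, 0 <= K &
    forall x, weight x <= K * weight (a.1 * x.1 + c.1, a.2 * x.2 + c.2).
Proof.
move=> a10 a20; pose K : R := 1 + `|a.1^-1| + `|a.2^-1|.
have K1 : 1 <= K by rewrite /K -addrA lerDl addr_ge0.
exists (K * weight c) => [|x].
  by rewrite mulr_ge0//; [rewrite (le_trans _ K1)|exact/ltW].
set y := (_, _).
have -> : x = (a.1^-1 * (y - c).1, a.2^-1 * (y - c).2).
  by case: x @y => x1 x2 /=; rewrite !addrK !mulKf.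
apply: (@le_trans _ _ (K * weight (y - c))).
  rewrite {1}/weight/= !normrM /weight/K.
  set p := `|(y - c).1|; set q := `|(y - c).2|.
  set r := `|a.1^-1|; set s := `|a.2^-1|.
  have [p0 q0 r0 s0] : [/\ 0 <= p, 0 <= q, 0 <= r & 0 <= s] by split; exact: normr_ge0.
  have := mulr_ge0 p0 r0; have := mulr_ge0 q0 s0; have := mulr_ge0 p0 s0.
  have := mulr_ge0 q0 r0; lra.
rewrite -mulrA ler_wpM2l// ?(le_trans _ K1)//.
by apply: le_trans (weightD _ _) _; rewrite weightN mulrC.
Qed.

Lemma decay_affine (a c : R * R) F n (C : R) : a.1 != 0 -> a.2 != 0 ->
  (forall x, `|F x| * weight x ^+ n <= C) ->
  exists D, forall x,
    `|F (a.1 * x.1 + c.1, a.2 * x.2 + c.2)| * weight x ^+ n <= D.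
Proof.
move=> a10 a20 FC; have [K K0 hK] := weight_affine c a10 a20.
exists (C * K ^+ n) => x.
set y := (_, _).
apply: (@le_trans _ _ (`|F y| * (K * weight y) ^+ n)).
  by rewrite ler_wpM2l// lerXn2r ?nnegrE ?mulr_ge0//; exact/ltW.
by rewrite exprMn mulrCA mulrC ler_wpM2r// exprn_ge0.
Qed.

Lemma dominated_affine (a c : R * R) F : a.1 != 0 -> a.2 != 0 ->
  dominated F ->
  dominated (fun x => F (a.1 * x.1 + c.1, a.2 * x.2 + c.2)).
Proof.
move=> a10 a20 [mF [C FC]]; split; first exact: measurable2_affine.
exact: decay_affine FC.
Qed.

Let plane_integral_affine_ge0 (a c : R * R) F : a.1 != 0 -> a.2 != 0 ->
  (forall x, 0 <= F x) -> dominated F ->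
  I2 F = `|a.1 * a.2| * I2 (fun x => F (a.1 * x.1 + c.1, a.2 * x.2 + c.2)).
Proof.
move=> a10 a20 F0 dF.
pose f := fun x : mR * mR => (a.1 * x.1 + c.1, a.2 * x.2 + c.2)%R : mR * mR.
have mf : measurable_fun setT f.
  apply: measurable_fun_pair; apply: measurable_funD => //;
  by apply: measurable_funM.
have a'0 : 0 <= `|a.1 * a.2| by [].
pose m0 : {measure set (mR * mR)%type -> \bar R} := pushforward plane_measure f.
pose m : {measure set (mR * mR)%type -> \bar R} := mscale (NngNum a'0) (m0 mf).
have mF : measurable_fun setT (EFin \o F : mR * mR -> \bar R).
  by apply/measurable_EFinP; case: dF.
rewrite /plane_integral /Rintegral (eq_measure_integral m); last first.
  by move=> A mA _; exact: (plane_measure_affine c a10 a20 mA).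
rewrite ge0_integral_mscale//=; last by move=> x _; rewrite lee_fin.
rewrite ge0_integral_pushforward//; last by move=> x _; rewrite /= lee_fin.
rewrite fineM// fin_num_abs.
have /integrableP[mG] := dominated_integrable (dominated_affine c a10 a20 dF).
by apply: le_lt_trans; rewrite preimage_setT; exact: (le_abse_integral plane_measure measurableT mG).
Qed.

(** The image measure formula is available for nonnegative integrands; writing [F] as the difference
    of [F + |F|] and [|F|] extends it to signed ones. *)
Lemma plane_integral_affine (a c : R * R) F : a.1 != 0 -> a.2 != 0 ->
  dominated F ->
  I2 F = `|a.1 * a.2| * I2 (fun x => F (a.1 * x.1 + c.1, a.2 * x.2 + c.2)).
Proof.
move=> a10 a20 dF; have dF' := dominated_affine c a10 a20 dF.
have dN := dominated_norm dF; have dN' := dominated_affine c a10 a20 dN.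
rewrite (eq_plane_integral (G := fun x => (F x + `|F x|) - `|F x|)); last first.
  by move=> x; rewrite addrK.
rewrite (plane_integralB (dominatedD dF dN) dN).
rewrite (plane_integral_affine_ge0 c a10 a20 _ dN)//.
rewrite (plane_integral_affine_ge0 c a10 a20 _ (dominatedD dF dN)); last first.
  by move=> x; rewrite addrC -lerBlDr sub0r -normrN ler_norm.
rewrite -mulrBr -(plane_integralB (dominatedD dF' dN') dN').
by congr (_ * _); apply: eq_plane_integral => x; rewrite addrK.
Qed.

Lemma plane_integral_shift c F : dominated F -> I2 (fun x => F (x + c)) = I2 F.
Proof.
move=> dF; rewrite (@plane_integral_affine (1, 1) c F) ?oner_neq0//= mulr1 normr1 mul1r.
by apply: eq_plane_integral => -[x1 x2]; rewrite !mul1r.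
Qed.

Lemma plane_integral_reflect c F : dominated F ->
  I2 (fun x => F (c - x)) = I2 F.
Proof.
move=> dF; rewrite (@plane_integral_affine (-1, -1) c F) ?oppr_eq0 ?oner_neq0//=.
rewrite mulrNN mulr1 normr1 mul1r.
by apply: eq_plane_integral => -[x1 x2]; rewrite !mulN1r; congr F; rewrite addrC.
Qed.

Lemma dominated_shift c F : dominated F -> dominated (fun x => F (x + c)).
Proof.
move=> dF; have := @dominated_affine (1, 1) c F (oner_neq0 R) (oner_neq0 R) dF.
by congr (dominated _); apply/funext => -[x1 x2]; rewrite !mul1r.
Qed.

Lemma dominated_reflect c F : dominated F -> dominated (fun x => F (c - x)).
Proof.
have N1 : (-1 : R) != 0 by rewrite oppr_eq0 oner_neq0.
move=> dF; have := @dominated_affine (-1, -1) c F N1 N1 dF.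
congr (dominated _); apply/funext => -[x1 x2].
by rewrite /= !mulN1r (addrC (- x1)) (addrC (- x2)).
Qed.

End plane_integral.

(** * Fubini's theorem for pairs of points *)

Section fubini_plane.
Variable R : realType.
Implicit Types (x y : R * R) (F : R * R -> R) (K : R * R -> R * R -> R).
Local Notation mR := (measurableTypeR R).
Local Notation I2 := (@plane_integral R).

Definition measurable4 K :=
  measurable_fun [set: (mR * mR) * (mR * mR)] (fun p : (mR * mR) * (mR * mR) => K p.1 p.2).

Lemma measurable4_slice K x : measurable4 K -> measurable2 (K x).
Proof. by move=> mK; exact: (measurableT_comp mK (pair1_measurable x)). Qed.

Lemma measurable4M K L : measurable4 K -> measurable4 L ->
  measurable4 (fun x y => K x y * L x y).
Proof. exact: measurable_funM. Qed.

Lemma measurable4_fst F : measurable2 F -> measurable4 (fun x _ => F x).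
Proof. by move=> mF; apply: (measurableT_comp mF). Qed.

Lemma measurable4_snd F : measurable2 F -> measurable4 (fun _ y => F y).
Proof. by move=> mF; apply: (measurableT_comp mF). Qed.

Lemma measurable4B F : measurable2 F -> measurable4 (fun x y => F (x - y)).
Proof.
move=> mF; apply: (measurableT_comp mF).
by apply: measurable_fun_pair; apply: measurable_funB;
  apply: measurableT_comp.
Qed.

Lemma measurable4_swap K : measurable4 K -> measurable4 (fun x y => K y x).
Proof.
move=> mK.
exact: (measurableT_comp mK (@measurable_swap _ _ (mR * mR)%type (mR * mR)%type)).
Qed.

(** The decay hypothesis dominates [K] by a product of two integrable weights, so Tonelli's theorem
    gives integrability. Applications obtain this bound from [rapid4] or [conv_dominated]. *)
Lemma fubini_plane K C : measurable4 K ->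
  (forall x y, `|K x y| * (weight x ^+ 4 * weight y ^+ 4) <= C) ->
  I2 (fun x => I2 (K x)) = I2 (fun y => I2 (K^~ y)).
Proof.
move=> mK KC.
have C0 : 0 <= C.
  by apply: le_trans (KC 0 0); apply: mulr_ge0 => //; exact: mulr_ge0.
have dom L : measurable4 L ->
  (forall x y, `|L x y| * (weight x ^+ 4 * weight y ^+ 4) <= C) ->
  forall x, dominated (L x).
  move=> mL LC x; split; first exact: measurable4_slice.
  exists C => y; apply: le_trans (LC x y); rewrite ler_wpM2l//.
  by rewrite ler_peMl //.
have fin L : measurable4 L ->
  (forall x y, `|L x y| * (weight x ^+ 4 * weight y ^+ 4) <= C) ->
  I2 (fun x => I2 (L x)) = fine (\int[plane_measure]_x \int[plane_measure]_y (L x y)%:E)%E.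
  move=> mL LC; rewrite /plane_integral/Rintegral; congr fine.
  apply: eq_integral => x _; rewrite fineK//; apply: integrable_fin_num => //.
  exact/dominated_integrable/(dom _ mL LC).
rewrite fin// (fin (fun y x => K x y)); last 2 first.
- exact: measurable4_swap.
- by move=> y x; rewrite [X in _ * X]mulrC.
congr fine; apply: (@Fubini _ _ _ _ _ plane_measure plane_measure (fun p => (K p.1 p.2)%:E)).
apply/integrable12ltyP; first exact/measurable_EFinP.
have w0 x : 0 <= (weight x ^+ 4)^-1 by rewrite invr_ge0.
have dw : dominated (fun x => (weight x ^+ 4)^-1).
  split.
    exact: measurable2_weightV.
  by exists 1 => x; rewrite ger0_norm// mulVf// gt_eqF// weightX_gt0.
have mw : measurable_fun [set: mR * mR] (fun x : mR * mR => ((weight x ^+ 4)^-1)%:E).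
  by apply/measurable_EFinP; case: dw.
have [J JE] : exists J : R, (\int[plane_measure]_y ((weight y ^+ 4)^-1)%:E = J%:E)%E.
  exists (I2 (fun y => (weight y ^+ 4)^-1)); rewrite fineK//.
  by apply: integrable_fin_num => //; exact: dominated_integrable dw.
have J0 : 0 <= J.
  by rewrite -lee_fin -JE; apply: integral_ge0 => y _; rewrite lee_fin.
apply: (@le_lt_trans _ _ (\int[plane_measure]_x \int[plane_measure]_y
   (C * (weight x ^+ 4)^-1 * (weight y ^+ 4)^-1)%:E)%E).
  apply: ge0_le_integral => //.
  - by move=> x _; exact: integral_ge0.
  - apply: (@measurable_fun_fubini_tonelli_F _ _ (mR * mR)%type (mR * mR)%type R plane_measure (fun p => `|(K p.1 p.2)%:E|%E)) => //.
    by apply: measurableT_comp => //; exact/measurable_EFinP.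
  - apply: (@measurable_fun_fubini_tonelli_F _ _ (mR * mR)%type (mR * mR)%type R plane_measure
      (fun p => (C * (weight p.1 ^+ 4)^-1 * (weight p.2 ^+ 4)^-1)%:E)) => //.
      apply/measurable_EFinP.
      apply: (@measurable4M (fun x _ => C * (weight x ^+ 4)^-1) (fun _ y => (weight y ^+ 4)^-1)).
        apply: measurable4_fst; apply: (measurable2M (measurable2_cst C)).
        exact: measurable2_weightV.
      by apply: measurable4_snd; exact: measurable2_weightV.
    by move=> p; rewrite lee_fin !mulr_ge0.
  move=> x _; apply: ge0_le_integral => //.
  - apply: measurableT_comp => //; apply/measurable_EFinP; exact: (measurable4_slice x mK).
  - apply/measurable_EFinP; apply: (measurable2M (measurable2_cst (C * (weight x ^+ 4)^-1))).
    exact: measurable2_weightV.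
  move=> y _; rewrite lee_fin -mulrA -invfM ler_pdivlMr ?mulr_gt0//.
under eq_integral => x _.
  under eq_integral => y _ do rewrite EFinM.
  rewrite ge0_integralZl//; last 2 first.
  - by move=> y _; rewrite lee_fin.
  - by rewrite lee_fin mulr_ge0.
  rewrite JE -EFinM mulrAC EFinM.
  over.
rewrite /= ge0_integralZl//; last 2 first.
- by move=> y _; rewrite lee_fin.
- by rewrite lee_fin mulr_ge0.
by rewrite JE -EFinM ltry.
Qed.

(** Measurability of partial integrals is known for nonnegative integrands, which [K + |K|] and
    [|K|] are. *)
Lemma measurable2_integral K : measurable4 K ->
  (forall x, exists C, forall y, `|K x y| * weight y ^+ 4 <= C) ->
  measurable2 (fun x => I2 (K x)).
Proof.
move=> mK KC.
have dK x : dominated (K x) by split; [exact: measurable4_slice|exact: KC].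
have mN : measurable4 (fun x y => `|K x y|) by exact: measurableT_comp.
have -> : (fun x => I2 (K x)) =
    (fun x => I2 (fun y => K x y + `|K x y|) - I2 (fun y => `|K x y|)).
  apply/funext => x; rewrite plane_integralD ?addrK//.
  exact: dominated_norm.
have nneg L : measurable4 L -> (forall x y, 0 <= L x y) ->
    measurable2 (fun x => I2 (L x)).
  move=> mL L0; apply: (@measurableT_comp _ _ _ _ _ _ (@fine R) setT) => //.
  apply: (@measurable_fun_fubini_tonelli_F _ _ (mR * mR)%type (mR * mR)%type R plane_measure (fun p => (L p.1 p.2)%:E)).
    exact/measurable_EFinP.
  by move=> p; rewrite lee_fin.
apply: measurable2B; apply: nneg => //.
  exact: measurable_funD.
by move=> x y; rewrite addrC -lerBlDr sub0r -normrN ler_norm.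
Qed.

End fubini_plane.

(** * Rapidly decaying functions, convolution and tempered distributions *)

Section growth.
Variable R : realType.
Implicit Types (x h : R * R) (a f F G : R * R -> R) (k m n : nat) (w : seq bool).

(** No regularity beyond measurability is asked, so that the class is stable under absolute values
    and under restriction to measurable sets. *)
Definition rapid a := measurable2 a /\
  forall k, exists C, forall x, `|a x| * weight x ^+ k <= C.

Definition poly_growth G := measurable2 G /\
  exists k C, forall x, `|G x| <= C * weight x ^+ k.

Lemma rapid_dominated a : rapid a -> dominated a.
Proof. by move=> [ma aC]; split. Qed.

Lemma weight_bound_ge0 (r C : R) x k : `|r| <= C * weight x ^+ k -> 0 <= C.
Proof. by rewrite -ler_pdivrMr//; apply: le_trans; rewrite divr_ge0. Qed.

Lemma rapidMpoly a G : rapid a -> poly_growth G -> rapid (fun x => a x * G x).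
Proof.
move=> [ma aC] [mG [k [C GC]]]; split; first exact: measurable2M.
move=> n; have [D aD] := aC (k + n)%N.
have C0 := weight_bound_ge0 (GC 0).
exists (D * C) => x; rewrite normrM.
apply: (@le_trans _ _ (`|a x| * (C * weight x ^+ k) * weight x ^+ n)).
  by rewrite ler_wpM2r// ler_wpM2l.
have -> : `|a x| * (C * weight x ^+ k) * weight x ^+ n =
    `|a x| * weight x ^+ (k + n) * C by rewrite exprD; ring.
exact: ler_wpM2r.
Qed.

Lemma rapid_norm a : rapid a -> rapid (fun x => `|a x|).
Proof.
move=> [ma aC]; split; first exact: measurable2_norm.
by move=> k; have [C CP] := aC k; exists C => x; rewrite normr_id.
Qed.

Lemma poly_growth_weight k : poly_growth (fun x => weight x ^+ k).
Proof.
split; first exact: (measurable2X k (@measurable2_weight R)).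
by exists k, 1 => x; rewrite mul1r ger0_norm.
Qed.

Lemma poly_growth_cst (c : R) : poly_growth (fun=> c).
Proof.
by split; [exact: measurable2_cst|exists 0%N, `|c| => x; rewrite expr0 mulr1].
Qed.

Lemma poly_growth_coord1 : poly_growth (fst : R * R -> R).
Proof.
split; first exact: measurable2_fst.
by exists 1%N, 1 => x; rewrite mul1r expr1 /weight addrAC lerDr addr_ge0.
Qed.

Lemma poly_growthD F G : poly_growth F -> poly_growth G ->
  poly_growth (fun x => F x + G x).
Proof.
move=> [mF [k [C FC]]] [mG [n [D GD]]]; split; first exact: measurable2D.
have D0 := weight_bound_ge0 (GD 0).
have C0 := weight_bound_ge0 (FC 0).
exists (maxn k n), (C + D) => x; rewrite mulrDl.
apply: le_trans (ler_normD _ _) _; apply: lerD.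
  by apply: le_trans (FC x) _; rewrite ler_wpM2l// weightX_le// leq_maxl.
by apply: le_trans (GD x) _; rewrite ler_wpM2l// weightX_le// leq_maxr.
Qed.

Lemma poly_growthM F G : poly_growth F -> poly_growth G ->
  poly_growth (fun x => F x * G x).
Proof.
move=> [mF [k [C FC]]] [mG [n [D GD]]]; split; first exact: measurable2M.
exists (k + n)%N, (C * D) => x; rewrite exprD mulrACA normrM.
by apply: ler_pM.
Qed.

Lemma measurable2_reflect c F : measurable2 F -> measurable2 (fun x => F (c - x)).
Proof.
by move=> mF; exact: (measurable4_slice c (measurable4B mF)).
Qed.

Lemma poly_growth_reflect c F : poly_growth F -> poly_growth (fun x => F (c - x)).
Proof.
move=> [mF [k [C FC]]]; split; first exact: measurable2_reflect.
have C0 := weight_bound_ge0 (FC 0).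
exists k, (C * weight c ^+ k) => x; apply: le_trans (FC _) _.
rewrite -mulrA ler_wpM2l//; apply: le_trans (weightDX _ _ _) _.
by rewrite weightN.
Qed.

Lemma rapid_reflect c F : rapid F -> rapid (fun x => F (c - x)).
Proof.
move=> [mF FC]; split; first exact: measurable2_reflect.
move=> k; have [C CP] := FC k; exists (C * weight c ^+ k) => x.
apply: (@le_trans _ _ (`|F (c - x)| * (weight (c - x) ^+ k * weight c ^+ k))).
  rewrite ler_wpM2l// mulrC -(weightN (c - x)) opprB.
  by have := weightDX c (x - c) k; rewrite addrC subrK.
by rewrite mulrA ler_wpM2r.
Qed.

Lemma rapid_shift c F : rapid F -> rapid (fun x => F (x + c)).
Proof.
move=> rF; have := rapid_reflect 0 (rapid_reflect c rF).
by congr (rapid _); apply/funext => x; rewrite sub0r opprK addrC.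
Qed.

Lemma weight_scale (t : R) h : 0 <= t <= 1 -> weight (t *: h) <= weight h.
Proof.
move=> /andP[t0 t1]; rewrite /weight/= -!addrA lerD2l.
by apply: lerD; rewrite [`|_ *: _|]normrM ger0_norm// ler_piMl.
Qed.

(** The weight is at most three times the largest of [1], [|x.1|] and [|x.2|]. Thereby three
    monomial seminorms control one weighted supremum. *)
Lemma weightX_poly x k :
  weight x ^+ k <= 3 ^+ k * (1 + `|x.1| ^+ k + `|x.2| ^+ k).
Proof.
have [|] := leP `|x.1| `|x.2| => h12; last have {}h12 := ltW h12.
  have [h|h] := leP 1 `|x.2|.
    apply: (@le_trans _ _ ((3 * `|x.2|) ^+ k)).
      by rewrite lerXn2r ?nnegrE ?mulr_ge0 ?(le_trans ler01)// /weight; lra.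
    rewrite exprMn ler_wpM2l ?exprn_ge0// lerDr addr_ge0// exprn_ge0//.
  apply: (@le_trans _ _ (3 ^+ k)).
    by rewrite lerXn2r ?nnegrE ?(le_trans ler01)// /weight; lra.
  by rewrite ler_peMr ?exprn_ge0// -addrA lerDl addr_ge0// exprn_ge0.
have [h|h] := leP 1 `|x.1|.
  apply: (@le_trans _ _ ((3 * `|x.1|) ^+ k)).
    by rewrite lerXn2r ?nnegrE ?mulr_ge0 ?(le_trans ler01)// /weight; lra.
  by rewrite exprMn ler_wpM2l ?exprn_ge0// addrAC lerDr addr_ge0// exprn_ge0.
apply: (@le_trans _ _ (3 ^+ k)).
  by rewrite lerXn2r ?nnegrE ?(le_trans ler01)// /weight; lra.
by rewrite ler_peMr ?exprn_ge0// -addrA lerDl addr_ge0// exprn_ge0.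
Qed.

Lemma schwartz_decay f w k : is_schwartz f ->
  exists C, forall x, `|pderivs w f x| * weight x ^+ k <= C.
Proof.
move=> /is_schwartzP/(_ w)[_ bf].
have [C0 h0] := bf 0%N 0%N; have [C1 h1] := bf k 0%N; have [C2 h2] := bf 0%N k.
exists (3 ^+ k * (C0 + C1 + C2)) => x.
apply: le_trans (ler_wpM2l (normr_ge0 _) (weightX_poly x k)) _.
rewrite mulrCA ler_wpM2l ?exprn_ge0// !mulrDr mulr1 lerD// ?lerD//.
- by apply: le_trans (h0 x); rewrite !expr0 !mul1r.
- by apply: le_trans (h1 x); rewrite expr0 mulr1 normrM normrX mulrC.
- by apply: le_trans (h2 x); rewrite expr0 mul1r normrM normrX mulrC.
Qed.

Lemma ler_coord_weight x m n : `|x.1 ^+ m * x.2 ^+ n| <= weight x ^+ (m + n).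
Proof.
have w0 := ltW (weight_gt0 x).
rewrite normrM !normrX exprD; apply: ler_pM; rewrite ?exprn_ge0//.
  by rewrite lerXn2r ?nnegrE// /weight addrAC lerDr addr_ge0.
by rewrite lerXn2r ?nnegrE// /weight lerDr addr_ge0.
Qed.

Lemma decay_schwartz f : (forall w x, differentiable (pderivs w f) x) ->
  (forall w k, exists C, forall x, `|pderivs w f x| * weight x ^+ k <= C) ->
  is_schwartz f.
Proof.
move=> df bf; apply/is_schwartzP => w; split=> // m n.
have [C hC] := bf w (m + n)%N; exists C => x; apply: le_trans (hC x).
by rewrite normrM mulrC ler_wpM2l// ler_coord_weight.
Qed.

Lemma schwartz_continuous f : is_schwartz f -> continuous f.
Proof. by move=> [df _] x; exact/differentiable_continuous/(df [::]). Qed.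

Lemma schwartz_rapid f : is_schwartz f -> rapid f.
Proof.
move=> sf; split; first exact: (continuous_measurable2 (schwartz_continuous sf)).
by move=> k; exact: (schwartz_decay [::] k sf).
Qed.

End growth.

(** * Differentiability from a quadratic remainder *)

Lemma expansion_is_diff (R : numFieldType) (V W : normedModType R) (f : V -> W)
    (df : {linear V -> W}) x :
  continuous df -> f \o shift x = cst (f x) + df +o_ 0 id -> is_diff x f df.
Proof.
move=> dfc dxf; split; last exact: diff_unique.
apply/diffP => /=.
(* The differential is a chosen value; it meets its specification as soon as some linear map does,
   here [df]. *)
apply: (@getPex _ (fun (df : {linear V -> W}) => continuous df /\
  forall y, f y = f (lim (nbhs x)) + df (y - lim (nbhs x))
                  +o_(y \near x) (y - lim (nbhs x)))).
exists df; split=> //; apply: eqaddoEx => z.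
have hdf (h : V -> W) : (f \o shift x = cst (f x) + h +o_ 0 id) ->
    h = f \o shift x - cst (f x) +o_ 0 id.
  move=> hdf; apply: eqaddoE.
  rewrite hdf addrAC -!addrA addrC !addrA subrK.
  rewrite -[LHS]addr0 -addrA; congr (_ + _).
  by apply/eqP; rewrite eq_sym addrC addr_eq0 oppo.
rewrite (hdf _ dxf) !addrA lim_id // /(_ \o _) /= subrK [f _ + _]addrC addrK.
rewrite -addrA -[LHS]addr0; congr (_ + _).
apply/eqP; rewrite eq_sym addrC addr_eq0 oppox; apply/eqP.
rewrite [in LHS]littleo_center0 (comp_centerK x id).
by rewrite -[- _ in RHS](comp_centerK x).
Qed.

Lemma quadratic_is_diff (R : realFieldType) (V W : normedModType R) (f : V -> W)
    (df : {linear V -> W}) x (C : R) : continuous df ->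
  (forall h, `|f (h + x) - f x - df h| <= C * `|h| ^+ 2) -> is_diff x f df.
Proof.
move=> dfc H; apply: expansion_is_diff => //.
apply/eqaddoP => _/posnumP[e].
have C1 : 0 < `|C| + 1 by rewrite ltr_pwDr.
apply/nbhs_ballP; exists (e%:num / (`|C| + 1)); first by rewrite /= divr_gt0.
move=> h; rewrite -ball_normE/= sub0r normrN => hd.
rewrite [leLHS](_ : _ = `|f (h + x) - f x - df h|); last first.
  by rewrite -addrA -opprD.
apply: le_trans (H h) _; rewrite expr2 mulrA ler_wpM2r//.
move: hd; rewrite ltr_pdivlMr// => /ltW; apply: le_trans.
by rewrite mulrC ler_wpM2l// (le_trans (ler_norm C))// lerDl.
Qed.

Section differential.
Variable R : realType.
Implicit Types (x y z h : R * R) (a f g : R * R -> R).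
Local Notation "''d1' f" := ('D_(unit_vec R false) f) (at level 10, f at next level).
Local Notation "''d2' f" := ('D_(unit_vec R true) f) (at level 10, f at next level).

Lemma derive_plane f x h : differentiable f x ->
  'D_h f x = 'd1 f x * h.1 + 'd2 f x * h.2.
Proof.
move=> df; rewrite !deriveE//.
rewrite [in LHS](_ : h = h.1 *: unit_vec R false + h.2 *: unit_vec R true); last first.
  by case: h => h1 h2; congr (_, _); rewrite /= /GRing.scale/= ?mulr1 ?mulr0 ?addr0 ?add0r.
by rewrite linearD !linearZ /= !(mulrC ('d f x _)).
Qed.

Lemma mvt_plane f x h : (forall z, differentiable f z) ->
  exists2 t : R, 0 <= t <= 1 &
    f (x + h) - f x = 'd1 f (x + t *: h) * h.1 + 'd2 f (x + t *: h) * h.2.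
Proof.
move=> df.
pose g (t : R) := f (x + t *: h).
have dg (t : R) : @is_derive R R^o R^o t 1 g ('D_h f (x + t *: h)).
  have dx : derivable f (x + t *: h) h by exact/diff_derivable.
  have E : (fun e : R => e^-1 *: ((g \o shift t) (e *: (1 : R^o)) - g t)) =
      (fun e : R => e^-1 *: ((f \o shift (x + t *: h)) (e *: h) - f (x + t *: h))).
    apply/funext => e; rewrite /g/= /shift/= scaler1 scalerDl addrCA.
    by rewrite [X in f X](_ : _ = e *: h + (x + t *: h))// .
  by split; rewrite /derivable ?/derive E.
have cg : {within `[0, 1], continuous g}.
  apply: continuous_subspaceT => t.
  by apply/differentiable_continuous/derivable1_diffP; case: (dg t).
have [t /[!in_itv]/= t01] := @MVT_segment R g _ 0 1 ler01 (fun t _ => dg t) cg.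
rewrite /g scale1r scale0r addr0 subr0 mulr1 derive_plane// => ->.
by exists t.
Qed.

(** The partial derivatives are read off from the expansion, so that a function given by an integral
    can be differentiated without passing to a limit under the integral. *)
Lemma differentiable_quadratic f x (a b C : R) :
  (forall h, `|f (x + h) - f x - (a * h.1 + b * h.2)| <= C * `|h| ^+ 2) ->
  differentiable f x /\ 'd1 f x = a /\ 'd2 f x = b.
Proof.
move=> H.
pose L0 (h : R * R) : R^o := a * h.1 + b * h.2.
have linL : linear L0.
  by move=> c u v; rewrite /L0/= /GRing.scale/=; ring.
pose L : {linear (R * R)%type -> R^o} := HB.pack L0 (GRing.isLinear.Build _ _ _ _ L0 linL).
have cL : continuous L.
  move=> h; apply: cvgD; apply: cvgM; [exact: cvg_cst|exact: cvg_fst|exact: cvg_cst|exact: cvg_snd].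
have [df dE] := @quadratic_is_diff R (R * R)%type R^o f L x C cL (fun h => etrans (congr1 (fun y => `|f y - _ - _| <= _) (addrC h x)) (H h)).
split=> //.
by rewrite !deriveE//; split; rewrite [LHS](congr1 (@^~ _) dE) /= /L0/= ?mulr1 ?mulr0 ?addr0 ?add0r.
Qed.

End differential.

(** * Convolution with Schwartz functions, and seminorm bounds for distributions *)

Section convolution.
Variable R : realType.
Implicit Types (x y z h : R * R) (a f g : R * R -> R) (k m n : nat) (w : seq bool).
Local Notation I2 := (@plane_integral R).
Local Notation "''d1' f" := ('D_(unit_vec R false) f) (at level 10, f at next level).
Local Notation "''d2' f" := ('D_(unit_vec R true) f) (at level 10, f at next level).

Definition plane_conv a g z := I2 (fun y => a y * g (z - y)).

Lemma rapid_dominated_conv a g z : rapid a -> poly_growth g ->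
  dominated (fun y => a y * g (z - y)).
Proof.
by move=> ra pg; apply/rapid_dominated/rapidMpoly => //; exact: poly_growth_reflect.
Qed.

Lemma rapid_poly a : rapid a -> poly_growth a.
Proof.
move=> [ma /(_ 0%N)[C aC]]; split=> //; exists 0%N, C => x.
by have := aC x; rewrite expr0 !mulr1.
Qed.

Lemma bounded_shift_weight g (B : R) k z y :
  (forall x, `|g x| * weight x ^+ k <= B) ->
  `|g (z - y)| * weight z ^+ k <= B * weight y ^+ k.
Proof.
move=> gB; apply: le_trans (ler_wpM2r (weightX_ge0 y k) (gB (z - y))).
by rewrite -mulrA ler_wpM2l// weightBX.
Qed.

Lemma conv_bound a g k (B : R) z : rapid a -> measurable2 g ->
  (forall x, `|g x| * weight x ^+ k <= B) ->
  `|plane_conv a g z| * weight z ^+ k <= B * I2 (fun y => `|a y| * weight y ^+ k).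
Proof.
move=> ra mg gB.
have pg : poly_growth g.
  split=> //; exists 0%N, B => x; rewrite expr0 mulr1; apply: le_trans (gB x).
  by rewrite ler_peMr.
have dw : dominated (fun y => `|a y| * weight y ^+ k).
  by apply/rapid_dominated/rapidMpoly; [exact: rapid_norm|exact: poly_growth_weight].
have E : weight z ^+ k * plane_conv a g z = I2 (fun y => weight z ^+ k * (a y * g (z - y))).
  by rewrite plane_integralZ//; exact: (rapid_dominated_conv z ra pg).
rewrite -(ger0_norm (weightX_ge0 z k)) -normrM mulrC E.
rewrite -plane_integralZ//; apply: ler_norm_plane_integral.
- by apply: dominatedZ; exact: (rapid_dominated_conv z ra pg).
- exact: dominatedZ.
move=> y; rewrite mulrCA !normrM [leRHS]mulrCA ler_wpM2l//.
by rewrite ger0_norm// mulrC; exact: bounded_shift_weight.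
Qed.

Lemma schwartz_deriv f i : is_schwartz f -> is_schwartz ('D_(unit_vec R i) f).
Proof. exact: (schwartz_pderivs [:: i]). Qed.

Lemma schwartz_diff f x : is_schwartz f -> differentiable f x.
Proof. by move=> [df _]; exact: (df [::]). Qed.

Lemma schwartz_poly f : is_schwartz f -> poly_growth f.
Proof. by move=> /schwartz_rapid/rapid_poly. Qed.

Lemma schwartz_bounded f : is_schwartz f -> exists C, forall x, `|f x| <= C.
Proof.
move=> sf; have [C hC] := schwartz_decay [::] 0 sf.
by exists C => x; have := hC x; rewrite expr0 mulr1.
Qed.

Lemma ler_coord_norm h : `|h.1| <= `|h| /\ `|h.2| <= `|h|.
Proof. by rewrite [`|h|]/(Num.max _ _) !le_max !lexx orbT. Qed.

(** The mean value theorem, applied to [f] and then to its first derivatives, whose own derivatives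
    are bounded. The constant is uniform in [x], which allows the expansion to be integrated in
    [conv_deriv]. *)
Lemma schwartz_taylor2 f : is_schwartz f -> exists C, forall x h,
  `|f (x + h) - f x - ('d1 f x * h.1 + 'd2 f x * h.2)| <= C * `|h| ^+ 2.
Proof.
move=> sf.
have lip i : exists C, forall x h,
    `|('D_(unit_vec R i) f) (x + h) - ('D_(unit_vec R i) f) x| <= C * `|h|.
  have sg := schwartz_deriv i sf; set g := 'D_(unit_vec R i) f in sg *.
  have [C1 h1] := schwartz_bounded (schwartz_deriv false sg).
  have [C2 h2] := schwartz_bounded (schwartz_deriv true sg).
  exists (C1 + C2) => x h.
  have [t _ ->] := mvt_plane x h (fun z => schwartz_diff z sg).
  apply: le_trans (ler_normD _ _) _; rewrite !normrM mulrDl.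
  have [n1 n2] := ler_coord_norm h.
  by apply: lerD; apply: ler_pM.
have [C1 h1] := lip false; have [C2 h2] := lip true.
exists (C1 + C2) => x h.
have [t t01 ->] := mvt_plane x h (fun z => schwartz_diff z sf).
have [n1 n2] := ler_coord_norm h.
have nt : `|t *: h| <= `|h|.
  by case/andP: t01 => t0 t1; rewrite normrZ ger0_norm// ler_piMl.
have n0 : 0 < `|(1, 0) : R * R|.
  by rewrite normr_gt0; apply/eqP => -[]/eqP; rewrite oner_eq0.
have C10 : 0 <= C1 by rewrite -(pmulr_lge0 _ n0); apply: le_trans (h1 0 (1, 0)).
have C20 : 0 <= C2 by rewrite -(pmulr_lge0 _ n0); apply: le_trans (h2 0 (1, 0)).
rewrite opprD addrACA -!mulrBl; apply: le_trans (ler_normD _ _) _.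
rewrite !normrM expr2 mulrA mulrDl mulrDl.
apply: lerD; apply: ler_pM => //.
  by apply: le_trans (h1 _ _) _; rewrite ler_wpM2l.
by apply: le_trans (h2 _ _) _; rewrite ler_wpM2l.
Qed.

(** Integrating the uniform second-order expansion of [g] against [a] yields a quadratic remainder
    for the convolution. *)
Lemma conv_deriv a g z : rapid a -> is_schwartz g ->
  differentiable (plane_conv a g) z /\
  forall i, 'D_(unit_vec R i) (plane_conv a g) z = plane_conv a ('D_(unit_vec R i) g) z.
Proof.
move=> ra sg; have [C hC] := schwartz_taylor2 sg.
have pg := schwartz_poly sg.
have pd i := schwartz_poly (schwartz_deriv i sg).
have dc i := rapid_dominated_conv z ra (pd i).
have dc0 := rapid_dominated_conv z ra pg.
have H h : `|plane_conv a g (z + h) - plane_conv a g z -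
    (plane_conv a ('d1 g) z * h.1 + plane_conv a ('d2 g) z * h.2)| <=
    (C * I2 (fun y => `|a y|)) * `|h| ^+ 2.
  pose A0 y := a y * g (z + h - y); pose A1 y := a y * g (z - y).
  pose A2 y := a y * 'd1 g (z - y); pose A3 y := a y * 'd2 g (z - y).
  have dA0 : dominated A0 := rapid_dominated_conv (z + h) ra pg.
  have dA1 : dominated A1 := dc0.
  have dA2 : dominated A2 := dc false.
  have dA3 : dominated A3 := dc true.
  have dA23 := dominatedD (dominatedZ h.1 dA2) (dominatedZ h.2 dA3).
  have dA := dominatedB (dominatedB dA0 dA1) dA23.
  have -> : plane_conv a g (z + h) - plane_conv a g z -
      (plane_conv a ('d1 g) z * h.1 + plane_conv a ('d2 g) z * h.2) =
      I2 (fun y => A0 y - A1 y - (h.1 * A2 y + h.2 * A3 y)).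
    rewrite (plane_integralB (dominatedB dA0 dA1) dA23) (plane_integralB dA0 dA1).
    rewrite (plane_integralD (dominatedZ h.1 dA2) (dominatedZ h.2 dA3)).
    by rewrite !plane_integralZ// [h.1 * _]mulrC [h.2 * _]mulrC.
  have dN := dominatedZ (C * `|h| ^+ 2) (dominated_norm (rapid_dominated ra)).
  rewrite mulrAC -(plane_integralZ _ (dominated_norm (rapid_dominated ra))).
  apply: (ler_norm_plane_integral dA dN) => y.
  have -> : A0 y - A1 y - (h.1 * A2 y + h.2 * A3 y) = a y * (g (z - y + h) - g (z - y) -
    ('d1 g (z - y) * h.1 + 'd2 g (z - y) * h.2)).
    by rewrite /A0 (addrAC z h) /A1 /A2 /A3; ring.
  by rewrite normrM mulrC ler_wpM2r.
have [dc' [e1 e2]] := differentiable_quadratic H.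
split; first exact: dc'.
by move=> [|]; [exact: e2|exact: e1].
Qed.

Lemma pderivs_conv a g w : rapid a -> is_schwartz g ->
  pderivs w (plane_conv a g) = plane_conv a (pderivs w g).
Proof.
move=> ra sg; elim: w => //= i w ->; apply/funext => z.
by apply: (conv_deriv z ra (schwartz_pderivs w sg)).2.
Qed.

Lemma conv_schwartz a g : rapid a -> is_schwartz g -> is_schwartz (plane_conv a g).
Proof.
move=> ra sg; apply: decay_schwartz => [w x|w k]; rewrite pderivs_conv//.
  exact: (conv_deriv x ra (schwartz_pderivs w sg)).1.
have sw := schwartz_pderivs w sg.
have [C hC] := schwartz_decay w k sg.
eexists => x; apply: (conv_bound x ra) => //.
exact: continuous_measurable2 (schwartz_continuous sw).
Qed.

Lemma plane_convC a g z : rapid a -> rapid g -> plane_conv a g z = plane_conv g a z.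
Proof.
move=> ra rg; rewrite /plane_conv.
rewrite -(plane_integral_reflect z (rapid_dominated_conv z ra (rapid_poly rg))).
by apply: eq_plane_integral => y; rewrite subKr mulrC.
Qed.

Lemma schwartz_seminorm_le phi (B : R) m n w : is_schwartz phi ->
  (forall x, `|pderivs w phi x| * weight x ^+ (m + n) <= B) ->
  (schwartz_seminorm (m, n, w) phi <= B%:E)%E.
Proof.
move=> sf hB; apply: ge_ereal_sup => _ [x _ <-]; rewrite lee_fin/=.
by rewrite normrM mulrC; apply: le_trans (hB x); rewrite ler_wpM2l// ler_coord_weight.
Qed.

Lemma schwartz_seminorm_fin p f : is_schwartz f ->
  schwartz_seminorm p f \is a fin_num.
Proof. by move=> [_ /(_ p) h]; rewrite ge0_fin_numE// schwartz_seminorm_ge0. Qed.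

(** The working form of temperedness: finitely many derivatives and a single power of the weight,
    the largest total degree of the monomials in the list of seminorms. *)
Lemma pairing_bound (D : tempered_distribution R) :
  exists C k (ws : seq (seq bool)), 0 <= C /\ forall (phi : schwartz R) (B : R),
    (forall w x, w \in ws -> `|pderivs w phi x| * weight x ^+ k <= B) ->
    `|D phi| <= C * B.
Proof.
have [C [s H]] := pairing_tempered D.
pose k := (\max_(p <- s) (p.1.1 + p.1.2))%N.
exists (`|C| * (size s)%:R), k, [seq p.2 | p <- s]; split; first by rewrite mulr_ge0.
move=> phi B hB; rewrite -lee_fin; apply: le_trans (H phi) _.
have sp := schwartzP phi.
apply: (@le_trans _ _ (`|C|%:E * \sum_(p <- s) schwartz_seminorm p phi)%E).
  apply: lee_wpmul2r; last by rewrite lee_fin ler_norm.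
  by apply: sume_ge0 => p _; exact: schwartz_seminorm_ge0.
rewrite -mulrA EFinM; apply: lee_wpmul2l => //.
apply: (@le_trans _ _ (\sum_(p <- s) B%:E)%E); last first.
  by rewrite sumEFin lee_fin big_const_seq iter_addr_0 count_predT mulr_natl.
rewrite !big_seq; apply: lee_sum => -[[m n] w] ps.
apply: schwartz_seminorm_le => // x.
have wws : w \in [seq p.2 | p <- s] by apply/mapP; exists (m, n, w).
apply: le_trans (hB w x wws); rewrite ler_wpM2l// weightX_le//.
exact: (@leq_bigmax_seq _ s xpredT (fun p => p.1.1 + p.1.2)%N (m, n, w)).
Qed.

(** Converse of [pairing_bound]: by [weightX_poly], three seminorms for each word suffice to recover
    the weighted bound. *)
Lemma tempered_of_bound (U : schwartz R -> R) (C : R) k (ws : seq (seq bool)) :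
  (forall (phi : schwartz R) (B : R),
    (forall w x, w \in ws -> `|pderivs w phi x| * weight x ^+ k <= B) ->
    `|U phi| <= C * B) ->
  exists (C : R) (s : seq (nat * nat * seq bool)), forall phi : schwartz R,
    (`|U phi|%:E <= C%:E * \sum_(p <- s) schwartz_seminorm p phi)%E.
Proof.
move=> H.
pose s : seq (nat * nat * seq bool) :=
  flatten [seq [:: (0, 0, w); (k, 0, w); (0, k, w)]%N | w <- ws].
exists (C * 3 ^+ k), s => phi; have sp := schwartzP phi.
have sf : (\sum_(p <- s) schwartz_seminorm p phi)%E \is a fin_num.
  by rewrite sum_fin_num; apply/allP => _ /mapP[p _ ->]; exact: schwartz_seminorm_fin.
rewrite -(fineK sf) -EFinM lee_fin -mulrA; apply: H => w x wws.
apply: le_trans (ler_wpM2l (normr_ge0 _) (weightX_poly x k)) _.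
rewrite mulrCA ler_wpM2l ?exprn_ge0// -lee_fin fineK//.
have sn0 p := schwartz_seminorm_ge0 p phi.
rewrite /s big_flatten big_map (big_rem w)//=.
apply: le_trans (leeDl _ _); last first.
  by apply: sume_ge0 => v _; apply: sume_ge0 => p _.
rewrite !big_cons big_nil adde0 addeA !mulrDr mulr1 !EFinD.
have ub m n : (`|x.1 ^+ m * x.2 ^+ n * pderivs w phi x|%:E <= schwartz_seminorm (m, n, w) phi)%E.
  by apply: ereal_sup_ubound; exists x.
apply: leeD; first apply: leeD.
- by apply: le_trans (ub 0 0)%N; rewrite !expr0 !mul1r.
- by apply: le_trans (ub k 0)%N; rewrite expr0 mulr1 normrM normrX mulrC.
- by apply: le_trans (ub 0 k)%N; rewrite expr0 mul1r normrM normrX mulrC.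
Qed.

End convolution.

Section shifts.
Variable R : realType.
Implicit Types (x y z h : R * R) (a f F : R * R -> R) (k n : nat) (w : seq bool).
Local Notation mR := (measurableTypeR R).

Lemma pderivs_shift c f w : is_schwartz f ->
  pderivs w (fun y => f (y + c)) = fun y => pderivs w f (y + c).
Proof.
move=> sf; have := pderivs_affine c 1 w sf; rewrite expr1n scale1r.
rewrite (_ : (fun y => f (c + 1 *: y)) = (fun y => f (y + c))); last first.
  by apply/funext => y; rewrite scale1r addrC.
by move=> ->; apply/funext => y; rewrite scale1r addrC.
Qed.

Lemma schwartz_decays f k (ws : seq (seq bool)) : is_schwartz f ->
  exists2 B, 0 <= B &
    forall w x, w \in ws -> `|pderivs w f x| * weight x ^+ k <= B.
Proof.
move=> sf; elim: ws => [|v ws [B B0 hB]]; first by exists 0.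
have [C hC] := schwartz_decay v k sf.
exists (Num.max C B) => [|w x]; first by rewrite le_max B0 orbT.
by rewrite inE le_max => /orP[/eqP ->|wws]; rewrite ?hC// hB// orbT.
Qed.

(** The weight at [x] is compared with the one at the intermediate point of the mean value theorem,
    at the cost of a factor [weight h ^+ k]. *)
Lemma mvt_plane_bound f x h k (B : R) : (forall z, differentiable f z) ->
  (forall i z, `|'D_(unit_vec R i) f z| * weight z ^+ k <= B) ->
  `|f (x + h) - f x| * weight x ^+ k <= B * (`|h.1| + `|h.2|) * weight h ^+ k.
Proof.
move=> df fB; have [t t01 ->] := mvt_plane x h df.
have H i : `|'D_(unit_vec R i) f (x + t *: h)| * weight x ^+ k <= B * weight h ^+ k.
  apply: le_trans (ler_wpM2r (weightX_ge0 h k) (fB i (x + t *: h))).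
  rewrite -mulrA ler_wpM2l//.
  have := weightBX x (- (t *: h)) k; rewrite opprK weightN => /le_trans; apply.
  rewrite ler_wpM2l//; apply: lerXn2r; rewrite ?nnegrE ?(ltW (weight_gt0 _))//.
  exact: weight_scale.
apply: le_trans (ler_wpM2r (weightX_ge0 x k) (ler_normD _ _)) _.
rewrite !normrM mulrDl mulrDr mulrDl; apply: lerD.
  by rewrite mulrAC [leRHS]mulrAC ler_wpM2r.
by rewrite mulrAC [leRHS]mulrAC ler_wpM2r.
Qed.

(** One further derivative in each direction is spent to make the translates of [f] locally
    Lipschitz in the translation, for the weighted bounds on the derivatives in [ws]. *)
Lemma schwartz_shift_lip f k (ws : seq (seq bool)) : is_schwartz f ->
  exists2 B, 0 <= B & forall w z y c, w \in ws ->
    `|pderivs w f (z - y) - pderivs w f (z - c)| * weight z ^+ k <=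
    B * (`|(y - c).1| + `|(y - c).2|) * weight (y - c) ^+ k * weight y ^+ k.
Proof.
move=> sf.
have [B B0 hB] := schwartz_decays k (map (cons false) ws ++ map (cons true) ws) sf.
exists B => // w z y c wws.
have sw := schwartz_pderivs w sf.
have hw i x : `|'D_(unit_vec R i) (pderivs w f) x| * weight x ^+ k <= B.
  apply: (hB (i :: w) x); rewrite mem_cat.
  by apply/orP; case: i; [right|left]; apply/mapP; exists w.
have := @mvt_plane_bound (pderivs w f) (z - y) (y - c) k B
  (fun z => schwartz_diff z sw) hw.
rewrite addrA subrK distrC => H.
apply: le_trans (ler_wpM2r (weightX_ge0 y k) H).
by rewrite -mulrA ler_wpM2l// weightBX.
Qed.

Lemma halving_eq0 (r X : R) : (forall n, `|r| <= X / 2 ^+ n) -> r = 0.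
Proof.
move=> H; apply/eqP; rewrite -normr_le0 leNgt; apply/negP => r0.
have X0 : 0 <= X by have := H 0%N; rewrite expr0 divr1; apply: le_trans.
have := archi_boundP (divr_ge0 X0 (ltW r0)); set n := Num.bound _ => hn.
have := H n; rewrite leNgt => /negP; apply.
rewrite ltr_pdivrMr ?exprn_gt0// mulrC -ltr_pdivrMr//; apply: lt_trans hn _.
by rewrite -natrX ltr_nat ltn_expl.
Qed.

Lemma lipschitz_continuous F y (L : R) :
  (forall c, `|y - c| <= 1 -> `|F y - F c| <= L * `|y - c|) ->
  {for y, continuous F}.
Proof.
move=> H; apply/cvgrPdist_le => /= e e0; apply/(@nbhs_ballP R (R * R)%type).
have L0 : 0 < `|L| + 1 by rewrite ltr_pwDr.
exists (Num.min 1 (e / (`|L| + 1))); first by rewrite /= lt_min ltr01 divr_gt0.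
move=> c; rewrite -ball_normE/= lt_min => /andP[/ltW y1 y2].
apply: le_trans (H c y1) _; move: y2; rewrite ltr_pdivlMr// => /ltW; apply: le_trans.
by rewrite mulrC ler_wpM2l// (le_trans (ler_norm L))// lerDl.
Qed.

Lemma rapid_indic a (A : set (mR * mR)) : rapid a -> measurable A ->
  rapid (fun y => a y * \1_A y).
Proof.
move=> ra mA; apply: rapidMpoly => //; split; first exact: measurable_indic.
exists 0%N, 1 => x; rewrite mulr1 indicE; case: (_ \in _) => /=; rewrite ?normr1 ?normr0//.
Qed.

End shifts.

(** * Exchanging a distribution with a convolution integral *)

Section pairing_conv.
Variable R : realType.
Implicit Types (x y z c : R * R) (a b : R * R -> R) (k n : nat) (w : seq bool).
Local Notation I2 := (@plane_integral R).
Local Notation mR := (measurableTypeR R).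
Variables (D : tempered_distribution R) (chi : schwartz R).

Let Dchi y := D (schwartz_shift (- y) chi).

Lemma pairingD (phi psi : schwartz R) : D (phi + psi) = D phi + D psi.
Proof. by rewrite -[X in D (X + _)]scale1r pairing_linear mul1r. Qed.

Lemma pairingZ (c : R) (phi : schwartz R) : D (c *: phi) = c * D phi.
Proof.
have D0 : D 0 = 0.
  by apply: (addIr (D 0)); rewrite -pairingD !add0r.
by rewrite -[c *: phi]addr0 pairing_linear D0 addr0.
Qed.

Lemma pairingB (phi psi : schwartz R) : D (phi - psi) = D phi - D psi.
Proof. by rewrite pairingD -scaleN1r pairingZ mulN1r. Qed.

Lemma conv_schwartz_pred a : rapid a -> plane_conv a chi \in @schwartz_pred R.
Proof. by move=> ra; apply/asboolP/conv_schwartz => //; exact: schwartzP. Qed.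

(** The convolution of [a] with [chi] as a total function of [a], with the default [0] when [a] is
    not rapid, so that [D (cs a)] can be written without a proof in its argument. *)
Let cs a : schwartz R :=
  if pselect (rapid a) is left ra then Schwartz (conv_schwartz_pred ra) else 0.

Let csE a : rapid a -> cs a = plane_conv a chi :> (_ -> _).
Proof. by rewrite /cs; case: pselect. Qed.

Let rchi : poly_growth chi.
Proof. exact/schwartz_poly/schwartzP. Qed.

Let csD a b : rapid a -> rapid b -> rapid (fun y => a y + b y) ->
  cs (fun y => a y + b y) = cs a + cs b.
Proof.
move=> ra rb rab; apply/val_inj => /=; rewrite !csE//; apply/funext => z.
rewrite [RHS](_ : _ = plane_conv a chi z + plane_conv b chi z)//.
rewrite /plane_conv -plane_integralD; last 2 first.
- exact: (rapid_dominated_conv z ra rchi).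
- exact: (rapid_dominated_conv z rb rchi).
by apply: eq_plane_integral => y; rewrite mulrDl.
Qed.

(** All bounds share one constant and one exponent. The last one drives the subdivision: if [a] is
    supported near [c], its convolution with [chi] is close to the multiple [I2 a] of the translate
    of [chi] to [c]. *)
Let Dchi_bounds : exists K k, 0 <= K /\ (forall y, `|Dchi y| <= K * weight y ^+ k) /\
  (forall y c, `|Dchi y - Dchi c| <=
    K * (`|(y - c).1| + `|(y - c).2|) * weight (y - c) ^+ k * weight y ^+ k) /\
  (forall a, rapid a -> `|D (cs a)| <= K * I2 (fun y => `|a y| * weight y ^+ k)) /\
  (forall a c (l : R), rapid a -> 0 <= l ->
    (forall y, a y != 0 -> `|(y - c).1| <= l /\ `|(y - c).2| <= l) ->
    `|D (cs a) - I2 a * Dchi c| <=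
      K * (l + l) * (1 + l + l) ^+ k * I2 (fun y => `|a y| * weight y ^+ k)).
Proof.
have [C [k [ws [C0 hD]]]] := pairing_bound D.
have sc := schwartzP chi.
have [B1 B10 h1] := schwartz_decays k ws sc.
have [B2 B20 h2] := schwartz_shift_lip k ws sc.
exists (C * (B1 + B2)), k; rewrite mulr_ge0 ?addr_ge0//; split=> //.
have le1 (r : R) : 0 <= r -> C * B1 * r <= C * (B1 + B2) * r.
  by move=> r0; rewrite ler_wpM2r// ler_wpM2l// lerDl.
have le2 (r : R) : 0 <= r -> C * B2 * r <= C * (B1 + B2) * r.
  by move=> r0; rewrite ler_wpM2r// ler_wpM2l// lerDr.
have W0 a : 0 <= I2 (fun y => `|a y| * weight y ^+ k).
  by apply: plane_integral_ge0 => y; rewrite mulr_ge0.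
split=> [y|].
  apply: le_trans (le1 _ _) => //; rewrite -mulrA; apply: hD => w z wws.
  rewrite pderivs_shift//; apply: bounded_shift_weight => x; exact: h1.
split=> [y c|].
  rewrite -[leRHS]mulrA -[leRHS]mulrA (mulrA (_ + _) (_ ^+ k)).
  apply: le_trans (le2 _ _); last by rewrite !mulr_ge0// addr_ge0.
  rewrite /Dchi -pairingB -mulrA; apply: hD => w z wws.
  have -> : pderivs w (schwartz_shift (- y) chi - schwartz_shift (- c) chi : schwartz R) z =
     pderivs w chi (z - y) - pderivs w chi (z - c).
    rewrite [X in pderivs w X](_ : _ = (-1) *: (fun z => chi (z + - c)) + (fun z => chi (z + - y))); last first.
      by apply/funext => x; rewrite scaleN1r addrC.
    rewrite pderivsD ?pderivs_shift//; last 2 first.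
    - exact: (schwartzP (schwartz_shift (- c) chi)).
    - exact: (schwartzP (schwartz_shift (- y) chi)).
    by rewrite scaleN1r addrC.
  by rewrite !mulrA; exact: h2.
split=> [a ra|a c l ra l0 al].
  apply: le_trans (le1 _ _) => //; rewrite -mulrA; apply: hD => w z wws.
  rewrite csE// pderivs_conv//; apply: conv_bound => //.
  - exact: (continuous_measurable2 (schwartz_continuous (schwartz_pderivs w sc))).
  - by move=> x; exact: h1.
rewrite -[leRHS]mulrA -[leRHS]mulrA (mulrA (_ + _) (_ ^+ k)).
apply: le_trans (le2 _ _); last first.
  by rewrite !mulr_ge0 ?addr_ge0// exprn_ge0// !addr_ge0.
rewrite /Dchi -pairingZ -pairingB -mulrA; apply: hD => w z wws.
have sw := schwartz_pderivs w sc.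
have dra := rapid_dominated ra.
have -> : pderivs w (cs a - I2 a *: schwartz_shift (- c) chi : schwartz R) z =
    I2 (fun y => a y * (pderivs w chi (z - y) - pderivs w chi (z - c))).
  rewrite [X in pderivs w X](_ : _ = (- I2 a) *: (fun z => chi (z + - c)) + plane_conv a chi); last first.
    by rewrite -csE//; apply/funext => x; rewrite scaleNr addrC.
  rewrite pderivsD ?pderivs_shift ?pderivs_conv//; last 2 first.
  - exact: (schwartzP (schwartz_shift (- c) chi)).
  - exact: conv_schwartz.
  transitivity (plane_conv a (pderivs w chi) z - pderivs w chi (z - c) * I2 a).
    by rewrite [LHS]addrC mulrC scaleNr.
  rewrite /plane_conv -plane_integralZ// -plane_integralB; last 2 first.
  - exact: (rapid_dominated_conv z ra (schwartz_poly sw)).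
  - exact: dominatedZ.
  by apply: eq_plane_integral => y; rewrite mulrBr [in RHS](mulrC (a y) (pderivs w chi (z - c))).
have dW : dominated (fun y => `|a y| * weight y ^+ k).
  by apply/rapid_dominated/rapidMpoly; [exact: rapid_norm|exact: poly_growth_weight].
have dd : dominated (fun y => a y * (pderivs w chi (z - y) - pderivs w chi (z - c))).
  apply: rapid_dominated; apply: rapidMpoly => //; apply: poly_growthD.
    exact: (poly_growth_reflect z (schwartz_poly sw)).
  exact: poly_growth_cst.
rewrite -(ger0_norm (weightX_ge0 z k)) -normrM mulrC -plane_integralZ//.
rewrite !mulrA -plane_integralZ//; apply: ler_norm_plane_integral.
- exact: dominatedZ.
- exact: dominatedZ.
move=> y; have [->|ay0] := eqVneq (a y) 0.
  by rewrite mul0r mulr0 normr0 mul0r mulr0.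
have [hl1 hl2] := al y ay0.
rewrite !normrM (ger0_norm (weightX_ge0 z k)) mulrCA [leRHS]mulrCA ler_wpM2l//.
rewrite mulrC; apply: le_trans (h2 w z y c wws) _; rewrite ler_wpM2r//.
apply: ler_pM; rewrite ?mulr_ge0 ?addr_ge0//.
  by rewrite ler_wpM2l// lerD.
apply: lerXn2r; rewrite ?nnegrE ?(ltW (weight_gt0 _)) ?addr_ge0//.
by rewrite /weight -!addrA lerD2l lerD.
Qed.

Let J a := D (cs a) - I2 (fun y => a y * Dchi y).

Lemma shift_pairing_continuous : continuous Dchi.
Proof.
have [K [k [K0 [hg [hl _]]]]] := Dchi_bounds.
move=> y; apply: (@lipschitz_continuous _ _ _ (K * 2 * 3 ^+ k * weight y ^+ k)) => c yc.
apply: le_trans (hl y c) _; rewrite [leRHS]mulrAC ler_wpM2r//.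
have [n1 n2] := ler_coord_norm (y - c).
rewrite [leRHS]mulrAC; apply: ler_pM => //; rewrite ?mulr_ge0 ?addr_ge0//.
  by rewrite -mulrA ler_wpM2l//; lra.
apply: lerXn2r; rewrite ?nnegrE ?(ltW (weight_gt0 _))//.
by rewrite /weight; lra.
Qed.

Lemma shift_pairing_poly : poly_growth Dchi.
Proof.
have [K [k [K0 [hg _]]]] := Dchi_bounds.
split; last by exists k, K.
exact: (continuous_measurable2 shift_pairing_continuous).
Qed.

(* [J] measures the failure of [D] to commute with the convolution integral.  It is
   linear, and on functions supported in a square of side [l] it is [O(l)] times the
   weighted mass; cutting the square in four and iterating shows that it vanishes
   there. *)
Let J0 a : rapid a -> J a = 0.
Proof.
have [K [k [K0 [hg [hl [hd hs]]]]]] := Dchi_bounds.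
have pD := shift_pairing_poly.
pose W a := I2 (fun y => `|a y| * weight y ^+ k).
have dW b : rapid b -> dominated (fun y => `|b y| * weight y ^+ k).
  by move=> rb; apply/rapid_dominated/rapidMpoly; [exact: rapid_norm|exact: poly_growth_weight].
have dD b : rapid b -> dominated (fun y => b y * Dchi y).
  by move=> rb; apply: rapid_dominated; exact: rapidMpoly.
have W0 b : 0 <= W b by apply: plane_integral_ge0 => y; rewrite mulr_ge0.
have JW b : rapid b -> `|J b| <= 2 * K * W b.
  move=> rb; apply: le_trans (ler_normB _ _) _.
  have -> : 2 * K * W b = K * W b + K * W b by ring.
  apply: lerD; first exact: hd.
  rewrite /W -plane_integralZ//; last exact: dW.
  apply: ler_norm_plane_integral; [exact: dD|by apply: dominatedZ; exact: dW|].
  by move=> y; rewrite normrM mulrCA ler_wpM2l.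
have split_indic (A : set (mR * mR)) b : measurable A -> rapid b ->
  [/\ rapid (fun y => b y * \1_A y), rapid (fun y => b y * \1_(~` A) y),
   J b = J (fun y => b y * \1_A y) + J (fun y => b y * \1_(~` A) y) &
   W b = W (fun y => b y * \1_A y) + W (fun y => b y * \1_(~` A) y)].
  move=> mA rb.
  have r1 := rapid_indic rb mA; have r2 := rapid_indic rb (measurableC mA).
  have E : b = fun y => b y * \1_A y + b y * \1_(~` A) y.
    apply/funext => y; rewrite !indicE in_setC -mulrDr.
    by case: (_ \in A); rewrite /= ?addr0 ?add0r mulr1.
  split=> //.
    rewrite {1}E /J csD//; last by rewrite -E.
    rewrite pairingD [RHS]addrACA -opprD; congr (_ - _).
    rewrite -plane_integralD; [|exact: dD|exact: dD].
    by apply: eq_plane_integral => y; rewrite mulrDl.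
  rewrite /W -plane_integralD; [|exact: dW|exact: dW].
  apply: eq_plane_integral => y; rewrite -mulrDl; congr (_ * _).
  rewrite !indicE in_setC !normrM.
  by case: (_ \in A); rewrite /= ?normr1 ?normr0 ?mulr1 ?mulr0 ?addr0 ?add0r.
pose sq b c (l : R) := forall y, b y != 0 -> `|(y - c).1| <= l /\ `|(y - c).2| <= l.
pose M (l : R) := 2 * K * (l + l) * (1 + l + l) ^+ k.
(* Both terms of [J b] are compared with [I2 b * Dchi c], each at the cost of half of [M l]. *)
have base b c l : rapid b -> 0 <= l -> sq b c l -> `|J b| <= M l * W b.
  move=> rb l0 bl.
  have -> : J b = (D (cs b) - I2 b * Dchi c) -
      (I2 (fun y => b y * Dchi y) - I2 b * Dchi c) by rewrite /J; ring.
  apply: le_trans (ler_normB _ _) _.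
  have -> : M l * W b = K * (l + l) * (1 + l + l) ^+ k * W b +
    K * (l + l) * (1 + l + l) ^+ k * W b by rewrite /M; ring.
  apply: lerD; first exact: hs.
  have drb := rapid_dominated rb.
  rewrite [X in _ - X]mulrC -plane_integralZ// -plane_integralB; [|exact: dD|exact: dominatedZ].
  rewrite /W -plane_integralZ; last exact: dW.
  apply: ler_norm_plane_integral.
  - by apply: dominatedB; [exact: dD|exact: dominatedZ].
  - by apply: dominatedZ; exact: dW.
  move=> y; rewrite (mulrC _ (b y)) -mulrBr normrM.
  have [->|by0] := eqVneq (b y) 0; first by rewrite normr0 !mul0r mulr0.
  have [hl1 hl2] := bl y by0.
  rewrite mulrCA ler_wpM2l//; apply: le_trans (hl y c) _; rewrite ler_wpM2r//.
  apply: ler_pM; rewrite ?mulr_ge0 ?addr_ge0//.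
    by rewrite ler_wpM2l// lerD.
  apply: lerXn2r; rewrite ?nnegrE ?(ltW (weight_gt0 _)) ?addr_ge0//.
  by rewrite /weight -!addrA lerD2l lerD.
(* Each round halves [l], and [M (l / 2) <= M l / 2], while [W] is additive over the four pieces; so
   every round gains a factor two. *)
have bis n : forall b c l, rapid b -> 0 <= l -> sq b c l ->
    `|J b| <= M l * W b / 2 ^+ n.
  elim: n => [|n IH] b c l rb l0 bl; first by rewrite expr0 divr1; exact: (base b c l).
  pose A1 : set (mR * mR) := fst @^-1` `[c.1, +oo[.
  pose A2 : set (mR * mR) := snd @^-1` `[c.2, +oo[.
  have mA1 : measurable A1 by rewrite -[A1]setTI; apply: measurable_fst.
  have mA2 : measurable A2 by rewrite -[A2]setTI; apply: measurable_snd.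
  have [r1 r2 -> ->] := split_indic A1 b mA1 rb.
  have [r11 r12 -> ->] := split_indic A2 _ mA2 r1.
  have [r21 r22 -> ->] := split_indic A2 _ mA2 r2.
  have l20 : 0 <= l / 2 by rewrite divr_ge0.
  have Ml b' : rapid b' -> M (l / 2) * W b' / 2 ^+ n <= M l * W b' / 2 ^+ n.+1.
    move=> rb'; have -> : M l * W b' / 2 ^+ n.+1 = M l / 2 * W b' / 2 ^+ n.
      by rewrite exprS invfM; ring.
    rewrite ler_wpM2r ?invr_ge0 ?exprn_ge0// ler_wpM2r//.
    have -> : M l / 2 = 2 * K * (l / 2 + l / 2) * (1 + l + l) ^+ k by rewrite /M; field.
    rewrite ler_wpM2l ?mulr_ge0 ?addr_ge0//.
    by apply: lerXn2r; rewrite ?nnegrE ?addr_ge0//; lra.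
  have lo t u : `|t - u| <= l -> u <= t -> `|t - (u + l / 2)| <= l / 2.
    by rewrite !ler_norml => /andP[h1 h2] ut; apply/andP; split; lra.
  have hi t u : `|t - u| <= l -> t < u -> `|t - (u - l / 2)| <= l / 2.
    by rewrite !ler_norml => /andP[h1 h2] ut; apply/andP; split; lra.
  have i1 y : \1_A1 y != 0 :> R -> c.1 <= y.1.
    by rewrite indicE; case: (boolP (y \in A1)) => [|_]; rewrite ?eqxx// inE /A1/= in_itv/= andbT.
  have i2 y : \1_A2 y != 0 :> R -> c.2 <= y.2.
    by rewrite indicE; case: (boolP (y \in A2)) => [|_]; rewrite ?eqxx// inE /A2/= in_itv/= andbT.
  have i1' y : \1_(~` A1) y != 0 :> R -> y.1 < c.1.
    rewrite indicE; case: (boolP (y \in ~` A1)) => [|_]; rewrite ?eqxx// inE /A1/= in_itv/= andbT.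
    by rewrite ltNge => /negP.
  have i2' y : \1_(~` A2) y != 0 :> R -> y.2 < c.2.
    rewrite indicE; case: (boolP (y \in ~` A2)) => [|_]; rewrite ?eqxx// inE /A2/= in_itv/= andbT.
    by rewrite ltNge => /negP.
  rewrite !mulrDr !mulrDl; apply: le_trans (ler_normD _ _) _.
  apply: lerD; apply: le_trans (ler_normD _ _) _; apply: lerD.
  - apply: le_trans (Ml _ r11); apply: (IH _ (c.1 + l / 2, c.2 + l / 2)) => // y.
    rewrite !mulf_eq0 !negb_or => /andP[/andP[/bl[h1 h2] /i1 ?] /i2 ?].
    by split; apply: lo.
  - apply: le_trans (Ml _ r12); apply: (IH _ (c.1 + l / 2, c.2 - l / 2)) => // y.
    rewrite !mulf_eq0 !negb_or => /andP[/andP[/bl[h1 h2] /i1 ?] /i2' ?].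
    by split; [apply: lo|apply: hi].
  - apply: le_trans (Ml _ r21); apply: (IH _ (c.1 - l / 2, c.2 + l / 2)) => // y.
    rewrite !mulf_eq0 !negb_or => /andP[/andP[/bl[h1 h2] /i1' ?] /i2 ?].
    by split; [apply: hi|apply: lo].
  - apply: le_trans (Ml _ r22); apply: (IH _ (c.1 - l / 2, c.2 - l / 2)) => // y.
    rewrite !mulf_eq0 !negb_or => /andP[/andP[/bl[h1 h2] /i1' ?] /i2' ?].
    by split; apply: hi.
have loc b c l : rapid b -> 0 <= l -> sq b c l -> J b = 0.
  move=> rb l0 bl; apply: (@halving_eq0 _ _ (M l * W b)) => n; exact: (bis n b c l).
(* For general [a], the part where the weight is at most [2 ^+ n] lies in a square, so [J] vanishes
   on it. The weighted mass of the rest is at most [W' / 2 ^+ n], at the price of one more power of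
   the weight. *)
move=> ra; pose W' := I2 (fun y => `|a y| * weight y ^+ k.+1).
apply: (@halving_eq0 _ _ (2 * K * W')) => n.
pose A : set (mR * mR) := (@weight R) @^-1` `]-oo, 2 ^+ n].
have mA : measurable A by rewrite -[A]setTI; apply: measurable2_weight.
have [r1 r2 -> _] := split_indic A a mA ra.
have iA y : \1_A y != 0 :> R -> weight y <= 2 ^+ n.
  by rewrite indicE; case: (boolP (y \in A)) => [|_]; rewrite ?eqxx// inE /A/= in_itv.
rewrite (loc _ 0 (2 ^+ n) r1); first last.
- move=> y; rewrite mulf_eq0 negb_or => /andP[_ /iA]; rewrite /weight subr0.
  have := normr_ge0 y.1; have := normr_ge0 y.2; move=> p1 p2 p3.
  by split; [move: p1 p2 p3|move: p1 p2 p3]; set s := `|y.1|; set t := `|y.2|; lra.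
- by rewrite exprn_ge0.
rewrite add0r; apply: le_trans (JW _ r2) _; rewrite -[leRHS]mulrA ler_wpM2l ?mulr_ge0//.
have dW' : dominated (fun y => `|a y| * weight y ^+ k.+1).
  by apply/rapid_dominated/rapidMpoly; [exact: rapid_norm|exact: poly_growth_weight].
rewrite mulrC -plane_integralZ//; apply: le_plane_integral.
- exact: dW.
- exact: dominatedZ.
move=> y; rewrite indicE in_setC.
have [_|yA] := boolP (y \in A).
  by rewrite /= mulr0 normr0 mul0r mulr_ge0 ?invr_ge0 ?exprn_ge0// mulr_ge0.
rewrite /= mulr1 mulrCA ler_wpM2l// mulrC exprS ler_pdivlMr ?exprn_gt0//.
rewrite mulrC ler_wpM2r// ltW// ltNge; apply: contra yA => wy.
by rewrite inE /A/= in_itv.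
Qed.

(** The vanishing of [J], restated for any Schwartz function that agrees pointwise with the
    convolution. It is the source of the semigroup property of mollification. *)
Lemma pairing_conv a (phi : schwartz R) : rapid a ->
  (forall z, phi z = plane_conv a chi z) ->
  D phi = I2 (fun y => a y * D (schwartz_shift (- y) chi)).
Proof.
move=> ra phiE; have -> : phi = cs a.
  by apply/val_inj => /=; rewrite csE//; apply/funext.
by apply/eqP; rewrite -subr_eq0; apply/eqP/J0.
Qed.

End pairing_conv.

(** * The kernel *)

Section fourier.
Variable R : realType.
Implicit Types (x y z k : R * R) (a b f F : R * R -> R).
Local Notation I2 := (@plane_integral R).
Local Notation mR := (measurableTypeR R).

Definition dotp x y : R := x.1 * y.1 + x.2 * y.2.

(* The phases [p = 0] and [p = - pi / 2] give the cosine and the sine transform; the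
   latter vanishes, i.e. the Fourier transform [g] is real. *)
Definition has_fourier f (g : R * R -> R) :=
  forall p k, I2 (fun x => cos (dotp k x + p) * f x) = cos p * g k.

Lemma measurable2_dotp k : measurable2 (dotp k).
Proof.
apply: (@measurable2D _ (fun x => k.1 * x.1) (fun x => k.2 * x.2)).
  exact: (measurable2M (measurable2_cst k.1) (@measurable2_fst R)).
exact: (measurable2M (measurable2_cst k.2) (@measurable2_snd R)).
Qed.

Lemma poly_growth_cos F : measurable2 F -> poly_growth (fun x => cos (F x)).
Proof.
move=> mF; split.
  apply: (@measurableT_comp _ _ _ _ _ _ (@cos R) setT) => //.
  exact: continuous_measurable_fun (@continuous_cos R).
by exists 0%N, 1 => x; rewrite expr0 mulr1 ler_norml cos_geN1 cos_le1.
Qed.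

Lemma poly_growth_wave k (p : R) : poly_growth (fun x => cos (dotp k x + p)).
Proof.
apply: poly_growth_cos; apply: measurable2D; first exact: measurable2_dotp.
exact: measurable2_cst.
Qed.

Lemma measurable4_wave c (q : R) : measurable4 (fun x k => cos (dotp (x + c) k + q)).
Proof.
apply: (@measurableT_comp _ _ _ _ _ _ (@cos R) setT) => //.
  exact: continuous_measurable_fun (@continuous_cos R).
apply: measurable_funD => //; apply: measurable_funD; apply: measurable_funM.
- apply: measurable_funD => //; exact: (measurableT_comp (@measurable_fst _ _ mR mR)).
- exact: (measurableT_comp (@measurable_fst _ _ mR mR)).
- apply: measurable_funD => //; exact: (measurableT_comp (@measurable_snd _ _ mR mR)).
- exact: (measurableT_comp (@measurable_snd _ _ mR mR)).
Qed.

Lemma rapid_wave f k (p : R) : rapid f -> rapid (fun x => cos (dotp k x + p) * f x).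
Proof.
move=> rf; have := rapidMpoly rf (poly_growth_wave k p).
by congr (rapid _); apply/funext => x; rewrite mulrC.
Qed.

Lemma rapid4 a b : rapid a -> rapid b ->
  exists C, forall x y, `|a x * b y| * (weight x ^+ 4 * weight y ^+ 4) <= C.
Proof.
move=> [_ /(_ 4%N)[A hA]] [_ /(_ 4%N)[B hB]]; exists (A * B) => x y.
rewrite normrM mulrACA; apply: ler_pM => //; exact: mulr_ge0.
Qed.

Lemma rapidN f : rapid f -> rapid (fun x => f (- x)).
Proof.
move=> /(rapid_reflect 0); congr (rapid _); apply/funext => x; by rewrite sub0r.
Qed.

Lemma has_fourier_reflect f g : rapid f -> has_fourier f g ->
  has_fourier (fun x => f (- x)) g.
Proof.
move=> rf H p k.
have dN := rapid_dominated (rapid_wave k p (rapidN rf)).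
rewrite -(plane_integral_reflect 0 dN).
rewrite -(cosN p) -(H (- p) k); apply: eq_plane_integral => x.
rewrite !sub0r opprK -[in RHS]cosN; congr (cos _ * _).
by rewrite /dotp/= !mulrN; ring.
Qed.

Lemma conv_dominated a b F : rapid a -> rapid b -> poly_growth F ->
  exists C, forall z y,
    `|F z * (a y * b (z - y))| * (weight z ^+ 4 * weight y ^+ 4) <= C.
Proof.
move=> [_ ra] [_ rb] [_ [n [K FK]]].
(* Of the powers of [weight y], [4 + n] pay for replacing [z] by [z - y] in the weight, where [n]
   are due to the growth of [F] and four to integrability in [z]; the other four give integrability
   in [y]. *)
have [A hA] := ra (8 + n)%N; have [B hB] := rb (4 + n)%N.
have K0 := weight_bound_ge0 (FK 0).
exists (K * (A * B)) => z y.
have wle : weight z ^+ (4 + n) * weight y ^+ 4 <=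
    weight y ^+ (8 + n) * weight (z - y) ^+ (4 + n).
  rewrite (_ : 8 + n = (4 + n) + 4)%N; last by rewrite addnAC.
  rewrite (exprD (weight y)) (mulrC _ (weight (z - y) ^+ _)) [leRHS]mulrA.
  by apply: ler_wpM2r => //; exact: weightBX.
apply: (@le_trans _ _ (K * (`|a y| * `|b (z - y)|) * (weight z ^+ (4 + n) * weight y ^+ 4))).
  rewrite !normrM exprD [leRHS](_ : _ = (K * weight z ^+ n) *
    (`|a y| * `|b (z - y)|) * (weight z ^+ 4 * weight y ^+ 4)); last by ring.
  apply: ler_wpM2r; first exact: mulr_ge0.
  by apply: ler_wpM2r; first exact: mulr_ge0.
rewrite -mulrA ler_wpM2l//; apply: le_trans (ler_wpM2l _ wle) _.
  exact: mulr_ge0.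
by rewrite mulrACA; apply: ler_pM => //; exact: mulr_ge0.
Qed.

(** After a translation by [y] the inner integral is the transform of [b] with phase [dotp k y + p],
    which produces the wave for [a]. Quantifying over phases thus replaces complex exponentials. *)
Lemma has_fourier_conv a b ga gb : rapid a -> rapid b ->
  has_fourier a ga -> has_fourier b gb ->
  has_fourier (plane_conv a b) (fun k => ga k * gb k).
Proof.
move=> ra rb Ha Hb p k.
have [C hC] := conv_dominated ra rb (poly_growth_wave k p).
transitivity (I2 (fun z => I2 (fun y => cos (dotp k z + p) * (a y * b (z - y))))).
  apply: eq_plane_integral => z; rewrite /plane_conv plane_integralZ//.
  exact: (rapid_dominated_conv z ra (rapid_poly rb)).
rewrite (fubini_plane _ hC); last first.
  apply: measurable4M; first exact: (measurable4_fst (poly_growth_wave k p).1).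
  by apply: measurable4M; [exact: (measurable4_snd ra.1)|exact: (measurable4B rb.1)].
rewrite mulrA -Ha mulrC -plane_integralZ; last exact/rapid_dominated/rapid_wave.
apply: eq_plane_integral => y.
have r1 := rapid_wave k p (rapid_shift (- y) rb).
transitivity (a y * I2 (fun z => cos (dotp k z + p) * b (z + - y))).
  rewrite -plane_integralZ; last exact: rapid_dominated.
  by apply: eq_plane_integral => z; rewrite mulrCA.
rewrite [RHS]mulrA [RHS]mulrC; congr (_ * _).
rewrite mulrC -Hb -(plane_integral_shift y (rapid_dominated r1)).
apply: eq_plane_integral => z; rewrite addrK; congr (cos _ * _).
by rewrite /dotp/=; ring.
Qed.

Lemma rapid_affine (s c : R * R) F : s.1 != 0 -> s.2 != 0 -> rapid F ->
  rapid (fun x => F (s.1 * x.1 + c.1, s.2 * x.2 + c.2)).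
Proof.
move=> s10 s20 [mF FC]; split; first exact: measurable2_affine.
by move=> n; have [C hC] := FC n; exact: decay_affine hC.
Qed.

(** The parabolic dilation: [x_2] scales like the square of [x_1], and [l ^- 3] preserves the
    integral. *)
Definition dilate (l : R) f x := l ^- 3 * f (l^-1 * x.1, l ^- 2 * x.2).

Lemma rapidZ (c : R) f : rapid f -> rapid (fun x => c * f x).
Proof.
move=> rf; have := rapidMpoly rf (poly_growth_cst c).
by congr (rapid _); apply/funext => x; rewrite mulrC.
Qed.

Lemma rapid_dilate (l : R) f : 0 < l -> rapid f -> rapid (dilate l f).
Proof.
move=> l0 rf; apply: rapidZ.
have := @rapid_affine (l^-1, l ^- 2) 0 f; rewrite /= !invr_eq0 expf_eq0 gt_eqF//=.
move=> /(_ isT isT rf); congr (rapid _); apply/funext => x.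
by rewrite !addr0.
Qed.

Lemma plane_integral_dilate (l : R) F : 0 < l -> dominated F ->
  I2 F = l ^+ 3 * I2 (fun x => F (l * x.1, l ^+ 2 * x.2)).
Proof.
move=> l0 dF; rewrite (@plane_integral_affine _ (l, l ^+ 2) 0) ?expf_eq0 ?gt_eqF//=.
rewrite -exprS gtr0_norm ?exprn_gt0//; congr (_ * _).
by apply: eq_plane_integral => x; rewrite !addr0.
Qed.

Lemma has_fourier_dilate f g (l : R) : 0 < l -> rapid f -> has_fourier f g ->
  has_fourier (dilate l f) (fun k => g (l * k.1, l ^+ 2 * k.2)).
Proof.
move=> l0 rf H p k.
have l0' : l != 0 by rewrite gt_eqF.
rewrite (plane_integral_dilate l0); last first.
  exact/rapid_dominated/rapid_wave/rapid_dilate.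
rewrite -H -plane_integralZ; last first.
  have := rapid_wave k p (rapid_dilate l0 rf).
  move=> /(@rapid_affine (l, l ^+ 2) 0); rewrite /= expf_eq0 l0' => /(_ isT isT)/rapid_dominated.
  by congr (dominated _); apply/funext => x; rewrite !addr0.
apply: eq_plane_integral => -[x1 x2]; rewrite /dilate/= !mulKf ?expf_neq0//.
rewrite mulrCA mulVKf ?expf_neq0//; congr (cos _ * _).
by rewrite /dotp/=; ring.
Qed.

(** * Injectivity of the Fourier transform *)

Section injectivity.
Variables (psi : R -> R * R -> R).
Let gauss T k : R := expR (- (T * (k.1 ^+ 4 + k.2 ^+ 2))).
Hypothesis rpsi : forall T, 0 < T -> rapid (psi T).
Hypothesis Fpsi : forall T, 0 < T -> has_fourier (psi T) (gauss T).

(** The factor [gauss T (x - c)] is the transform of [psi T] at frequency [x - c]. Exchanging the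
    integrals leaves the transform of [f] with phase [- dotp k c], which vanishes. *)
Lemma gauss_pairing f c T : 0 < T -> rapid f ->
  (forall p k, I2 (fun x => cos (dotp k x + p) * f x) = 0) ->
  I2 (fun x => f x * gauss T (x - c)) = 0.
Proof.
move=> T0 rf Hf; have [C hC] := rapid4 rf (rpsi T0).
transitivity (I2 (fun x => I2 (fun k => cos (dotp (x - c) k + 0) * (f x * psi T k)))).
  apply: eq_plane_integral => x.
  rewrite -[gauss T _]mul1r -cos0 -Fpsi// -plane_integralZ; last first.
    exact/rapid_dominated/rapid_wave/rpsi.
  by apply: eq_plane_integral => k; rewrite mulrCA.
rewrite (@fubini_plane _ _ C); last 2 first.
- apply: measurable4M; first exact: measurable4_wave.
  by apply: measurable4M; [exact: (measurable4_fst rf.1)|exact: (measurable4_snd (rpsi T0).1)].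
- move=> x y; apply: le_trans (hC x y); apply: ler_wpM2r; first exact: mulr_ge0.
  by rewrite normrM ler_piMl// ler_norml cos_geN1 cos_le1.
transitivity (0 * I2 (psi T)); last by rewrite mul0r.
rewrite -plane_integralZ; last exact/rapid_dominated/rpsi.
apply: eq_plane_integral => k; rewrite mul0r.
transitivity (psi T k * I2 (fun x => cos (dotp k x + - dotp k c) * f x)); last first.
  by rewrite Hf mulr0.
rewrite -plane_integralZ; last exact/rapid_dominated/rapid_wave.
apply: eq_plane_integral => x; rewrite addr0 mulrA [RHS]mulrC.
congr (_ * _ * _).
by congr (cos _); rewrite /dotp/=; ring.
Qed.

(* If [f c > 0], then as [T] tends to infinity the mass of [gauss T] near [c]
   dominates, and the integral is positive. *)
Lemma gauss_pairing_eq0 f : continuous f -> rapid f ->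
  (forall c T, 0 < T -> I2 (fun x => f x * gauss T (x - c)) = 0) ->
  forall c, f c <= 0.
Proof.
move=> cf rf Hf c; rewrite leNgt; apply/negP => fc.
have fc2 : 0 < f c / 2 by rewrite divr_gt0.
have /cvgrPdist_le/(_ _ fc2)/nbhs_normP[d0 /= d00 hd0] := cf c.
pose d := Num.min 1 (d0 / 2).
have d_gt0 : 0 < d by rewrite lt_min ltr01 divr_gt0.
have d1 : d <= 1 by rewrite ge_min lexx.
have fd x : `|x.1 - c.1| <= d -> `|x.2 - c.2| <= d -> f c / 2 <= f x.
  move=> h1 h2; have dd0 : d < d0 by rewrite gt_min; apply/orP; right; lra.
  have /hd0 /= : `|c - x| < d0.
    by rewrite distrC [`|_|]/(Num.max _ _) gt_max (le_lt_trans h1 dd0) (le_lt_trans h2 dd0).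
  by rewrite ler_norml => /andP[_]; lra.
(* On the box of half-side [r] the quartic-quadratic symbol is at most [d ^+ 4 / 2]. Off the box of
   half-side [d] it is at least [d ^+ 4], since [d <= 1], and in between [f] is nonnegative. *)
pose r := d ^+ 2 / 2.
have r0 : 0 < r by rewrite divr_gt0 ?exprn_gt0.
have rd : r <= d by rewrite /r expr2; nra.
have rd4 : r ^+ 4 + r ^+ 2 <= d ^+ 4 / 2.
  have r1 : r <= 1 by apply: le_trans rd d1.
  have -> : d ^+ 4 / 2 = r ^+ 2 + r ^+ 2 by rewrite /r; field.
  by rewrite lerD2r; apply: ler_wiXn2l => //; exact/ltW.
pose A : set (mR * mR) := `[c.1 - r, c.1 + r] `*` `[c.2 - r, c.2 + r].
have mA : measurable A by apply: measurableX; exact: measurable_itv.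
have AP x : (x \in A) = (`|x.1 - c.1| <= r) && (`|x.2 - c.2| <= r).
  apply/idP/idP; rewrite inE /A/= !in_itv/= !ler_norml.
    by move=> [/andP[h1 h2] /andP[h3 h4]]; apply/andP; split; apply/andP; split; lra.
  by move=> /andP[/andP[h1 h2] /andP[h3 h4]]; split; apply/andP; split; lra.
have dA : dominated \1_A.
  split; first exact: measurable_indic.
  exists ((1 + (`|c.1| + r) + (`|c.2| + r)) ^+ 4) => x; rewrite indicE AP.
  case: (boolP (_ && _)) => [/andP[h1 h2]|_]; last first.
    by rewrite normr0 mul0r exprn_ge0// !addr_ge0// ltW.
  rewrite normr1 mul1r; apply: lerXn2r; rewrite ?nnegrE ?(ltW (weight_gt0 _))//.
    by rewrite !addr_ge0// ltW.
  have := ler_normD (x.1 - c.1) c.1; have := ler_normD (x.2 - c.2) c.2.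
  by rewrite !subrK /weight; lra.
have IA : I2 \1_A = (r + r) * (r + r).
  rewrite /plane_integral /Rintegral integral_indic//= setIT.
  rewrite /plane_measure product_measure1E//= !lebesgue_measure_itv/= !lte_fin.
  have -> : c.1 - r < c.1 + r by lra.
  have -> : c.2 - r < c.2 + r by lra.
  by rewrite -!EFinB -EFinM/=; congr (_ * _); ring.
have key T : 0 < T ->
    f c / 2 * expR (- (T * (d ^+ 4 / 2))) * I2 \1_A <= expR (- (T * d ^+ 4)) * I2 (fun x => `|f x|).
  move=> T0; rewrite -subr_le0 -(Hf c T T0).
  have dN := dominated_norm (rapid_dominated rf).
  rewrite -!plane_integralZ// -plane_integralB; [|exact: dominatedZ|exact: dominatedZ].
  apply: le_plane_integral.
  - by apply: dominatedB; exact: dominatedZ.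
  - apply: rapid_dominated; apply: rapidMpoly => //; split.
      apply: (@measurableT_comp _ _ _ _ _ _ (@expR R) setT) => //.
      have m1 : measurable2 (fun x => x.1 - c.1).
        exact: (measurable2B (@measurable2_fst R) (measurable2_cst c.1)).
      have m2 : measurable2 (fun x => x.2 - c.2).
        exact: (measurable2B (@measurable2_snd R) (measurable2_cst c.2)).
      have m3 := measurable2M (measurable2_cst (- T)) (measurable2D (measurable2X 4 m1) (measurable2X 2 m2)).
      by move: m3; congr (measurable2 _); apply/funext => x; rewrite mulNr.
    exists 0%N, 1 => x; rewrite expr0 mulr1 ger0_norm ?expR_ge0// /gauss -expR0 ler_expR.
    rewrite oppr_le0; apply: mulr_ge0; first exact: ltW.
    by apply: addr_ge0; rewrite ?sqr_ge0// (exprM _ 2 2) sqr_ge0.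
  move=> x; rewrite indicE AP /gauss; set s := (x - c).1; set t := (x - c).2.
  have g0 u : 0 < expR (- (T * u)) by exact: expR_gt0.
  have gle u v : u <= v -> expR (- (T * v)) <= expR (- (T * u)).
    by move=> uv; rewrite ler_expR lerN2 ler_wpM2l// ltW.
  have q0 := mulr_ge0 (ltW (g0 (d ^+ 4))) (normr_ge0 (f x)).
  have s2 : s ^+ 4 = `|s| ^+ 4 by rewrite -normrX ger0_norm// (exprM _ 2 2) sqr_ge0.
  have t2 : t ^+ 2 = `|t| ^+ 2 by rewrite -normrX ger0_norm// sqr_ge0.
  case: (boolP (_ && _)) => [/andP[h1 h2]|_].
    rewrite mulr1; apply: (@le_trans _ _ (f c / 2 * expR (- (T * (d ^+ 4 / 2))))); first by lra.
    apply: ler_pM; rewrite ?(ltW fc2) ?(ltW (g0 _))//.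
      by apply: fd; apply: le_trans rd.
    apply: gle; apply: le_trans rd4; rewrite s2 t2.
    by apply: lerD; apply: lerXn2r; rewrite ?nnegrE// ltW.
  rewrite mulr0 add0r.
  have [h1|h1] := leP `|s| d; last first.
    apply: (@le_trans _ _ (- (expR (- (T * (s ^+ 4 + t ^+ 2))) * `|f x|))).
      rewrite lerN2 ler_wpM2r//; apply: gle; rewrite s2 -[leLHS]addr0; apply: lerD; rewrite ?sqr_ge0//.
      by apply: lerXn2r; rewrite ?nnegrE// ltW.
    by rewrite -mulrN mulrC ler_wpM2r ?(ltW (g0 _))// lerNnormlW.
  have [h2|h2] := leP `|t| d; last first.
    apply: (@le_trans _ _ (- (expR (- (T * (s ^+ 4 + t ^+ 2))) * `|f x|))).
      rewrite lerN2 ler_wpM2r//; apply: gle; rewrite s2 t2 -[leLHS]add0r; apply: lerD; rewrite ?exprn_ge0//.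
      apply: (@le_trans _ _ (d ^+ 2)); first by apply: ler_wiXn2l => //; exact/ltW.
      by apply: lerXn2r; rewrite ?nnegrE// ltW.
    by rewrite -mulrN mulrC ler_wpM2r ?(ltW (g0 _))// lerNnormlW.
  apply: (@le_trans _ _ 0); first by rewrite oppr_le0.
  by rewrite mulr_ge0 ?(ltW (g0 _))// (le_trans (ltW fc2))// fd.
pose q := d ^+ 4 / 2; pose P := f c / 2 * I2 \1_A; pose N := I2 (fun x => `|f x|).
have q_gt0 : 0 < q by rewrite divr_gt0 ?exprn_gt0.
have P_gt0 : 0 < P by rewrite /P IA !mulr_gt0// addr_gt0.
have N_ge0 : 0 <= N by exact: plane_integral_ge0.
(* This makes [P * (1 + T * q)] exceed [N], which contradicts [key] because the exponential of
   [T * q] is at least [1 + T * q]. *)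
pose T := N / (P * q) + 1.
have T0 : 0 < T by rewrite ltr_wpDl// divr_ge0// mulr_ge0// ltW.
have := key T T0; rewrite -/N -/q.
have -> : d ^+ 4 = q + q by rewrite /q; field.
rewrite mulrAC -/P mulrDr opprD expRD -mulrA mulrC ler_pM2l ?expR_gt0// expRN.
rewrite mulrC ler_pdivlMr ?expR_gt0// leNgt => /negP; apply.
have Tq : N < P * (1 + T * q).
  have -> : P * (1 + T * q) = N + P + P * q.
    by rewrite /T; field; rewrite !gt_eqF.
  have := mulr_gt0 P_gt0 q_gt0; lra.
by apply: lt_le_trans Tq _; rewrite ler_pM2l// expR_ge1Dx.
Qed.

(** The one-sided conclusion of [gauss_pairing_eq0] is applied to the difference in both orders. *)
Lemma has_fourier_inj f1 f2 g : continuous f1 -> continuous f2 ->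
  rapid f1 -> rapid f2 -> has_fourier f1 g -> has_fourier f2 g -> f1 =1 f2.
Proof.
move=> c1 c2 r1 r2 h1 h2.
have aux u v : continuous u -> continuous v -> rapid u -> rapid v ->
    has_fourier u g -> has_fourier v g -> forall c, u c <= v c.
  move=> cu cv ru rv hu hv c; rewrite -subr_le0.
  have rN := rapidZ (-1) rv.
  have rD : rapid (fun x => u x - v x).
    split; first exact: measurable2B ru.1 rv.1.
    move=> n; have [A hA] := ru.2 n; have [B hB] := rv.2 n.
    exists (A + B) => x; apply: le_trans (lerD (hA x) (hB x)).
    by rewrite -mulrDl ler_wpM2r// ler_normB.
  apply: (@gauss_pairing_eq0 (fun x => u x - v x)) => //.
    by move=> x; apply: cvgB; [exact: cu|exact: cv].
  move=> {}c T T0; apply: gauss_pairing => // p k.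
  rewrite -[RHS](subrr (cos p * g k)) -{1}hu -hv -plane_integralB; last 2 first.
  - exact/rapid_dominated/rapid_wave.
  - exact/rapid_dominated/rapid_wave.
  by apply: eq_plane_integral => x; rewrite mulrBr.
by move=> c; apply/eqP; rewrite eq_le !aux.
Qed.

End injectivity.
End fourier.

(** * Algebra of convolutions with functions of polynomial growth *)

Section conv_growth.
Variable R : realType.
Implicit Types (x y z : R * R) (a b f F G : R * R -> R).
Local Notation I2 := (@plane_integral R).

Lemma measurable2_conv a F : rapid a -> poly_growth F ->
  measurable2 (plane_conv a F).
Proof.
move=> ra pF; apply: (@measurable2_integral _ (fun x y => a y * F (x - y))) => [|x].
  by apply: measurable4M; [exact: (measurable4_snd ra.1)|exact: (measurable4B pF.1)].
by case: (rapid_dominated_conv x ra pF).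
Qed.

Lemma poly_growth_conv a F : rapid a -> poly_growth F ->
  poly_growth (plane_conv a F).
Proof.
move=> ra pF; split; first exact: measurable2_conv.
have [mF [k [C FC]]] := pF; have C0 := weight_bound_ge0 (FC 0).
have dW : dominated (fun y => `|a y| * weight y ^+ k).
  by apply/rapid_dominated/rapidMpoly; [exact: rapid_norm|exact: poly_growth_weight].
exists k, (C * I2 (fun y => `|a y| * weight y ^+ k)) => x.
rewrite mulrAC -plane_integralZ//; apply: ler_norm_plane_integral.
- exact: rapid_dominated_conv.
- exact: dominatedZ.
move=> y; rewrite normrM [leRHS]mulrCA ler_wpM2l//; apply: le_trans (FC _) _.
rewrite -mulrA ler_wpM2l//; apply: le_trans (weightDX _ _ _) _.
by rewrite weightN.
Qed.

Lemma plane_convA a b F x : rapid a -> is_schwartz b -> poly_growth F ->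
  plane_conv a (plane_conv b F) x = plane_conv (plane_conv a b) F x.
Proof.
move=> ra sb pF; have rb := schwartz_rapid sb.
have pFx := poly_growth_reflect x pF.
have [C hC] := conv_dominated ra rb pFx.
transitivity (I2 (fun y => I2 (fun z => F (x - z) * (a y * b (z - y))))).
  apply: eq_plane_integral => y; rewrite /plane_conv.
  have dF := rapid_dominated_conv (x - y) rb pF.
  rewrite -(plane_integral_shift (- y) dF) -plane_integralZ; last first.
    exact: (dominated_shift (- y) dF).
  apply: eq_plane_integral => z.
  by rewrite (_ : x - y - (z - y) = x - z); [ring|rewrite opprB addrA subrK].
rewrite (@fubini_plane _ _ C); last 2 first.
- apply: measurable4M; first exact: (measurable4_snd pFx.1).
  apply: measurable4M; first exact: (measurable4_fst ra.1).
  exact: (measurable4_swap (measurable4B rb.1)).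
- by move=> y z; rewrite [X in _ * X]mulrC; exact: hC.
apply: eq_plane_integral => z; rewrite plane_integralZ; last first.
  exact: (rapid_dominated_conv z ra (rapid_poly rb)).
by rewrite mulrC.
Qed.

Lemma plane_conv_adjoint a f F : rapid a -> rapid f -> poly_growth F ->
  (forall x, a (- x) = a x) ->
  I2 (fun x => plane_conv a F x * f x) = I2 (fun x => F x * plane_conv a f x).
Proof.
move=> ra rf pF ea.
have [C hC] := conv_dominated rf ra pF.
transitivity (I2 (fun x => I2 (fun z => F z * (f x * a (z - x))))).
  apply: eq_plane_integral => x; rewrite /plane_conv.
  have dF := rapid_dominated_conv x ra pF.
  rewrite -(plane_integral_reflect x dF) mulrC -plane_integralZ; last first.
    exact: (dominated_reflect x dF).
  by apply: eq_plane_integral => z; rewrite subKr -opprB ea; ring.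
rewrite (@fubini_plane _ _ C); last 2 first.
- apply: measurable4M; first exact: (measurable4_snd pF.1).
  apply: measurable4M; first exact: (measurable4_fst rf.1).
  exact: (measurable4_swap (measurable4B ra.1)).
- by move=> y z; rewrite [X in _ * X]mulrC; exact: hC.
apply: eq_plane_integral => z; rewrite plane_integralZ; last first.
  exact: (rapid_dominated_conv z rf (rapid_poly ra)).
by rewrite -/(plane_conv f a z) plane_convC.
Qed.

Lemma plane_convB a F G x : rapid a -> poly_growth F -> poly_growth G ->
  plane_conv a (fun y => F y - G y) x = plane_conv a F x - plane_conv a G x.
Proof.
move=> ra pF pG; rewrite /plane_conv -plane_integralB; last 2 first.
- exact: rapid_dominated_conv.
- exact: rapid_dominated_conv.
by apply: eq_plane_integral => y; rewrite mulrBr.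
Qed.

End conv_growth.

(** * Identities and moments of the kernel *)

Section kernel_facts.
Variable R : realType.
Implicit Types (x z h c : R * R) (g F : R * R -> R) (m : nat) (T s t l : R).
Local Notation I2 := (@plane_integral R).

Lemma kernel_has_fourier (psi : R -> schwartz R) T : is_kernel psi -> 0 < T ->
  has_fourier (psi T) (fun k => expR (- (T * (k.1 ^+ 4 + k.2 ^+ 2)))).
Proof.
move=> hpsi T0 p k.
have rp := schwartz_rapid (schwartzP (psi T)).
have /eqP := hpsi T T0 k; rewrite eq_complex /= => /andP[/eqP hc /eqP hs].
have pc : poly_growth (fun x => cos (dotp k x)).
  by have := poly_growth_wave k 0; congr (poly_growth _); apply/funext => x; rewrite addr0.
have ps : poly_growth (fun x => sin (dotp k x)).
  have := poly_growth_wave k (- (pi / 2)); congr (poly_growth _); apply/funext => x.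
  by rewrite -[in RHS](subrK (pi / 2) (dotp k x)) sinDpihalf.
have dc : dominated (fun x => cos (dotp k x) * psi T x).
  have := rapid_dominated (rapidMpoly rp pc).
  by congr (dominated _); apply/funext => x; rewrite mulrC.
have ds : dominated (fun x => sin (dotp k x) * psi T x).
  have := rapid_dominated (rapidMpoly rp ps).
  by congr (dominated _); apply/funext => x; rewrite mulrC.
transitivity (cos p * I2 (fun x => cos (dotp k x) * psi T x) -
              sin p * I2 (fun x => sin (dotp k x) * psi T x)).
  rewrite -!plane_integralZ// -plane_integralB; [|exact: dominatedZ|exact: dominatedZ].
  by apply: eq_plane_integral => x; rewrite cosD; ring.
have -> : I2 (fun x => cos (dotp k x) * psi T x) = expR (- (T * (k.1 ^+ 4 + k.2 ^+ 2))) := hc.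
have -> : I2 (fun x => sin (dotp k x) * psi T x) = 0.
  by apply/eqP; rewrite -oppr_eq0; apply/eqP.
by rewrite mulr0 subr0.
Qed.

Section fixed_kernel.
Variable psi : R -> schwartz R.
Hypothesis hpsi : is_kernel psi.

Lemma kernel_rapid T : rapid (psi T).
Proof. exact/schwartz_rapid/schwartzP. Qed.

Lemma kernel_inj f1 f2 g : continuous f1 -> continuous f2 ->
  rapid f1 -> rapid f2 -> has_fourier f1 g -> has_fourier f2 g -> f1 =1 f2.
Proof.
apply: (@has_fourier_inj _ (fun T => psi T : R * R -> R)) => T T0.
  exact: kernel_rapid.
exact: kernel_has_fourier.
Qed.

Lemma kernel_continuous T : continuous (psi T).
Proof. exact/schwartz_continuous/schwartzP. Qed.

Lemma kernel_even T x : 0 < T -> psi T (- x) = psi T x.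
Proof.
move=> T0; move: x; apply: (@kernel_inj (fun x => psi T (- x)) (psi T)).
- move=> x; apply: (@cvg_comp _ _ _ (@GRing.opp _) (psi T)); last exact: kernel_continuous.
  exact: opp_continuous.
- exact: kernel_continuous.
- exact: (rapidN (kernel_rapid T)).
- exact: kernel_rapid.
- by apply: has_fourier_reflect; [exact: kernel_rapid|exact: kernel_has_fourier].
- exact: kernel_has_fourier.
Qed.

Lemma kernel_semigroup s t : 0 < s -> 0 < t ->
  plane_conv (psi s) (psi t) =1 psi (s + t).
Proof.
move=> s0 t0.
have sc := conv_schwartz (kernel_rapid s) (schwartzP (psi t)).
apply: (@kernel_inj _ _ (fun k => expR (- ((s + t) * (k.1 ^+ 4 + k.2 ^+ 2))))).
- exact: schwartz_continuous.
- exact: kernel_continuous.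
- exact: schwartz_rapid.
- exact: kernel_rapid.
- have := has_fourier_conv (kernel_rapid s) (kernel_rapid t)
    (kernel_has_fourier hpsi s0) (kernel_has_fourier hpsi t0).
  by congr has_fourier; apply/funext => k; rewrite -expRD; congr expR; ring.
- by apply: kernel_has_fourier; rewrite ?addr_gt0.
Qed.

Lemma kernel_dilate l : 0 < l -> dilate l (psi 1) =1 psi (l ^+ 4).
Proof.
move=> l0; have l40 : 0 < l ^+ 4 by rewrite exprn_gt0.
apply: (@kernel_inj _ _ (fun k => expR (- (l ^+ 4 * (k.1 ^+ 4 + k.2 ^+ 2))))).
- move=> x; apply: cvgM; first exact: cvg_cst.
  have H1 : {for (l^-1 * x.1, l ^- 2 * x.2), continuous (fun z : R * R => psi 1 (z.1, z.2))}.
    have := @kernel_continuous 1 (l^-1 * x.1, l ^- 2 * x.2).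
    by congr continuous_at; apply/funext => -[].
  have H2 : (fun x : R * R => l^-1 * x.1) @ x --> l^-1 * x.1.
    by case: x {H1} => x1 x2; apply: cvgM; [exact: cvg_cst|exact: cvg_fst].
  have H3 : (fun x : R * R => l ^- 2 * x.2) @ x --> l ^- 2 * x.2.
    by case: x {H1 H2} => x1 x2; apply: cvgM; [exact: cvg_cst|exact: cvg_snd].
  have H := continuous2_cvg (h := fun u v => psi 1 (u, v)) _ H1 H2 H3.
  exact: H.
- exact: kernel_continuous.
- exact: (rapid_dilate l0 (kernel_rapid 1)).
- exact: kernel_rapid.
- have := has_fourier_dilate l0 (kernel_rapid 1) (kernel_has_fourier hpsi ltr01).
  congr has_fourier; apply/funext => k /=; congr (expR (- _)).
  by ring.
- exact: kernel_has_fourier.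
Qed.

Lemma kernel_integral T : 0 < T -> I2 (psi T) = 1.
Proof.
move=> T0; have := kernel_has_fourier hpsi T0 0 0.
rewrite cos0 mul1r /= !expr0n/= addr0 mulr0 oppr0 expR0 => <-.
by apply: eq_plane_integral => x; rewrite /dotp/= !mul0r !addr0 cos0 mul1r.
Qed.

Lemma kernel_integral_coord1 T : 0 < T -> I2 (fun h => psi T h * h.1) = 0.
Proof.
move=> T0.
have p1 := @poly_growth_coord1 R.
have d1 := rapid_dominated (rapidMpoly (kernel_rapid T) p1).
have := plane_integral_reflect 0 d1.
rewrite (eq_plane_integral (G := fun h => (-1) * (psi T h * h.1))); last first.
  by move=> h; rewrite sub0r kernel_even//= mulrN mulN1r.
by rewrite plane_integralZ// mulN1r => /eqP; rewrite eq_sym -addr_eq0 -mulr2n mulrn_eq0 => /eqP.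
Qed.

(** The moments with [m = 0, 1, 2] enter the final constant; higher ones only ensure convergence. *)
Definition kernel_moment m := I2 (fun z => `|psi 1 z| * weight z ^+ m).

Lemma dominated_kernel_moment m : dominated (fun z => `|psi 1 z| * weight z ^+ m).
Proof.
apply: rapid_dominated; apply: rapidMpoly; last exact: poly_growth_weight.
exact: (rapid_norm (kernel_rapid 1)).
Qed.

Lemma kernel_moment_ge0 m : 0 <= kernel_moment m.
Proof. by apply: plane_integral_ge0 => z; rewrite mulr_ge0. Qed.

(** Under the substitution [h = (l z_1, l^2 z_2)] the kernel at time [l ^+ 4] becomes [psi 1].
    Bounds on [F] along this dilation therefore give bounds uniform in the scale. *)
Lemma kernel_moment_le l m F (c : R) : 0 < l -> measurable2 F ->
  (forall z, `|F (l * z.1, l ^+ 2 * z.2)| <= c * weight z ^+ m) ->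
  `|I2 (fun h => psi (l ^+ 4) h * F h)| <= c * kernel_moment m.
Proof.
move=> l0 mF hF; have l_neq0 : l != 0 by rewrite gt_eqF.
have c0 := weight_bound_ge0 (hF 0).
(* Undoing the dilation turns the hypothesis into polynomial growth of [F]. *)
have pF : poly_growth F.
  split=> //.
  have [C hC] : exists C, forall x, weight (l^-1 * x.1, l ^- 2 * x.2) <= C * weight x.
    exists (1 + l^-1 + l ^- 2) => x; rewrite /weight/= !normrM.
    have [u0 v0] : 0 <= l^-1 /\ 0 <= l ^- 2 by rewrite !invr_ge0 exprn_ge0// ltW.
    rewrite (ger0_norm u0) (ger0_norm v0).
    have := normr_ge0 x.1; have := normr_ge0 x.2.
    set p := `|x.1|; set q := `|x.2| => q0 p0.
    have := mulr_ge0 u0 p0; have := mulr_ge0 v0 q0.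
    have := mulr_ge0 u0 q0; have := mulr_ge0 v0 p0; lra.
  exists m, (c * C ^+ m) => x.
  have := hF (l^-1 * x.1, l ^- 2 * x.2); rewrite /= !mulVKf ?expf_neq0//.
  rewrite -surjective_pairing => /le_trans; apply.
  rewrite -mulrA ler_wpM2l// -exprMn; apply: lerXn2r; rewrite ?nnegrE ?(ltW (weight_gt0 _))//.
  by apply: le_trans (hC x); exact/ltW.
have d1 := rapid_dominated (rapidMpoly (kernel_rapid (l ^+ 4)) pF).
rewrite (plane_integral_dilate l0 d1) -plane_integralZ; last first.
  have := @dominated_affine _ (l, l ^+ 2) 0 _ _ _ d1; rewrite /= expf_eq0 l_neq0 => /(_ isT isT).
  by congr (dominated _); apply/funext => x; rewrite !addr0.
rewrite -plane_integralZ; last exact: dominated_kernel_moment.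
apply: ler_norm_plane_integral.
- apply: dominatedZ.
  have := @dominated_affine _ (l, l ^+ 2) 0 _ _ _ d1; rewrite /= expf_eq0 l_neq0 => /(_ isT isT).
  by congr (dominated _); apply/funext => x; rewrite !addr0.
- exact/dominatedZ/dominated_kernel_moment.
move=> z; rewrite -kernel_dilate// /dilate/= !mulKf ?expf_neq0//.
have cancel3 (p q : R) : l ^+ 3 * (l ^- 3 * p * q) = p * q by field.
by rewrite -surjective_pairing cancel3 normrM mulrCA ler_wpM2l.
Qed.

End fixed_kernel.

Lemma kernel_unique (psi psi' : R -> schwartz R) T : is_kernel psi ->
  is_kernel psi' -> 0 < T -> psi T =1 psi' T.
Proof.
move=> h h' T0; apply: (kernel_inj h) => //.
- exact: kernel_continuous.
- exact: kernel_continuous.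
- exact: kernel_rapid.
- exact: kernel_rapid.
- exact: kernel_has_fourier.
- exact: kernel_has_fourier.
Qed.

End kernel_facts.

(** * Mollification of distributions *)

Section mollify_facts.
Variable R : realType.
Implicit Types (x y z h : R * R) (f g : R * R -> R) (k : nat) (T s t l : R).
Implicit Types (D : tempered_distribution R) (phi : schwartz R).
Local Notation I2 := (@plane_integral R).
Variable psi : R -> schwartz R.
Hypothesis hpsi : is_kernel psi.

(** Evenness turns the reflection of the kernel into a translation, the form to which [pairing_conv]
    applies. *)
Lemma mollifyE D T x : 0 < T -> mollify psi D T x = D (schwartz_shift (- x) (psi T)).
Proof.
move=> T0; congr (pairing D _); apply/val_inj/funext => y /=.
by rewrite -(kernel_even hpsi)// opprB.
Qed.

Lemma mollify_funE D T : 0 < T ->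
  mollify psi D T = fun x => D (schwartz_shift (- x) (psi T)).
Proof. by move=> T0; apply/funext => x; exact: mollifyE. Qed.

Lemma mollify_continuous D T : 0 < T -> continuous (mollify psi D T).
Proof. by move=> /mollify_funE ->; exact: shift_pairing_continuous. Qed.

Lemma mollify_poly D T : 0 < T -> poly_growth (mollify psi D T).
Proof. by move=> /mollify_funE ->; exact: shift_pairing_poly. Qed.

Lemma mollify_pairing D a T phi : 0 < T -> rapid a ->
  (forall z, phi z = plane_conv a (psi T) z) ->
  D phi = I2 (fun y => a y * mollify psi D T y).
Proof.
move=> T0 ra /(pairing_conv _ ra) ->.
by apply: eq_plane_integral => y; rewrite mollifyE.
Qed.

Lemma plane_conv_recenter a g x z :
  rapid a -> rapid g ->
  plane_conv (fun y => a (y - x)) g z = plane_conv a g (z - x).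
Proof.
move=> ra rg; rewrite /plane_conv.
rewrite -(plane_integral_shift x (rapid_dominated_conv z (rapid_shift (- x) ra) (rapid_poly rg))).
by apply: eq_plane_integral => y; rewrite addrK opprD addrA addrAC.
Qed.

Lemma mollify_semigroup D s t x : 0 < s -> 0 < t ->
  mollify psi D (s + t) x = plane_conv (psi s) (mollify psi D t) x.
Proof.
move=> s0 t0; rewrite mollifyE ?addr_gt0//.
have rs := kernel_rapid psi s.
rewrite (@mollify_pairing _ (fun y => psi s (y - x)) t)//; last first.
- move=> z; rewrite plane_conv_recenter//; last exact: kernel_rapid.
  by rewrite kernel_semigroup.
- exact: rapid_shift.
have d1 := rapid_dominated (rapidMpoly (rapid_shift (- x) rs) (mollify_poly D t0)).
rewrite -(plane_integral_reflect x d1).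
by apply: eq_plane_integral => y; rewrite addrAC subrr add0r (kernel_even hpsi).
Qed.

(** The first-order term in [h_1] integrates to zero. What remains is of second order in [h_1] or of
    first order in [h_2], both of parabolic order [l ^+ 2]; the three words are the derivatives that
    occur. *)
Lemma smoothing_error f k l y (B : R) : is_schwartz f -> 0 < l <= 1 ->
  (forall w x, w \in [:: [:: true]; [:: false; false]; [:: true; false]] ->
    `|pderivs w f x| * weight x ^+ k <= B) ->
  `|plane_conv (psi (l ^+ 4)) f y - f y| * weight y ^+ k
    <= B * l ^+ 2 * kernel_moment psi (k + 2).
Proof.
move=> sf /andP[l0 l1] hB; have l40 : 0 < l ^+ 4 by rewrite exprn_gt0.
set T := l ^+ 4; have rT := kernel_rapid psi T.
have B0 : 0 <= B.
  by apply: le_trans (hB [:: true] 0 _) => //; rewrite mulr_ge0.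
pose d1 := 'D_(unit_vec R false) f; pose d2 := 'D_(unit_vec R true) f.
have s1 : is_schwartz d1 := schwartz_deriv false sf.
pose H h := weight y ^+ k * (f (y - h) - f y + d1 y * h.1).
have p1 := @poly_growth_coord1 R.
have pf := poly_growth_reflect y (schwartz_poly sf).
have pd := poly_growthM (poly_growth_cst (d1 y)) p1.
have mH : measurable2 H.
  apply: (poly_growthM (poly_growth_cst _) _).1.
  by apply: poly_growthD => //; apply: poly_growthD => //; exact: poly_growth_cst.
have E : weight y ^+ k * (plane_conv (psi T) f y - f y) = I2 (fun h => psi T h * H h).
  have c0 := rapid_dominated rT.
  have a1 := rapid_dominated (rapidMpoly rT pf).
  have a3 := rapid_dominated (rapidMpoly rT p1).
  transitivity (weight y ^+ k * (I2 (fun h => psi T h * f (y - h)) -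
     f y * I2 (psi T) + d1 y * I2 (fun h => psi T h * h.1))).
    by rewrite (kernel_integral hpsi)// (kernel_integral_coord1 hpsi)// mulr1 mulr0 addr0.
  have dA := dominatedZ (f y) c0; have dB := dominatedZ (d1 y) a3.
  have dC := dominatedB a1 dA.
  rewrite -(plane_integralZ (f y) c0) -(plane_integralZ (d1 y) a3).
  rewrite -(plane_integralB a1 dA) -(plane_integralD dC dB).
  rewrite -(plane_integralZ _ (dominatedD dC dB)).
  by apply: eq_plane_integral => h; rewrite /H; ring.
rewrite -(ger0_norm (weightX_ge0 y k)) -normrM mulrC E.
apply: (kernel_moment_le hpsi l0 mH) => z; rewrite /H.
set h := (l * z.1, l ^+ 2 * z.2).
rewrite normrM (ger0_norm (weightX_ge0 y k)).
have := @mvt_plane _ f y (- h) (fun z => schwartz_diff z sf).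
move=> [t t01 Ht].
have -> : f (y - h) - f y + d1 y * h.1 =
   (d1 (y + t *: - h) - d1 y) * - h.1 + d2 (y + t *: - h) * - h.2.
  rewrite Ht /d1 /d2 (_ : (- h).1 = - h.1)// (_ : (- h).2 = - h.2)//.
  by ring.
have wth : weight (t *: - h) ^+ k <= weight h ^+ k.
  apply: lerXn2r; rewrite ?nnegrE ?(ltW (weight_gt0 _))//.
  by apply: le_trans (weight_scale _ t01) _; rewrite weightN.
have whz : weight h ^+ k <= weight z ^+ k.
  apply: lerXn2r; rewrite ?nnegrE ?(ltW (weight_gt0 _))//.
  rewrite /weight -!addrA lerD2l; apply: lerD; rewrite normrM ler_piMl//.
    by rewrite ger0_norm// ltW.
  by rewrite ger0_norm ?exprn_ge0 ?exprn_ile1// ltW.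
have e1 : weight y ^+ k * `|d1 (y + t *: - h) - d1 y| <=
    B * (`|h.1| + `|h.2|) * weight z ^+ k.
  rewrite mulrC; apply: le_trans (@mvt_plane_bound _ d1 y (t *: - h) k B _ _) _.
  - by move=> x; exact: schwartz_diff.
  - by move=> i x; apply: (hB [:: i; false]); rewrite !inE; case: i; rewrite ?eqxx ?orbT.
  apply: ler_pM; rewrite ?mulr_ge0 ?addr_ge0//; last exact: le_trans wth whz.
  rewrite ler_wpM2l//; case/andP: t01 => t0 t1.
  by apply: lerD; rewrite [`|_|]normrM normrN ger0_norm// ler_piMl.
have e2 : weight y ^+ k * `|d2 (y + t *: - h)| <= B * weight z ^+ k.
  have := hB [:: true] (y + t *: - h); rewrite !inE eqxx => /(_ isT) hb.
  apply: (@le_trans _ _ (`|d2 (y + t *: - h)| * weight (y + t *: - h) ^+ k * weight (t *: - h) ^+ k)).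
    rewrite mulrC -mulrA ler_wpM2l//.
    have := weightBX y (- (t *: - h)) k; rewrite opprK weightN; exact.
  by apply: ler_pM => //; [exact: mulr_ge0|exact: le_trans wth whz].
(* The cross term in [h_1 h_2] is of order [l ^+ 3], absorbed because [l <= 1]. *)
have l2 : l ^+ 3 <= l ^+ 2 by apply: ler_wiXn2l => //; exact/ltW.
have l20 : 0 <= l ^+ 2 by rewrite exprn_ge0// ltW.
have hz1 : `|h.1| = l * `|z.1| by rewrite normrM gtr0_norm.
have hz2 : `|h.2| = l ^+ 2 * `|z.2| by rewrite normrM gtr0_norm ?exprn_gt0.
apply: (@le_trans _ _ (B * (`|h.1| + `|h.2|) * weight z ^+ k * `|h.1| + B * weight z ^+ k * `|h.2|)).
  apply: le_trans (ler_wpM2l (weightX_ge0 y k) (ler_normD _ _)) _.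
  rewrite mulrDr; apply: lerD.
    by rewrite (normrM _ (- h.1)) normrN mulrA; apply: ler_wpM2r.
  by rewrite (normrM _ (- h.2)) normrN mulrA; apply: ler_wpM2r.
rewrite hz1 hz2 exprD expr2 /weight.
set p := `|z.1|; set q := `|z.2|; set W := (1 + p + q) ^+ k.
have p0 : 0 <= p by exact: normr_ge0.
have q0 : 0 <= q by exact: normr_ge0.
have W0 : 0 <= W by rewrite exprn_ge0// !addr_ge0.
rewrite [leLHS](_ : _ = B * W * (l ^+ 2 * (p * p + q) + l ^+ 3 * (p * q))); last by ring.
rewrite [leRHS](_ : _ = B * W * (l ^+ 2 * ((1 + p + q) * (1 + p + q)))); last by ring.
rewrite ler_wpM2l ?mulr_ge0//.
apply: (@le_trans _ _ (l ^+ 2 * (p * p + q) + l ^+ 2 * (p * q))).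
  by rewrite lerD2l ler_wpM2r// mulr_ge0.
rewrite -mulrDr ler_wpM2l//.
by have := mulr_ge0 p0 q0; have := mulr_ge0 q0 q0; have := mulr_ge0 p0 p0; lra.
Qed.

(** Convolution commutes with derivatives, so [smoothing_error] controls every derivative that the
    distribution sees. The rate, not only the convergence, is used later. *)
Lemma pairing_smoothing D phi : exists C, forall l (phil : schwartz R), 0 < l <= 1 ->
  (forall z, phil z = plane_conv (psi (l ^+ 4)) phi z) ->
  `|D phil - D phi| <= C * l ^+ 2.
Proof.
have [C [k [ws [C0 hD]]]] := pairing_bound D.
have sp := schwartzP phi.
pose vs := [:: [:: true]; [:: false; false]; [:: true; false]].
(* The derivatives [v] of the smoothing error act on top of the derivatives [w] tested by [D]. *)
have [B B0 hB] := schwartz_decays k [seq v ++ w | v <- vs, w <- ws] sp.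
exists (C * (B * kernel_moment psi (k + 2))) => l phil l01 hl.
rewrite -pairingB -mulrA; apply: hD => w z wws.
have rl := kernel_rapid psi (l ^+ 4).
have -> : pderivs w (phil - phi : schwartz R) z =
    plane_conv (psi (l ^+ 4)) (pderivs w phi) z - pderivs w phi z.
  rewrite [X in pderivs w X](_ : _ = (-1) *: (phi : R * R -> R) + plane_conv (psi (l ^+ 4)) phi); last first.
    apply/funext => x; transitivity (phil x - phi x); first by [].
    by rewrite hl scaleN1r [RHS]addrC.
  by rewrite pderivsD ?pderivs_conv// ?scaleN1r; [rewrite addrC|exact: conv_schwartz].
rewrite mulrAC; apply: smoothing_error => //; first exact: schwartz_pderivs.
move=> v x vvs; rewrite /pderivs -foldr_cat.
by apply: hB; apply/allpairsP; exists (v, w).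
Qed.

End mollify_facts.

(** * Length scales, the parabolic norm and geometric convergence *)

Section scales.
Variable R : realType.
Implicit Types (x y z h : R * R) (s t T l b : R) (n : nat).

(** The parabolic length attached to the time [T]: [psi (l ^+ 4)] is [psi 1] dilated by [l]. *)
Definition root4 T : R := T `^ 4^-1.

Lemma root4_gt0 T : 0 < T -> 0 < root4 T.
Proof. exact: powR_gt0. Qed.

Lemma root4K T : 0 <= T -> root4 T ^+ 4 = T.
Proof.
move=> T0; rewrite /root4 -powR_mulrn ?powR_ge0// -powRrM mulVf ?powRr1// pnatr_eq0.
Qed.

Lemma root4_le s t : 0 <= s -> s <= t -> root4 s <= root4 t.
Proof.
by move=> s0 st; apply: ge0_ler_powR; rewrite ?nnegrE// (le_trans s0).
Qed.

Lemma root4_1 : root4 1 = 1.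
Proof. by rewrite /root4 powR1. Qed.

Lemma root4_le1 t : 0 <= t <= 1 -> root4 t <= 1.
Proof. by move=> /andP[t0 t1]; rewrite -root4_1 root4_le. Qed.

Lemma root4_double s t : 0 <= s -> 0 <= t -> s <= 2 * t -> root4 s <= 2 * root4 t.
Proof.
move=> s0 t0 st; apply: le_trans (root4_le s0 st) _.
rewrite /root4 powRM// ler_wpM2r ?powR_ge0//; apply: ler1_powR; first by lra.
by rewrite invf_le1; lra.
Qed.

Lemma root4_half t : 0 <= t -> root4 t <= 2 * root4 (t / 2).
Proof. by move=> t0; apply: root4_double; rewrite ?divr_ge0//; lra. Qed.

Lemma ler_powRn b s t : 0 <= b -> 0 <= s -> s <= t -> s `^ b <= t `^ b.
Proof. by move=> b0 s0 st; apply: ge0_ler_powR; rewrite ?nnegrE// (le_trans s0). Qed.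

Lemma ger_powR_le1 s b c : 0 < s <= 1 -> c <= b -> s `^ b <= s `^ c.
Proof. by move=> s01 cb; apply: ger_powR. Qed.

Definition parnorm h : R := `|h.1| + Num.sqrt `|h.2|.

Lemma pdistE x y : pdist x y = parnorm (x - y).
Proof. by []. Qed.

Lemma parnorm_ge0 h : 0 <= parnorm h.
Proof. by rewrite addr_ge0// sqrtr_ge0. Qed.

Lemma parnorm0 : parnorm 0 = 0.
Proof. by rewrite /parnorm !normr0 sqrtr0 addr0. Qed.

Lemma parnormN h : parnorm (- h) = parnorm h.
Proof. by rewrite /parnorm !normrN. Qed.

Lemma parnorm_gt0 h : h != 0 -> 0 < parnorm h.
Proof.
move=> h0; rewrite lt_neqAle parnorm_ge0 andbT eq_sym.
apply: contra h0; rewrite paddr_eq0 ?sqrtr_ge0// => /andP[h1].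
by rewrite sqrtr_eq0 normr_le0 => h2; move: h1; rewrite normr_eq0; case: h h2 => a b /= /eqP -> /eqP ->.
Qed.

Lemma sqrtr_subadd s t : 0 <= s -> 0 <= t -> Num.sqrt (s + t) <= Num.sqrt s + Num.sqrt t.
Proof.
move=> s0 t0; have a0 := sqrtr_ge0 s; have b0 := sqrtr_ge0 t.
rewrite -(@ler_pXn2r _ 2)// ?nnegrE ?sqrtr_ge0 ?addr_ge0//.
rewrite sqr_sqrtr ?addr_ge0// sqrrD !sqr_sqrtr// addrAC lerDl mulrn_wge0// mulr_ge0.
Qed.

Lemma parnormD h h' : parnorm (h + h') <= parnorm h + parnorm h'.
Proof.
rewrite /parnorm addrACA; apply: lerD; first exact: ler_normD.
apply: le_trans (sqrtr_subadd _ _) => //; rewrite ler_sqrt ?addr_ge0//.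
exact: ler_normD.
Qed.

Lemma parnorm_dilate l z : 0 < l -> parnorm (l * z.1, l ^+ 2 * z.2) = l * parnorm z.
Proof.
move=> l0; rewrite /parnorm/= (normrM l) (normrM (l ^+ 2)) (gtr0_norm l0) (gtr0_norm (exprn_gt0 2 l0)) mulrDr.
by rewrite sqrtrM ?sqrtr_sqr ?(gtr0_norm l0)// exprn_ge0// ltW.
Qed.

Lemma parnorm_weight h : parnorm h <= weight h.
Proof.
have : Num.sqrt `|h.2| <= 1 + `|h.2|.
  rewrite -(@ler_pXn2r _ 2)// ?nnegrE ?sqrtr_ge0 ?addr_ge0// sqr_sqrtr//.
  by have := normr_ge0 h.2; nra.
by rewrite /parnorm /weight; lra.
Qed.

Lemma parnorm_powR_weight h b : 0 <= b <= 2 -> parnorm h `^ b <= weight h ^+ 2.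
Proof.
move=> /andP[b0 b2]; apply: le_trans (ler_powRn b0 (parnorm_ge0 h) (parnorm_weight h)) _.
by rewrite -powR_mulrn ?(ltW (weight_gt0 _))//; apply: ler_powR.
Qed.

(** The constant [4] comes from raising the factor [2] in [l <= 2 * t] to a power [b <= 2]. *)
Lemma parnorm_dilate_powR l t z b : 0 < l -> l <= 2 * t -> 0 <= b <= 2 ->
  parnorm (l * z.1, l ^+ 2 * z.2) `^ b <= 4 * t `^ b * weight z ^+ 2.
Proof.
move=> l0 lt b02; have /andP[b0 b2] := b02.
have t0 : 0 <= t by move: (lt_le_trans l0 lt); rewrite pmulr_rgt0// => /ltW.
rewrite parnorm_dilate// powRM ?parnorm_ge0//; last exact/ltW.
apply: ler_pM; rewrite ?powR_ge0//; last exact: parnorm_powR_weight.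
apply: le_trans (ler_powRn b0 (ltW l0) lt) _.
rewrite powRM// ler_wpM2r ?powR_ge0//.
have -> : 4 = 2 `^ 2%:R :> R by rewrite powR_mulrn// expr2; ring.
by apply: ler_powR => //; lra.
Qed.

(** The intervals of centre [a n] and radius [e n] are nested, because [e n.+1 + E * r ^+ n = e n];
    the limit is the supremum of their left ends. *)
Lemma geometric_limit (a : nat -> R) (E r : R) : 0 <= r < 1 ->
  (forall n, `|a n.+1 - a n| <= E * r ^+ n) ->
  exists L, forall n, `|L - a n| <= E / (1 - r) * r ^+ n.
Proof.
move=> /andP[r0 r1] H; have s0 : 0 < 1 - r by lra.
pose e n := E / (1 - r) * r ^+ n.
have eS n : e n.+1 + E * r ^+ n = e n.
  by rewrite /e exprS; field; rewrite gt_eqF.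
have E0 : 0 <= E by have := H 0%N; rewrite expr0 mulr1; apply: le_trans.
have e0 n : 0 <= e n by rewrite mulr_ge0 ?exprn_ge0// divr_ge0// ltW.
pose lo n := a n - e n; pose hi n := a n + e n.
have loS n : lo n <= lo n.+1.
  by have := H n; rewrite ler_norml /lo => /andP[h1 h2]; have := eS n; lra.
have hiS n : hi n.+1 <= hi n.
  by have := H n; rewrite ler_norml /hi => /andP[h1 h2]; have := eS n; lra.
have lo_mono m n : lo m <= lo (m + n)%N.
  by elim: n => [|n IH]; rewrite ?addn0// addnS (le_trans IH).
have hi_mono m n : hi (m + n)%N <= hi m.
  by elim: n => [|n IH]; rewrite ?addn0// addnS (le_trans _ IH).
have lohi m n : lo m <= hi n.
  apply: le_trans (lo_mono m n) _; apply: le_trans (hi_mono n m).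
  by rewrite addnC /lo /hi; have := e0 (n + m)%N; lra.
pose S := [set lo n | n in [set: nat]].
have hS : has_sup S.
  by split; [exists (lo 0%N), 0%N|exists (hi 0%N) => _ [n _ <-]].
exists (sup S) => n.
have h1 : lo n <= sup S by apply: sup_upper_bound => //; exists n.
have h2 : sup S <= hi n by apply: ge_sup => [|_ [m _ <-]]; [exists (lo 0%N), 0%N|].
by rewrite ler_norml -/(e n); move: h1 h2; rewrite /lo /hi => h1 h2; apply/andP; split; lra.
Qed.

Lemma geometric_le (x y E r : R) : 0 <= r < 1 ->
  (forall n, x <= y + E * r ^+ n) -> x <= y.
Proof.
move=> /andP[r0 r1] H.
have h : (fun n => y + E * r ^+ n) @ \oo --> y + E * 0.
  by apply: cvgD; [exact: cvg_cst|apply: cvgM; [exact: cvg_cst|apply: cvg_expr; rewrite ger0_norm]].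
rewrite -[y]addr0 -(mulr0 E); apply: ler_cvg_to (cvg_cst x) h _.
by apply: nearW => n.
Qed.

End scales.

(** * The commutator with the first coordinate, and continuity in time *)

Section coordinate_commutator.
Variable R : realType.
Implicit Types (x y h : R * R) (T t l : R).
Implicit Types (f : tempered_distribution R).
Local Notation I2 := (@plane_integral R).
Variable psi : R -> schwartz R.
Hypothesis hpsi : is_kernel psi.

(* Symmetrizing the convolution [psi_T * psi_T] under [h -> w - h]. *)
Lemma kernel_coord1_conv T w : 0 < T ->
  w.1 * psi (T + T) w = 2 * I2 (fun h => psi T h * (h.1 * psi T (w - h))).
Proof.
move=> T0; have rT := kernel_rapid psi T.
have p1 := rapid_poly rT.
have d1 : dominated (fun h => psi T h * (h.1 * psi T (w - h))).
  apply: rapid_dominated; apply: rapidMpoly => //; apply: poly_growthM.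
    exact: poly_growth_coord1.
  exact: (poly_growth_reflect w p1).
have d0 := rapid_dominated_conv w rT p1.
rewrite -(kernel_semigroup hpsi)//.
have -> : 2 * I2 (fun h => psi T h * (h.1 * psi T (w - h))) =
    I2 (fun h => psi T h * (h.1 * psi T (w - h))) +
    I2 (fun h => psi T (w - h) * ((w - h).1 * psi T (w - (w - h)))).
  by rewrite (plane_integral_reflect w d1); ring.
rewrite -plane_integralD//; last exact: (dominated_reflect w d1).
rewrite /plane_conv -plane_integralZ//.
by apply: eq_plane_integral => h; rewrite subKr /=; ring.
Qed.

(** The commutator has kernel [(y - z).1 * psi (T + T) (y - z)], which [kernel_coord1_conv] writes
    as a convolution with [psi T]. Hence [f] enters only through its mollification at time [T]. *)
Lemma commutator_coord1 f T y : 0 < T ->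
  commutator psi fst f (distr_mulx1 f) (T + T) y =
  2 * I2 (fun h => psi T h * (h.1 * mollify psi f T (y - h))).
Proof.
move=> T0; have TT : 0 < T + T by rewrite addr_gt0.
have rT := kernel_rapid psi T.
have r1 : rapid (fun h => 2 * (psi T h * h.1)).
  exact: (rapidZ 2 (rapidMpoly rT (@poly_growth_coord1 R))).
have r2 := rapid_reflect y r1.
have E : commutator psi fst f (distr_mulx1 f) (T + T) y =
   f (y.1 *: schwartz_reflect y (psi (T + T)) -
      schwartz_coord1 (schwartz_reflect y (psi (T + T)))).
  by rewrite pairingB pairingZ.
rewrite {}E (mollify_pairing hpsi f T0 r2); last first.
  move=> z; transitivity ((y - z).1 * psi (T + T) (y - z)).
    transitivity (y.1 * psi (T + T) (y - z) - z.1 * psi (T + T) (y - z)); first by [].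
    by rewrite -mulrBl.
  rewrite kernel_coord1_conv// /plane_conv.
  have d3 := rapid_dominated_conv z r2 (rapid_poly rT).
  rewrite -(plane_integral_reflect y d3) -plane_integralZ; last first.
    apply: rapid_dominated; apply: rapidMpoly => //; apply: poly_growthM.
      exact: poly_growth_coord1.
    exact: (poly_growth_reflect (y - z) (rapid_poly rT)).
  apply: eq_plane_integral => h; rewrite subKr.
  rewrite (_ : z - (y - h) = - (y - z - h)); last by rewrite !opprB addrCA addrC.
  by rewrite (kernel_even hpsi)//; ring.
have d4 := rapid_dominated (rapidMpoly r2 (mollify_poly hpsi f T0)).
rewrite -(plane_integral_reflect y d4) -plane_integralZ; last first.
  apply: rapid_dominated; apply: rapidMpoly => //; apply: poly_growthM.
    exact: poly_growth_coord1.
  exact: (poly_growth_reflect y (mollify_poly hpsi f T0)).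
by apply: eq_plane_integral => h; rewrite subKr; ring.
Qed.

(** The factor [h.1] gains one power of the length. The constant [4] is the [2] of
    [commutator_coord1] times a [2] for passing from the scale of [T / 2] to that of [T]. *)
Lemma commutator_coord1_bound f T y (b N1 : R) : 0 < T <= 1 -> b < 1 -> 0 <= N1 ->
  0 <= b ->
  (forall t x, 0 < t <= 1 -> `|mollify psi f t x| <= N1 * root4 t `^ (b - 2)) ->
  `|commutator psi fst f (distr_mulx1 f) T y| <=
    4 * kernel_moment psi 1 * N1 * root4 T `^ (b - 1).
Proof.
move=> /andP[T0 T1] b1 N10 b0 Hf.
have T20 : 0 < T / 2 by rewrite divr_gt0.
have {1}-> : T = T / 2 + T / 2 by field.
rewrite commutator_coord1//; set l := root4 (T / 2).
have l0 : 0 < l by exact: root4_gt0.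
rewrite -[X in psi X](root4K (ltW T20)) -/l normrM ger0_norm//.
have mF : poly_growth (fun h => h.1 * mollify psi f (T / 2) (y - h)).
  apply: poly_growthM; first exact: poly_growth_coord1.
  exact: (poly_growth_reflect y (mollify_poly hpsi f T20)).
have : `|I2 (fun h => psi (l ^+ 4) h * (h.1 * mollify psi f (T / 2) (y - h)))| <=
    (N1 * l `^ (b - 1)) * kernel_moment psi 1.
  apply: (kernel_moment_le hpsi l0 mF.1) => z; rewrite /= expr1 normrM normrM gtr0_norm//.
  have lE : l `^ (b - 1) = l * l `^ (b - 2).
    rewrite (_ : b - 1 = 1 + (b - 2)); last by ring.
    have c : (1 + (b - 2) == 0) ==> (l != 0) by rewrite (gt_eqF l0) implybT.
    by rewrite (powRD c) powRr1 ?(ltW l0).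
  rewrite lE [leLHS](_ : _ = l * (`|z.1| * `|mollify psi f (T / 2) (y - (l * z.1, l ^+ 2 * z.2))|)); last by ring.
  rewrite [leRHS](_ : _ = l * (weight z * (N1 * l `^ (b - 2)))); last by ring.
  rewrite ler_wpM2l ?(ltW l0)//; apply: ler_pM => //.
    by rewrite /weight addrAC lerDr addr_ge0.
  by apply: Hf; apply/andP; split=> //; lra.
move=> /(ler_wpM2l (ler0n R 2)) /le_trans; apply.
have lr : l `^ (b - 1) <= 2 * root4 T `^ (b - 1).
  have rT0 := root4_gt0 T0.
  have h : root4 T <= 2 * l by apply: root4_half; exact: ltW.
  have h1 : root4 T `^ (1 - b) <= (2 * l) `^ (1 - b).
    by apply: ler_powRn => //; [lra|exact: ltW].
  rewrite (@powRM _ 2 l (1 - b) (ler0n R 2) (ltW l0)) in h1.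
  have b1' : 1 - b <= 1 by rewrite lerBlDr lerDl.
  have h2 := @ler1_powR R 2 (1 - b) (ler1n R 2) b1'.
  rewrite -[b - 1]opprB !powRN ler_pdivlMr ?powR_gt0// mulrC ler_pdivrMr ?powR_gt0//.
  by apply: le_trans h1 _; rewrite ler_wpM2r ?powR_ge0.
rewrite [leRHS](_ : _ = 2 * (N1 * (2 * root4 T `^ (b - 1)) * kernel_moment psi 1)); last by ring.
by rewrite ler_wpM2l// ler_wpM2r ?kernel_moment_ge0// ler_wpM2l.
Qed.

(** By the semigroup property, passing from [T] to [t + T] smooths the fixed test function
    [psi_T(x - .)] by [psi_t], so [pairing_smoothing] applies. The constant depends on [x] and
    [T]. *)
Lemma mollify_time_continuity f T x : 0 < T -> exists C, forall t, 0 < t <= 1 ->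
  `|mollify psi f (t + T) x - mollify psi f T x| <= C * root4 t ^+ 2.
Proof.
move=> T0; have [C hC] := pairing_smoothing hpsi f (schwartz_reflect x (psi T)).
exists C => t /andP[t0 t1].
apply: hC; first by rewrite root4_gt0//= root4_le1// ltW.
move=> z; rewrite root4K ?(ltW t0)//=.
rewrite -(kernel_semigroup hpsi)//.
have d := rapid_dominated_conv (x - z) (kernel_rapid psi t) (rapid_poly (kernel_rapid psi T)).
rewrite /plane_conv -(plane_integral_reflect 0 d).
apply: eq_plane_integral => y; rewrite sub0r (kernel_even hpsi)//=.
by congr (_ * psi T _); rewrite opprK opprB addrA addrAC.
Qed.

End coordinate_commutator.

Lemma holder_continuous_at (R : realType) (F : R * R -> R) (x : R * R) (K g : R) :
  0 < g -> (forall y, pdist y x <= 1 -> `|F y - F x| <= K * pdist y x `^ g) ->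
  {for x, continuous F}.
Proof.
move=> g0 HF; apply/cvgrPdist_le => /= e e0.
have K1 : 0 < `|K| + 1 by rewrite ltr_pwDr.
pose r := Num.min 1 ((e / (`|K| + 1)) `^ g^-1).
have r0 : 0 < r by rewrite lt_min ltr01 powR_gt0// divr_gt0.
have r1 : r <= 1 by rewrite ge_min lexx.
have re : r `^ g <= e / (`|K| + 1).
  have h : r <= (e / (`|K| + 1)) `^ g^-1 by rewrite ge_min lexx orbT.
  apply: le_trans (ler_powRn (ltW g0) (ltW r0) h) _.
  by rewrite -powRrM mulVf ?gt_eqF// powRr1// divr_ge0 ?(ltW e0)// ltW.
(* The second coordinate enters [pdist] under a square root, hence the radius [(r / 2) ^+ 2] in the
   maximum norm. *)
apply/(@nbhs_ballP R (R * R)%type); exists ((r / 2) ^+ 2) => [|y].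
  by rewrite /= exprn_gt0// divr_gt0.
rewrite -ball_normE/= distrC => /ltW yx.
have [h1 h2] := ler_coord_norm (y - x).
have d1 : pdist y x <= r.
  rewrite pdistE /parnorm.
  have : Num.sqrt `|(y - x).2| <= r / 2.
    rewrite -(@ler_pXn2r _ 2)// ?nnegrE ?sqrtr_ge0 ?divr_ge0 ?(ltW r0)//.
    by rewrite sqr_sqrtr//; exact: le_trans yx.
  have : `|(y - x).1| <= (r / 2) ^+ 2 by exact: le_trans yx.
  have : (r / 2) ^+ 2 <= r / 2 by rewrite expr2; nra.
  by lra.
rewrite distrC; apply: le_trans (HF y (le_trans d1 r1)) _.
have p0 : 0 <= pdist y x by rewrite pdistE parnorm_ge0.
apply: (@le_trans _ _ ((`|K| + 1) * r `^ g)).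
  apply: (@le_trans _ _ ((`|K| + 1) * pdist y x `^ g)).
    by rewrite ler_wpM2r ?powR_ge0// (le_trans (ler_norm K))// lerDl.
  by rewrite ler_wpM2l ?(ltW K1)//; apply: ler_powRn => //; exact: ltW.
by rewrite mulrC -ler_pdivlMr.
Qed.

(** * The germ and its reconstruction *)

Section germ.
Variable R : realType.
Implicit Types (x y z : R * R) (T s t : R).
Variables (alpha : R) (psi : R -> schwartz R).
Variables (v : R * R -> R * R -> R) (f : tempered_distribution R)
  (vf : R * R -> tempered_distribution R) (N N1 : R)
  (u : R * R -> R) (M : R) (nu : R * R -> R).
Hypotheses (ha1 : 2 / 3 < alpha) (ha2 : alpha < 1) (hpsi : is_kernel psi).
Hypotheses (M0 : 0 <= M) (N0 : 0 <= N) (N10 : 0 <= N1).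

Local Notation A x := (commutator psi (v^~ x) f (vf x)).
Local Notation B := (commutator psi fst f (distr_mulx1 f)).
Local Notation fT := (mollify psi f).
Local Notation "T ^^ b" := (root4 T `^ b) (at level 30).

Hypothesis Hvx : forall x, exists C, forall y z, `|v y x - v z x| <= C * pdist y z `^ alpha.
Hypothesis Hf : forall T y, 0 < T <= 1 -> `|fT T y| <= N1 * T ^^ (alpha - 2).
Hypothesis Hvf : forall x, exists C, forall T y, 0 < T <= 1 ->
  `|mollify psi (vf x) T y| <= C * T ^^ (alpha - 2).
Hypothesis Hv : forall x x' y z,
  `|(v y x - v y x') - (v z x - v z x')| <= N * pdist x x' `^ alpha * pdist y z `^ alpha.
Hypothesis HA : forall x x' T y, 0 < T <= 1 ->
  `|A x T y - A x' T y| <= N * N1 * pdist x x' `^ alpha * T ^^ (2 * alpha - 2).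
Hypothesis Hu : forall x y, `|(u y - u x) - (v y x - v x x) - nu x * (y - x).1|
      <= M * pdist y x `^ (2 * alpha).

Ltac alpha_lra := move: ha1 ha2 => ? ?; lra.

Let a2ge0 : 0 <= 2 * alpha. Proof. by alpha_lra. Qed.

Let pdC x y : pdist x y = pdist y x.
Proof. by rewrite !pdistE -parnormN opprB. Qed.

Let pd0 x y : 0 <= pdist x y.
Proof. by rewrite pdistE parnorm_ge0. Qed.

(* Compare the expansions at [x] and [x'] in the point [y = x' + (d, 0)], where
   [d = pdist x x']. *)
Lemma nu_holder x x' : `|nu x - nu x'| <= 6 * (M + N) * pdist x x' `^ (2 * alpha - 1).
Proof.
have [->|xx'] := eqVneq x x'.
  by rewrite subrr normr0 mulr_ge0 ?powR_ge0// mulr_ge0// addr_ge0.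
pose d := pdist x x'; have d0 : 0 < d by rewrite /d pdistE parnorm_gt0// subr_eq0.
pose y := x' + (d, 0).
have yx' : pdist y x' = d.
  by rewrite pdistE /y addrC addKr /parnorm/= normr0 sqrtr0 addr0 gtr0_norm.
have yx : pdist y x <= 2 * d.
  rewrite pdistE (_ : y - x = (y - x') + (x' - x)); last by rewrite addrA subrK.
  apply: le_trans (parnormD _ _) _; rewrite -!pdistE yx' pdC -/d; alpha_lra.
have H1 : `|(u y - u x) - (v y x - v x x) - nu x * (y - x).1| <= 4 * M * d `^ (2 * alpha).
  apply: le_trans (Hu x y) _.
  have := ler_powRn a2ge0 (pd0 y x) yx; rewrite powRM ?(ltW d0)// => h.
  have h4 : 2 `^ (2 * alpha) <= 4 :> R.
    have -> : 4 = 2 `^ 2%:R :> R by rewrite powR_mulrn// expr2; ring.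
    by apply: ler_powR => //; alpha_lra.
  rewrite [leRHS](_ : _ = M * (4 * d `^ (2 * alpha))); last by ring.
  rewrite ler_wpM2l//; apply: le_trans h _.
  by rewrite ler_wpM2r ?powR_ge0.
have H2 := Hu x' y; rewrite yx' in H2.
have H3 := Hu x x'; rewrite pdC -/d in H3.
have H4 := Hv x x' y x'; rewrite yx' -/d in H4.
have dd : d `^ alpha * d `^ alpha = d `^ (2 * alpha).
  rewrite -powRD; first by congr (_ `^ _); ring.
  by rewrite (gt_eqF d0) implybT.
(* The increments of [u] cancel, and those of [v] combine into the mixed difference controlled by
   [Hv]. The expansions contribute [4 * M], [M] and [M], the mixed difference [N], whence the
   constant [6 * (M + N)]. *)
have E : (nu x - nu x') * d = - ((u y - u x) - (v y x - v x x) - nu x * (y - x).1)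
   + ((u y - u x') - (v y x' - v x' x') - nu x' * (y - x').1)
   + ((u x' - u x) - (v x' x - v x x) - nu x * (x' - x).1)
   - ((v y x - v y x') - (v x' x - v x' x')).
  by rewrite /y/=; ring.
have dE : d `^ (2 * alpha) = d `^ (2 * alpha - 1) * d.
  rewrite -[X in _ = _ * X]powRr1 ?(ltW d0)// -powRD ?subrK//.
  by rewrite (gt_eqF d0) implybT.
rewrite -(ler_pM2r d0) -/d -[leRHS]mulrA -dE -[X in _ * X <= _](gtr0_norm d0) -normrM E.
apply: le_trans (ler_normB _ _) _; apply: (@le_trans _ _ (4 * M * d `^ (2 * alpha) +
   M * d `^ (2 * alpha) + M * d `^ (2 * alpha) + N * d `^ (2 * alpha))).
  apply: lerD; last by rewrite -dd mulrA.
  apply: le_trans (ler_normD _ _) _; apply: lerD => //.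
  by apply: le_trans (ler_normD _ _) _; rewrite normrN; apply: lerD.
have := mulr_ge0 N0 (powR_ge0 d (2 * alpha)); alpha_lra.
Qed.

Definition germ t x := u x * fT t x - A x t x - nu x * B t x.

(* The mollification of [W_x]. *)
Definition frozen_germ x t y := (u x - v x x - nu x * x.1) * fT t y +
  mollify psi (vf x) t y + nu x * mollify psi (distr_mulx1 f) t y.

(** Each term is a product or difference matched to one pair of bounds: [Hu] with [Hf], then [HA],
    then [nu_holder] with the bound on the coordinate commutator. *)
Lemma germ_diff x t y : germ t y - frozen_germ x t y =
  ((u y - u x) - (v y x - v x x) - nu x * (y - x).1) * fT t y
  - (A y t y - A x t y) - (nu y - nu x) * B t y.
Proof. by rewrite /germ /frozen_germ /commutator /=; ring. Qed.

Lemma frozen_germ_diag x t : frozen_germ x t x = germ t x.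
Proof. by rewrite /germ /frozen_germ /commutator /=; ring. Qed.

Lemma frozen_germ_poly x t : 0 < t -> poly_growth (frozen_germ x t).
Proof.
move=> t0; apply: poly_growthD; first apply: poly_growthD.
- by apply: poly_growthM; [exact: poly_growth_cst|exact: mollify_poly].
- exact: mollify_poly.
- by apply: poly_growthM; [exact: poly_growth_cst|exact: mollify_poly].
Qed.

Lemma frozen_germ_semigroup x s t : 0 < s -> 0 < t ->
  plane_conv (psi s) (frozen_germ x t) x = germ (s + t) x.
Proof.
move=> s0 t0; have rs := kernel_rapid psi s.
rewrite -frozen_germ_diag /frozen_germ !(mollify_semigroup hpsi)//.
have d D := rapid_dominated_conv x rs (mollify_poly hpsi D t0).
have d1 := dominatedZ (u x - v x x - nu x * x.1) (d f).
have d3 := dominatedZ (nu x) (d (distr_mulx1 f)).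
rewrite /plane_conv -(plane_integralZ _ (d f)) -(plane_integralZ _ (d (distr_mulx1 f))).
rewrite -(plane_integralD d1 (d (vf x))) -(plane_integralD (dominatedD d1 (d (vf x))) d3).
by apply: eq_plane_integral => y; ring.
Qed.

Let KB := 4 * kernel_moment psi 1.

Let KB0 : 0 <= KB.
Proof. by rewrite mulr_ge0// kernel_moment_ge0. Qed.

Let HB T y : 0 < T <= 1 -> `|B T y| <= KB * N1 * T ^^ (alpha - 1).
Proof.
by move=> T01; apply: commutator_coord1_bound => //; alpha_lra.
Qed.

Let rho_split T a b : 0 < T -> T ^^ (a + b) = T ^^ a * T ^^ b.
Proof.
by move=> T0; rewrite powRD// (gt_eqF (root4_gt0 T0)) implybT.
Qed.

Let rho_le T a b : 0 < T <= 1 -> a <= b -> T ^^ b <= T ^^ a.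
Proof.
by move=> /andP[T0 T1] ab; apply: ger_powR_le1 => //; rewrite root4_gt0//= root4_le1// T1 ltW.
Qed.

Let gamma0 : 0 < 2 * alpha - 1. Proof. by alpha_lra. Qed.

Let pd_le1 x y a b : pdist y x <= 1 -> 0 < a <= b -> pdist y x `^ b <= pdist y x `^ a.
Proof.
move=> d1 /andP[a0 ab]; have [d0|d0] := ltP 0 (pdist y x).
  by apply: ger_powR_le1 => //; rewrite d0.
have -> : pdist y x = 0 by apply/eqP; rewrite eq_le d0 pd0.
by rewrite !powR0// gt_eqF//; alpha_lra.
Qed.

Lemma u_continuous : continuous u.
Proof.
move=> x; have [C HC] := Hvx x.
(* Among [2 * alpha], [alpha] and [1], each exponent exceeds [2 * alpha - 1], so at distances at
   most one this power bounds all three terms. *)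
apply: (@holder_continuous_at _ _ _ (`|C| + `|nu x| + M) _ gamma0) => y d1.
have -> : u y - u x = ((u y - u x) - (v y x - v x x) - nu x * (y - x).1) +
   (v y x - v x x) + nu x * (y - x).1 by ring.
apply: le_trans (ler_normD _ _) _; apply: le_trans (lerD (ler_normD _ _) (lexx _)) _.
rewrite [leRHS](_ : _ = M * pdist y x `^ (2 * alpha - 1) + `|C| * pdist y x `^ (2 * alpha - 1)
   + `|nu x| * pdist y x `^ (2 * alpha - 1)); last by ring.
apply: lerD; first apply: lerD.
- apply: le_trans (Hu x y) _; rewrite ler_wpM2l//; apply: pd_le1 => //; apply/andP; split; alpha_lra.
- apply: le_trans (HC y x) _; apply: le_trans (ler_wpM2r (powR_ge0 _ _) (ler_norm C)) _.
  by rewrite ler_wpM2l//; apply: pd_le1 => //; apply/andP; split; alpha_lra.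
- rewrite normrM ler_wpM2l//; apply: (@le_trans _ _ (pdist y x)).
    by rewrite pdistE /parnorm lerDl sqrtr_ge0.
  by rewrite -[leLHS]powRr1//; apply: pd_le1 => //; apply/andP; split; alpha_lra.
Qed.

Lemma nu_continuous : continuous nu.
Proof.
move=> x; apply: (@holder_continuous_at _ _ _ (6 * (M + N)) _ gamma0) => y d1.
exact: nu_holder.
Qed.

Lemma v_continuous x : continuous (v^~ x).
Proof.
move=> z; have [C HC] := Hvx x.
have a0 : 0 < alpha by alpha_lra.
by apply: (@holder_continuous_at _ _ _ C _ a0) => y _; exact: HC.
Qed.

Lemma commutator_continuous (g : R * R -> R) (D D' : tempered_distribution R) t :
  continuous g -> 0 < t -> continuous (commutator psi g D D' t).
Proof.
move=> cg t0 x; apply: cvgB; last exact: mollify_continuous.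
by apply: cvgM; [exact: cg|exact: mollify_continuous].
Qed.

Lemma germ_continuous t : 0 < t <= 1 -> continuous (germ t).
Proof.
move=> t01 x; have /andP[t0 t1] := t01.
have c1 : (fun y => u y * fT t y) @ x --> u x * fT t x.
  by apply: cvgM; [exact: u_continuous|exact: mollify_continuous].
have c2 : (fun y => A y t y) @ x --> A x t x.
  have a0 : 0 < alpha by alpha_lra.
  have H1 : (fun y => A y t y - A x t y) @ x --> A x t x - A x t x.
    apply: (@holder_continuous_at _ (fun y => A y t y - A x t y) x
      (N * N1 * t ^^ (2 * alpha - 2)) _ a0) => y _.
    by rewrite subrr subr0 [leRHS]mulrAC; exact: (HA y x).
  have H2 := @commutator_continuous (v^~ x) f (vf x) t (@v_continuous x) t0 x.
  have E : (fun y => A y t y) = (fun y => A y t y - A x t y) + A x t.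
    by apply/funext => y; rewrite [RHS]subrK.
  rewrite E; have H3 := cvgD H1 H2.
  by rewrite -[X in _ --> X](subrK (A x t x)); exact: H3.
have c3 : (fun y => nu y * B t y) @ x --> nu x * B t x.
  apply: cvgM; first exact: nu_continuous.
  apply: commutator_continuous => //.
  by move=> -[a b]; exact: cvg_fst.
exact: (cvgB (cvgB c1 c2) c3).
Qed.

Let wt2 x (b : R) : 0 <= b <= 2 -> pdist x 0 `^ b <= weight x ^+ 2.
Proof. by move=> hb; rewrite pdistE subr0; exact: parnorm_powR_weight. Qed.

(** Everything is compared with the base point [0]; since [2 * alpha <= 2], two powers of the weight
    suffice. The constant depends on all the data and serves only to make pairings converge. *)
Lemma germ_growth : exists2 C, 0 <= C & forall t x, 0 < t <= 1 ->
  `|germ t x| <= C * t ^^ (alpha - 2) * weight x ^+ 2.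
Proof.
have [Cv HCv] := Hvx 0; have [Cf HCf] := Hvf 0.
have a1 : 0 <= alpha <= 2 by apply/andP; split; alpha_lra.
have a2 : 0 <= 2 * alpha <= 2 by apply/andP; split; alpha_lra.
have a3 : 0 <= 2 * alpha - 1 <= 2 by apply/andP; split; alpha_lra.
have w1 x : 1 <= weight x ^+ 2 by [].
have bv x : `|v x 0| <= (`|v 0 0| + `|Cv|) * weight x ^+ 2.
  rewrite -[v x 0](subrK (v 0 0)) addrC; apply: le_trans (ler_normD _ _) _.
  rewrite mulrDl; apply: lerD; first by rewrite ler_peMr.
  apply: le_trans (HCv x 0) _; apply: le_trans (ler_wpM2r (powR_ge0 _ _) (ler_norm Cv)) _.
  by rewrite ler_wpM2l// wt2.
have bnu x : `|nu x| <= (`|nu 0| + 6 * (M + N)) * weight x ^+ 2.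
  rewrite -[nu x](subrK (nu 0)) addrC; apply: le_trans (ler_normD _ _) _.
  rewrite mulrDl; apply: lerD; first by rewrite ler_peMr.
  apply: le_trans (nu_holder x 0) _.
  by rewrite ler_wpM2l ?wt2// mulr_ge0// addr_ge0.
have bu x : `|u x| <= (`|u 0| + M + `|Cv| + `|nu 0|) * weight x ^+ 2.
  have -> : u x = u 0 + ((u x - u 0) - (v x 0 - v 0 0) - nu 0 * (x - 0).1) +
     (v x 0 - v 0 0) + nu 0 * x.1 by rewrite subr0; ring.
  rewrite !mulrDl; apply: le_trans (ler_normD _ _) _; apply: lerD; last first.
    rewrite normrM ler_wpM2l//; apply: (@le_trans _ _ (weight x)).
      by rewrite /weight addrAC lerDr addr_ge0.
    by rewrite expr2 ler_peMr// ltW.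
  apply: le_trans (ler_normD _ _) _; apply: lerD; last first.
    apply: le_trans (HCv x 0) _; apply: le_trans (ler_wpM2r (powR_ge0 _ _) (ler_norm Cv)) _.
    by rewrite ler_wpM2l// wt2.
  apply: le_trans (ler_normD _ _) _; apply: lerD; first by rewrite ler_peMr.
  by apply: le_trans (Hu 0 x) _; rewrite ler_wpM2l// wt2.
set cv := `|v 0 0| + `|Cv| in bv; set cn := `|nu 0| + 6 * (M + N) in bnu.
set cu := `|u 0| + M + `|Cv| + `|nu 0| in bu.
have [cv0 cn0 cu0] : [/\ 0 <= cv, 0 <= cn & 0 <= cu].
  by split; rewrite !addr_ge0// ?mulr_ge0// addr_ge0.
exists (cu * N1 + cv * N1 + `|Cf| + N * N1 + cn * KB * N1).
  have cN1 : 0 <= cn * KB * N1 by exact: mulr_ge0 (mulr_ge0 cn0 KB0) N10.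
  by apply: addr_ge0 => //; rewrite !addr_ge0// !mulr_ge0.
move=> t x t01; have /andP[t0 t1] := t01.
set p := t ^^ (alpha - 2); set W := weight x ^+ 2.
have p0 : 0 <= p by exact: powR_ge0.
have W1 : 1 <= W by exact: w1.
have W0 : 0 <= W by exact: le_trans W1.
have q1 : t ^^ (2 * alpha - 2) <= p by apply: rho_le => //; alpha_lra.
have q2 : t ^^ (alpha - 1) <= p by apply: rho_le => //; alpha_lra.
have -> : germ t x = u x * fT t x - v x 0 * fT t x + mollify psi (vf 0) t x
    - (A x t x - A 0 t x) - nu x * B t x by rewrite /germ /commutator; ring.
rewrite [leRHS](_ : _ = (cu * W) * (N1 * p) + (cv * W) * (N1 * p) + (`|Cf| * p) * W
   + (N * N1 * W * p) + (cn * W) * (KB * N1 * p)); last by ring.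
apply: le_trans (ler_normB _ _) _; apply: lerD; last first.
  rewrite normrM; apply: ler_pM => //; apply: le_trans (HB x t01) _.
  by rewrite ler_wpM2l// mulr_ge0.
apply: le_trans (ler_normB _ _) _; apply: lerD; last first.
  apply: le_trans (HA x 0 x t01) _; apply: ler_pM => //; rewrite ?powR_ge0 ?mulr_ge0 ?powR_ge0//.
  by rewrite ler_wpM2l ?mulr_ge0// wt2.
apply: le_trans (ler_normD _ _) _; apply: lerD; last first.
  apply: le_trans (HCf t x t01) _.
  apply: (@le_trans _ _ (`|Cf| * p)); first by rewrite ler_wpM2r// ler_norm.
  by rewrite ler_peMr// mulr_ge0.
by apply: le_trans (ler_normB _ _) _; apply: lerD; rewrite normrM; apply: ler_pM => //; exact: Hf.
Qed.

Lemma germ_poly t : 0 < t <= 1 -> poly_growth (germ t).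
Proof.
move=> t01; split; first exact: (continuous_measurable2 (germ_continuous t01)).
have [C C0 HC] := germ_growth.
by exists 2%N, (C * t ^^ (alpha - 2)) => x; exact: HC.
Qed.

(** Because [s <= 2 * t], powers of the distance under [psi s] become powers of [root4 t], up to a
    factor [4] and a weight. The constants [4 * M], [4 * N] and [24 * (M + N) * KB], times [N1], add
    up to the stated one. *)
Lemma germ_defect s t x : 0 < t <= 1 -> 0 < s <= 2 * t ->
  `|plane_conv (psi s) (germ t) x - germ (s + t) x| <=
  4 * (1 + 6 * KB) * (M + N) * N1 * t ^^ (3 * alpha - 2) * kernel_moment psi 2.
Proof.
move=> t01 /andP[s0 st]; have /andP[t0 t1] := t01.
have pF := germ_poly t01; have pG := frozen_germ_poly x t0.
have rs := kernel_rapid psi s.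
rewrite -(frozen_germ_semigroup x s0 t0) -(plane_convB x rs pF pG).
set H := fun y => germ t y - frozen_germ x t y.
have pH : poly_growth H.
  have := poly_growthD pF (poly_growthM (poly_growth_cst (-1)) pG).
  by congr (poly_growth _); apply/funext => y; rewrite /H mulN1r.
set l := root4 s; have l0 : 0 < l by exact: root4_gt0.
have lt : l <= 2 * root4 t by exact: root4_double (ltW s0) (ltW t0) st.
rewrite -[s](root4K (ltW s0)) -/l /plane_conv.
apply: (kernel_moment_le hpsi l0 (poly_growth_reflect x pH).1) => z.
set h := (l * z.1, l ^+ 2 * z.2); set y := x - h; rewrite /H germ_diff.
have dE : pdist y x = parnorm h by rewrite pdistE /y addrAC subrr add0r parnormN.
have hp b : 0 <= b <= 2 -> parnorm h `^ b <= 4 * t ^^ b * weight z ^+ 2.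
  exact: parnorm_dilate_powR l0 lt.
have a1 : 0 <= alpha <= 2 by apply/andP; split; alpha_lra.
have a2 : 0 <= 2 * alpha <= 2 by apply/andP; split; alpha_lra.
have a3 : 0 <= 2 * alpha - 1 <= 2 by apply/andP; split; alpha_lra.
set W := weight z ^+ 2 in hp *.
have e1 : `|((u y - u x) - (v y x - v x x) - nu x * (y - x).1) * fT t y| <=
    4 * M * N1 * t ^^ (3 * alpha - 2) * W.
  rewrite normrM; apply: le_trans (ler_pM (normr_ge0 _) (normr_ge0 _) (Hu x y) (Hf y t01)) _.
  rewrite dE (_ : 3 * alpha - 2 = 2 * alpha + (alpha - 2)); last by ring.
  rewrite (rho_split (2 * alpha))// [leRHS](_ : _ = M * (4 * t ^^ (2 * alpha) * W) * (N1 * t ^^ (alpha - 2))); last by ring.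
  by rewrite ler_wpM2r ?mulr_ge0 ?powR_ge0// ler_wpM2l// hp.
have e2 : `|A y t y - A x t y| <= 4 * N * N1 * t ^^ (3 * alpha - 2) * W.
  apply: le_trans (HA y x y t01) _.
  rewrite dE (_ : 3 * alpha - 2 = alpha + (2 * alpha - 2)); last by ring.
  rewrite (rho_split alpha)// [leRHS](_ : _ = N * N1 * (4 * t ^^ alpha * W) * t ^^ (2 * alpha - 2)); last by ring.
  by rewrite ler_wpM2r ?powR_ge0// ler_wpM2l ?hp// mulr_ge0.
have e3 : `|(nu y - nu x) * B t y| <= 24 * (M + N) * KB * N1 * t ^^ (3 * alpha - 2) * W.
  rewrite normrM; apply: le_trans (ler_pM (normr_ge0 _) (normr_ge0 _) (nu_holder y x) (HB y t01)) _.
  rewrite dE (_ : 3 * alpha - 2 = (2 * alpha - 1) + (alpha - 1)); last by ring.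
  rewrite (rho_split (2 * alpha - 1))// [leRHS](_ : _ = 6 * (M + N) * (4 * t ^^ (2 * alpha - 1) * W) * (KB * N1 * t ^^ (alpha - 1))); last by ring.
  rewrite ler_wpM2r ?ler_wpM2l ?hp//; first by rewrite mulr_ge0 ?powR_ge0// mulr_ge0.
  by rewrite mulr_ge0// addr_ge0.
apply: le_trans (ler_normB _ _) _; apply: le_trans (lerD (ler_normB _ _) (lexx _)) _.
apply: le_trans (lerD (lerD e1 e2) e3) _; rewrite le_eqVlt; apply/orP; left; apply/eqP.
by ring.
Qed.

(** At its own base point the germ is a fixed combination of mollified distributions, to each of
    which [mollify_time_continuity] applies. *)
Lemma germ_time_continuity x T : 0 < T -> exists C, forall t, 0 < t <= 1 ->
  `|germ (t + T) x - germ T x| <= C * root4 t ^+ 2.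
Proof.
move=> T0.
have [Cf hf] := mollify_time_continuity hpsi f x T0.
have [Cv hv] := mollify_time_continuity hpsi (vf x) x T0.
have [C1 h1] := mollify_time_continuity hpsi (distr_mulx1 f) x T0.
exists (`|u x - v x x - nu x * x.1| * Cf + Cv + `|nu x| * C1) => t t01.
rewrite -!frozen_germ_diag /frozen_germ.
set a := u x - v x x - nu x * x.1.
rewrite [X in `|X|](_ : _ = a * (fT (t + T) x - fT T x) +
  (mollify psi (vf x) (t + T) x - mollify psi (vf x) T x) +
  nu x * (mollify psi (distr_mulx1 f) (t + T) x - mollify psi (distr_mulx1 f) T x)); last by ring.
rewrite [leRHS](_ : _ = `|a| * (Cf * root4 t ^+ 2) + Cv * root4 t ^+ 2 + `|nu x| * (C1 * root4 t ^+ 2)); last by ring.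
apply: le_trans (ler_normD _ _) _; apply: lerD; last first.
  by rewrite normrM ler_wpM2l// h1.
apply: le_trans (ler_normD _ _) _; apply: lerD; last exact: hv.
by rewrite normrM ler_wpM2l// hf.
Qed.

End germ.

(** * Geometric limits with simultaneous rates *)

Section geometric.
Variable R : realType.
Implicit Types (r x y b : R).

Lemma geometric_eq x y (E r : R) : 0 <= r < 1 ->
  (forall n, `|x - y| <= E * r ^+ n) -> x = y.
Proof.
move=> hr H; apply/eqP; rewrite -subr_eq0 -normr_le0.
by apply: (geometric_le hr) => n; rewrite add0r.
Qed.

(** Limits obtained from different constants coincide. Hence one limit can be fixed before the
    constant, and inherits every available rate. *)
Lemma geometric_limit_all (a : nat -> R) r : 0 <= r < 1 ->
  (exists E, forall n, `|a n.+1 - a n| <= E * r ^+ n) ->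
  exists L, forall E, (forall n, `|a n.+1 - a n| <= E * r ^+ n) ->
    forall n, `|L - a n| <= E / (1 - r) * r ^+ n.
Proof.
move=> hr [E0 /(geometric_limit hr)[L0 h0]]; exists L0 => E /(geometric_limit hr)[L h] n.
suff -> : L0 = L by [].
apply: (@geometric_eq _ _ (E0 / (1 - r) + E / (1 - r)) _ hr) => m.
rewrite mulrDl (_ : L0 - L = (L0 - a m) - (L - a m)); last by ring.
by apply: le_trans (ler_normB _ _) (lerD (h0 m) (h m)).
Qed.

Lemma powR_gt1 x b : 1 < x -> 0 < b -> 1 < x `^ b.
Proof.
move=> x1 b0; have := @gt0_ltr_powR R b b0 1 x; rewrite powR1; apply=> //; rewrite nnegrE//.
by rewrite (le_trans ler01)// ltW.
Qed.

End geometric.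

(** * Reconstruction of a distribution from a germ of small defect *)

Section reconstruction.
Variable R : realType.
Implicit Types (x y z : R * R) (F : R * R -> R) (n : nat) (T s t : R).
Implicit Types (phi : schwartz R).
Local Notation I2 := (@plane_integral R).
Variables (psi : R -> schwartz R) (hpsi : is_kernel psi).
Variables (a th Cg D : R) (G : R -> R * R -> R).
Local Notation "T ^^ b" := (root4 T `^ b) (at level 30).
Hypotheses (th0 : 0 < th) (tha : th <= a) (th2 : th <= 2) (Cg0 : 0 <= Cg) (D0 : 0 <= D).
Hypothesis pG : forall t, 0 < t <= 1 -> poly_growth (G t).
Hypothesis gG : forall t x, 0 < t <= 1 -> `|G t x| <= Cg * t ^^ (a - 2) * weight x ^+ 2.
Hypothesis dG : forall s t x, 0 < t <= 1 -> 0 < s <= 2 * t ->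
  `|plane_conv (psi s) (G t) x - G (s + t) x| <= D * t ^^ th.
Hypothesis cG : forall x T, 0 < T -> exists C, forall t, 0 < t <= 1 ->
  `|G (t + T) x - G T x| <= C * root4 t ^+ 2.

Let K0 := kernel_moment psi 0.

Lemma kernel_conv_bounded s F x (C : R) : 0 < s -> poly_growth F ->
  (forall y, `|F y| <= C) -> `|plane_conv (psi s) F x| <= C * K0.
Proof.
move=> s0 pF hF; rewrite -[s](root4K (ltW s0)).
apply: (kernel_moment_le hpsi (root4_gt0 s0) (poly_growth_reflect x pF).1) => z.
by rewrite expr0 mulr1.
Qed.

Let q := 2 ^^ th.

Let q1 : 1 < q.
Proof. by apply: powR_gt1 => //; apply: powR_gt1; rewrite ?invr_gt0 ?ltr1n. Qed.

Let rhoM s t : 0 <= s -> 0 <= t -> (s * t) ^^ th = s ^^ th * t ^^ th.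
Proof. by move=> s0 t0; rewrite /root4 powRM// powRM ?powR_ge0. Qed.

Let rho_mono s t : 0 <= s -> s <= t -> s ^^ th <= t ^^ th.
Proof.
move=> s0 st; apply: ler_powRn; [exact: ltW|exact: powR_ge0|exact: root4_le].
Qed.

(** Chosen so that [D * K0 = L' * (q - 1)]: the cost of one doubling is the increase of
    [L' * t ^^ th] when [t] is doubled. *)
Let L' := D * K0 / (q - 1).
Let L := D + L'.

Let L'0 : 0 <= L'.
Proof.
rewrite divr_ge0//; first by rewrite mulr_ge0// kernel_moment_ge0.
by rewrite subr_ge0 ltW.
Qed.

(* The defect of passing from [t] to [s + t] is telescoped along the doublings
   of [t]; the correction [- L' * t ^^ th] closes the induction because [1 < q]. *)
Lemma defect_telescope j s t x : 0 < t <= 1 -> 0 < s <= 1 -> s <= 2 ^+ j.+1 * t ->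
  `|plane_conv (psi s) (G t) x - G (s + t) x| <= L * (s + t) ^^ th - L' * t ^^ th.
Proof.
elim: j s t => [|j IH] s t t01 s01.
  rewrite expr1 => st; have /andP[t0 t1] := t01; have /andP[s0 s1] := s01.
  have h := @dG s t x t01; rewrite s0 st in h.
  apply: le_trans (h isT) _; rewrite lerBrDr /L mulrDl.
  have tst : t ^^ th <= (s + t) ^^ th by rewrite rho_mono ?(ltW t0)// lerDr ltW.
  by apply: lerD; rewrite ler_wpM2l.
have [st _|st hs] := leP s (2 ^+ j.+1 * t); first exact: IH.
have /andP[t0 t1] := t01; have /andP[s0 s1] := s01.
have j1 : 1 <= 2 ^+ j :> R by rewrite exprn_ege1// ler1n.
have st2 : 2 * t < s.
  apply: le_lt_trans st; rewrite ler_wpM2r ?(ltW t0)// exprS ler_peMr//.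
have t20 : 0 < 2 * t <= 1 by apply/andP; split; lra.
have st0 : 0 < s - t <= 1 by apply/andP; split; lra.
have /andP[st00 _] := st0.
have hst : s - t <= 2 ^+ j.+1 * (2 * t) by rewrite mulrA -exprSr; lra.
have := IH (s - t) (2 * t) t20 st0 hst.
have -> : s - t + 2 * t = s + t by ring.
move=> h; have r1 := kernel_rapid psi (s - t).
have pGt := pG t01; have rt := kernel_rapid psi t.
(* One factor [psi t] is split off from [psi s] and spent on replacing the germ at [t] by the germ
   at [2 * t]; the remaining time is [s - t]. *)
have E : plane_conv (psi s) (G t) x = plane_conv (psi (s - t)) (plane_conv (psi t) (G t)) x.
  rewrite (plane_convA x r1 (schwartzP (psi t)) pGt); congr (plane_conv _ _ x).
  by apply/funext => z; rewrite (kernel_semigroup hpsi st00 t0 z) subrK.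
have pc := poly_growth_conv rt pGt; have pG2 := pG t20.
have H : forall y, `|plane_conv (psi t) (G t) y - G (2 * t) y| <= D * t ^^ th.
  have tt : 0 < t <= 2 * t by rewrite t0 ler_peMl ?(ltW t0)// ler1n.
  by move=> y; have := dG y t01 tt; rewrite (_ : t + t = 2 * t); last by ring.
have pH : poly_growth (fun y => plane_conv (psi t) (G t) y - G (2 * t) y).
  have := poly_growthD pc (poly_growthM (poly_growth_cst (-1)) pG2).
  by congr (poly_growth _); apply/funext => y; rewrite mulN1r.
have := kernel_conv_bounded x st00 pH H.
rewrite (plane_convB x r1 pc pG2) -E => h2.
rewrite -(subrKA (plane_conv (psi (s - t)) (G (2 * t)) x)).
apply: le_trans (ler_normD _ _) _; apply: le_trans (lerD h2 h) _.
have -> : (2 * t) ^^ th = q * t ^^ th by exact: rhoM (ler0n R 2) (ltW t0).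
rewrite addrCA lerD2l.
have e : D * K0 = L' * (q - 1) by rewrite /L' divfK// gt_eqF// subr_gt0.
rewrite [X in X - _ <= _]mulrAC e.
by move: (t ^^ th) (q) L' => P Q M; rewrite le_eqVlt; apply/orP; left; apply/eqP; ring.
Qed.

Lemma defect_bound s t x : 0 < t <= 1 -> 0 < s <= 1 ->
  `|plane_conv (psi s) (G t) x - G (s + t) x| <= L * (s + t) ^^ th.
Proof.
move=> t01 s01; have /andP[t0 t1] := t01; have /andP[s0 s1] := s01.
have [j hj] : exists j, s <= 2 ^+ j.+1 * t.
  have h := archi_boundP (divr_ge0 (ltW s0) (ltW t0)); exists (Num.bound (s / t)).
  rewrite -ler_pdivrMr//; apply: le_trans (ltW h) _.
  by rewrite -natrX ler_nat ltnW// (leq_trans (ltn_expl _ (ltnSn 1)))// leq_exp2l.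
apply: le_trans (defect_telescope x t01 s01 hj) _.
by rewrite lerBlDr lerDl; exact: mulr_ge0 L'0 (powR_ge0 _ _).
Qed.

Let tn n : R := 2^-1 ^+ n.

Let tn01 n : 0 < tn n <= 1.
Proof.
have h0 : 0 < 2^-1 :> R by rewrite invr_gt0.
have h1 : 2^-1 <= 1 :> R by rewrite invf_le1// ler1n.
by rewrite /tn exprn_gt0//= exprn_ile1// ltW.
Qed.

Let r := 2^-1 ^^ th.

Let r01 : 0 <= r < 1.
Proof.
rewrite powR_ge0/=; have : r * q = 1.
  by rewrite /r /q -rhoM ?invr_ge0// mulVf// root4_1 powR1.
move=> rq; have r0 : 0 <= r by exact: powR_ge0.
by rewrite ltNge; apply/negP => r1; have := q1; nra.
Qed.

Let rhotn n : tn n ^^ th = r ^+ n.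
Proof.
elim: n => [|n IH]; first by rewrite /tn !expr0 root4_1 powR1.
by rewrite /tn !exprS rhoM ?invr_ge0// -?IH// exprn_ge0// invr_ge0.
Qed.

Let J := I2 (fun x => (weight x ^+ 4)^-1).

Let J0 : 0 <= J.
Proof. by apply: plane_integral_ge0 => x; rewrite invr_ge0. Qed.

Lemma plane_integral_decay F (C : R) : measurable2 F ->
  (forall x, `|F x| * weight x ^+ 4 <= C) -> `|I2 F| <= C * J.
Proof.
move=> mF hF.
have dw : dominated (fun x : R * R => (weight x ^+ 4)^-1).
  split; first exact: measurable2_weightV.
  by exists 1 => x; rewrite ger0_norm ?invr_ge0// mulVf// expf_neq0// weight_neq0.
rewrite -plane_integralZ//; apply: ler_norm_plane_integral.
- by split=> //; exists C.
- exact: dominatedZ.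
by move=> x; rewrite ler_pdivlMr// weightX_gt0.
Qed.

(** The empty word bounds the test function itself, the others are those of [smoothing_error]. They
    are used with weight exponent [6]: four for integrability and two for the growth of [G]. *)
Let ws := [:: [::]; [:: true]; [:: false; false]; [:: true; false]].

Let an phi n := I2 (fun y => G (tn n) y * phi y).

Let E0 := (D + Cg * kernel_moment psi 8) * J.

(** With [t = tn n.+1], self-adjointness of convolution with [psi t] splits the step into [G t]
    tested against the smoothing error of [phi], of order [t ^^ (a - 2) * root4 t ^+ 2], and the
    defect tested against [phi]. Both are [O(t ^^ th)] since [th <= a]. *)
Lemma germ_pairing_step phi (B : R) n :
  (forall w x, w \in ws -> `|pderivs w phi x| * weight x ^+ 6 <= B) ->
  `|an phi n.+1 - an phi n| <= E0 * B * r ^+ n.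
Proof.
move=> hB; rewrite distrC; have B0 : 0 <= B.
  by apply: le_trans (hB [::] 0 _) => //; rewrite mulr_ge0.
set t := tn n.+1; have t01 : 0 < t <= 1 by exact: tn01.
have /andP[t0 t1] := t01.
have tt : 0 < t <= 2 * t by rewrite t0 ler_peMl ?(ltW t0)// ler1n.
have tE : tn n = t + t by rewrite /t /tn exprS; field.
have t201 : 0 < t + t <= 1 by rewrite -tE; exact: tn01.
have rt := kernel_rapid psi t; have rp := schwartz_rapid (schwartzP phi).
have pGt := pG t01; have pG2 := pG t201; have pc := poly_growth_conv rt pGt.
have rc := schwartz_rapid (conv_schwartz rt (schwartzP phi)).
have d1 := rapid_dominated (rapidMpoly rp pG2).
have d2 := rapid_dominated (rapidMpoly rp pc).
have d3 := rapid_dominated (rapidMpoly rc pGt).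
have d4 := rapid_dominated (rapidMpoly rp pGt).
have cm F1 F2 : (fun y : R * R => F1 y * F2 y) = (fun y => F2 y * F1 y :> R).
  by apply/funext => y; rewrite mulrC.
rewrite cm in d1; rewrite cm in d2; rewrite cm in d3; rewrite cm in d4.
have e := plane_conv_adjoint rt rp pGt (fun z => kernel_even hpsi z t0).
have -> : an phi n - an phi n.+1 =
  I2 (fun y => G t y * (plane_conv (psi t) phi y - phi y)) -
  I2 (fun y => (plane_conv (psi t) (G t) y - G (t + t) y) * phi y).
  have -> : I2 (fun y => G t y * (plane_conv (psi t) phi y - phi y)) =
      I2 (fun y => G t y * plane_conv (psi t) phi y) - I2 (fun y => G t y * phi y).
    by rewrite -(plane_integralB d3 d4); apply: eq_plane_integral => y; rewrite mulrBr.
  have -> : I2 (fun y => (plane_conv (psi t) (G t) y - G (t + t) y) * phi y) =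
      I2 (fun y => plane_conv (psi t) (G t) y * phi y) - I2 (fun y => G (t + t) y * phi y).
    by rewrite -(plane_integralB d2 d1); apply: eq_plane_integral => y; rewrite mulrBl.
  by rewrite e /an -/t tE; ring.
have rl : r ^+ n.+1 <= r ^+ n.
  by case/andP: r01 => r0 r1; rewrite exprS ler_piMl// ?exprn_ge0// ltW.
apply: (@le_trans _ _ (E0 * B * r ^+ n.+1)); last first.
  rewrite ler_wpM2l//; apply: mulr_ge0 => //; apply: mulr_ge0 => //.
  by rewrite addr_ge0// mulr_ge0// kernel_moment_ge0.
rewrite -rhotn -/t.
apply: le_trans (ler_normB _ _) _.
rewrite [leRHS](_ : _ = (Cg * (B * kernel_moment psi 8)) * t ^^ th * J + (D * t ^^ th * B) * J); last first.
  by rewrite /E0; ring.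
apply: lerD; apply: plane_integral_decay.
- apply: measurable2M; first exact: pGt.1.
  by apply: measurable2B; [exact: rc.1|exact: rp.1].
- move=> x; set d := plane_conv (psi t) phi x - phi x.
  have rt01 : 0 < root4 t <= 1 by rewrite root4_gt0//= root4_le1// t1 ltW.
  have hd : `|d| * weight x ^+ 6 <= B * root4 t ^+ 2 * kernel_moment psi 8.
    rewrite /d -[X in psi X](root4K (ltW t0)).
    apply: (smoothing_error hpsi x (schwartzP phi) rt01) => w y hw.
    by apply: hB; rewrite inE hw orbT.
  rewrite normrM; apply: (@le_trans _ _ (Cg * t ^^ (a - 2) * weight x ^+ 2 * `|d| * weight x ^+ 4)).
    by rewrite ler_wpM2r// ler_wpM2r// gG.
  rewrite [leLHS](_ : _ = Cg * t ^^ (a - 2) * (`|d| * weight x ^+ 6)); last by ring.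
  apply: le_trans (ler_wpM2l _ hd) _; first exact: mulr_ge0 Cg0 (powR_ge0 _ _).
  have ta : t ^^ (a - 2) * root4 t ^+ 2 <= t ^^ th.
    have c : (a - 2 + 2%:R == 0) ==> (root4 t != 0).
      by rewrite (gt_eqF (root4_gt0 t0)) implybT.
    rewrite -(powR_mulrn 2 (powR_ge0 t 4^-1)) -(powRD c) subrK.
    exact: ger_powR_le1 rt01 tha.
  rewrite [leLHS](_ : _ = (Cg * (B * kernel_moment psi 8)) * (t ^^ (a - 2) * root4 t ^+ 2)); last by ring.
  rewrite ler_wpM2l//; exact: mulr_ge0 Cg0 (mulr_ge0 B0 (kernel_moment_ge0 psi 8)).
- apply: measurable2M; last exact: rp.1.
  by apply: measurable2B; [exact: pc.1|exact: pG2.1].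
- move=> x; rewrite normrM -[leLHS]mulrA; apply: ler_pM; [exact: normr_ge0|exact: mulr_ge0|exact: dG|].
  apply: le_trans (hB [::] x _); last by rewrite inE.
  by rewrite ler_wpM2l// weightX_le.
Qed.

Lemma germ_reconstruction : exists uf : tempered_distribution R,
  forall T x, 0 < T <= 1 ->
    `|mollify psi uf T x - G T x| <= q * (1 + K0 / (q - 1)) * D * T ^^ th.
Proof.
have E00 : 0 <= E0.
  have k8 := kernel_moment_ge0 psi 8.
  exact: mulr_ge0 (addr_ge0 D0 (mulr_ge0 Cg0 k8)) J0.
(* The limit is chosen together with its rate for every admissible [B], so that temperedness of [U]
   follows with constants independent of [phi]. *)
have /choice[U hU] : forall phi, exists U, forall B,
    (forall w x, w \in ws -> `|pderivs w phi x| * weight x ^+ 6 <= B) ->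
    forall n, `|U - an phi n| <= E0 * B / (1 - r) * r ^+ n.
  move=> phi; have [B _ hB] := schwartz_decays 6 ws (schwartzP phi).
  have hE : exists E, forall n, `|an phi n.+1 - an phi n| <= E * r ^+ n.
    by exists (E0 * B) => n; exact: germ_pairing_step.
  have [U hU] := geometric_limit_all r01 hE.
  by exists U => B' hB'; apply: hU => n; exact: germ_pairing_step.
have da phi n : dominated (fun y => G (tn n) y * phi y).
  have := rapid_dominated (rapidMpoly (schwartz_rapid (schwartzP phi)) (pG (tn01 n))).
  by congr dominated; apply/funext => y; rewrite mulrC.
have Ulin (c : R) phi chi : U (c *: phi + chi) = c * U phi + U chi.
  have [B1 _ h1] := schwartz_decays 6 ws (schwartzP phi).
  have [B2 _ h2] := schwartz_decays 6 ws (schwartzP chi).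
  have [B3 _ h3] := schwartz_decays 6 ws (schwartzP (c *: phi + chi)).
  apply: (@geometric_eq _ _ _ (E0 * B3 / (1 - r) + `|c| * (E0 * B1 / (1 - r)) + E0 * B2 / (1 - r)) _ r01) => n.
  have e : an (c *: phi + chi) n = c * an phi n + an chi n.
    rewrite /an -(plane_integralZ c (da phi n)) -plane_integralD; last 2 first.
    - exact: dominatedZ (da phi n).
    - exact: da.
    apply: eq_plane_integral => y.
    transitivity (G (tn n) y * (c * phi y + chi y)); first by [].
    by ring.
  rewrite (_ : U (c *: phi + chi) - _ = (U (c *: phi + chi) - an (c *: phi + chi) n) -
    c * (U phi - an phi n) - (U chi - an chi n)); last by rewrite e; ring.
  rewrite !mulrDl; apply: le_trans (ler_normB _ _) (lerD _ (hU chi _ h2 n)).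
  apply: le_trans (ler_normB _ _) (lerD (hU _ _ h3 n) _).
  by rewrite normrM -[leRHS]mulrA ler_wpM2l// hU.
have Utemp := @tempered_of_bound _ U (E0 / (1 - r) + Cg * J) 6 ws.
(* [U phi] is compared with its approximation at [n = 0], the pairing with the germ at time one. *)
have /Utemp {}Utemp : forall phi (B : R),
    (forall w x, w \in ws -> `|pderivs w phi x| * weight x ^+ 6 <= B) ->
    `|U phi| <= (E0 / (1 - r) + Cg * J) * B.
  move=> phi B hB; rewrite -[U phi](subrK (an phi 0)) mulrDl.
  apply: le_trans (ler_normD _ _) (lerD _ _).
    by have := hU phi B hB 0%N; rewrite expr0 mulr1 mulrAC.
  rewrite mulrAC; apply: plane_integral_decay => [|x]; first exact: (da phi 0%N).1.
  have h1 := gG x (tn01 0); rewrite {2}/tn expr0 root4_1 powR1 mulr1 in h1.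
  rewrite normrM; apply: (@le_trans _ _ (Cg * weight x ^+ 2 * `|phi x| * weight x ^+ 4)).
    by rewrite ler_wpM2r// ler_wpM2r.
  rewrite [leLHS](_ : _ = Cg * (`|phi x| * weight x ^+ 6)); last by ring.
  by rewrite ler_wpM2l//; apply: (hB [::]); rewrite inE.
exists (Distribution Ulin Utemp) => T x T01; have /andP[T0 T1] := T01.
set phi := schwartz_reflect x (psi T).
have aE n : an phi n = plane_conv (psi T) (G (tn n)) x.
  have d := rapid_dominated_conv x (kernel_rapid psi T) (pG (tn01 n)).
  rewrite /plane_conv -(plane_integral_reflect x d).
  by apply: eq_plane_integral => y; rewrite subKr mulrC.
have [B _ hB] := schwartz_decays 6 ws (schwartzP phi).
have [C hC] := cG x T0.
(* Three errors at level [n]: from [U phi] to its approximation, the defect from [tn n] to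
   [T + tn n], and continuity in time from [T + tn n] to [T]. All vanish in the limit but the part
   [L * q * T ^^ th] of the defect. *)
apply: (@geometric_le _ _ _ (E0 * B / (1 - r) + L * q + `|C|) _ r01) => n.
have /andP[t0 t1] := tn01 n.
have h1 := hU phi B hB n; rewrite aE in h1.
have h2 := defect_bound x (tn01 n) T01.
have h3 : `|G (tn n + T) x - G T x| <= `|C| * r ^+ n.
  apply: le_trans (hC _ (tn01 n)) _.
  apply: (@le_trans _ _ (`|C| * root4 (tn n) ^+ 2)).
    by rewrite ler_wpM2r ?ler_norm// exprn_ge0// powR_ge0.
  rewrite ler_wpM2l// -rhotn -(powR_mulrn 2 (powR_ge0 (tn n) 4^-1)).
  by apply: ger_powR_le1 => //; rewrite root4_gt0//= root4_le1// t1 ltW.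
have L0 : 0 <= L by exact: addr_ge0.
(* The sum of the two times is at most twice the larger one, which splits the power. *)
have h4 : L * (T + tn n) ^^ th <= L * q * T ^^ th + L * q * r ^+ n.
  rewrite -mulrDr -mulrA ler_wpM2l// -rhotn mulrDr.
  have [m1|m1] := leP T (tn n).
    apply: (@le_trans _ _ ((2 * tn n) ^^ th)).
      by apply: rho_mono; [exact: addr_ge0 (ltW T0) (ltW t0)|rewrite mulr2n mulrDl !mul1r lerD2r].
    rewrite (rhoM (ler0n R 2) (ltW t0)) lerDr.
    exact: mulr_ge0 (powR_ge0 _ _) (powR_ge0 _ _).
  apply: (@le_trans _ _ ((2 * T) ^^ th)).
    by apply: rho_mono; [exact: addr_ge0 (ltW T0) (ltW t0)|rewrite mulr2n mulrDl !mul1r lerD2l ltW].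
  rewrite (rhoM (ler0n R 2) (ltW T0)) lerDl.
  exact: mulr_ge0 (powR_ge0 _ _) (powR_ge0 _ _).
have -> : mollify psi (Distribution Ulin Utemp) T x = U phi by [].
have -> : q * (1 + K0 / (q - 1)) * D * T ^^ th = L * q * T ^^ th.
  by rewrite /L /L'; move: (T ^^ th) ((q - 1)^-1) => P Q; ring.
rewrite (_ : U phi - G T x = (U phi - plane_conv (psi T) (G (tn n)) x) +
  (plane_conv (psi T) (G (tn n)) x - G (T + tn n) x) + (G (tn n + T) x - G T x)); last first.
  by rewrite [tn n + T]addrC; ring.
apply: le_trans (ler_normD _ _) _; apply: le_trans (lerD (ler_normD _ _) (lexx _)) _.
apply: le_trans (lerD (lerD h1 (le_trans h2 h4)) h3) _.
by move: (r ^+ n) (T ^^ th) => P Q; rewrite le_eqVlt; apply/orP; left; apply/eqP; ring.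
Qed.

(** Tested against [phi], the difference of the mollifications at time [tn n] is of order [r ^+ n],
    and so are the two smoothing errors because [th <= 2]. *)
Lemma mollify_inj (D1 D2 : tempered_distribution R) (E : R) :
  (forall T x, 0 < T <= 1 ->
    `|mollify psi D1 T x - mollify psi D2 T x| <= E * T ^^ th) -> D1 = D2.
Proof.
move=> H.
suff : pairing D1 = pairing D2.
  case: D1 D2 {H} => [p1 l1 t1] [p2 l2 t2] /= e; subst p2.
  by congr Distribution; exact: Prop_irrelevance.
apply/funext => phi.
have rp := schwartz_rapid (schwartzP phi).
have [C1 h1] := pairing_smoothing hpsi D1 phi.
have [C2 h2] := pairing_smoothing hpsi D2 phi.
apply: (@geometric_eq _ _ _ (`|C1| + `|C2| + I2 (fun y => `|phi y|) * E) _ r01) => n.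
have t01 := tn01 n; have /andP[t0 t1] := t01; set t := tn n in t01 t0 t1 *.
have l01 : 0 < root4 t <= 1 by rewrite root4_gt0//= root4_le1// t1 ltW.
pose phil := Schwartz (conv_schwartz_pred (psi t) rp).
have hl z : phil z = plane_conv (psi (root4 t ^+ 4)) phi z.
  by rewrite (root4K (ltW t0)) plane_convC//; exact: kernel_rapid.
have hE (D3 : tempered_distribution R) : D3 phil = I2 (fun y => phi y * mollify psi D3 t y).
  exact: (mollify_pairing hpsi D3 t0 rp).
have l2 : root4 t ^+ 2 <= r ^+ n.
  rewrite -rhotn -(powR_mulrn 2 (powR_ge0 t 4^-1)).
  exact: ger_powR_le1 l01 th2.
have e1 (C3 X : R) : `|X| <= C3 * root4 t ^+ 2 -> `|X| <= `|C3| * r ^+ n.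
  move=> /le_trans; apply; apply: (@le_trans _ _ (`|C3| * root4 t ^+ 2)).
    by rewrite ler_wpM2r ?ler_norm// exprn_ge0// powR_ge0.
  by rewrite ler_wpM2l.
have {}h1 := e1 _ _ (h1 _ phil l01 hl); have {}h2 := e1 _ _ (h2 _ phil l01 hl).
have h3 : `|D1 phil - D2 phil| <= I2 (fun y => `|phi y|) * E * r ^+ n.
  have d1 := rapid_dominated (rapidMpoly rp (mollify_poly hpsi D1 t0)).
  have d2 := rapid_dominated (rapidMpoly rp (mollify_poly hpsi D2 t0)).
  have d3 := dominated_norm (rapid_dominated rp).
  rewrite !hE -(plane_integralB d1 d2) -mulrA mulrC -(plane_integralZ _ d3).
  apply: ler_norm_plane_integral; [exact: dominatedB|exact: dominatedZ|move=> y].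
  by rewrite -mulrBr normrM mulrC ler_wpM2r// -rhotn; exact: H.
rewrite (_ : D1 phi - D2 phi = - (D1 phil - D1 phi) + (D2 phil - D2 phi) + (D1 phil - D2 phil)); last by ring.
rewrite !mulrDl; apply: le_trans (ler_normD _ _) (lerD _ h3).
by apply: le_trans (ler_normD _ _) (lerD _ h2); rewrite normrN.
Qed.

End reconstruction.

(** * Norms as pointwise bounds, and the theorem *)

Section norms.
Variable R : realType.
Implicit Types (x y z : R * R) (g : R * R -> R) (F : R -> R * R -> R) (T a b C : R).

Lemma scaled_sup_leP F b C : (scaled_sup b F <= C%:E)%E <->
  forall T x, 0 < T <= 1 -> `|F T x| <= C * root4 T `^ (- b).
Proof.
have p0 T : 0 < T <= 1 -> 0 < root4 T `^ b.
  by move=> /andP[T0 _]; exact/powR_gt0/root4_gt0.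
split=> [h T x T01|h].
  rewrite powRN ler_pdivlMr ?p0// mulrC -lee_fin; apply: le_trans h.
  apply: le_trans (ereal_sup_ubound _); last by exists T.
  rewrite EFinM; apply: lee_wpmul2l; first by rewrite lee_fin ltW// p0.
  by apply: ereal_sup_ubound; exists x.
apply: ge_ereal_sup => _ [T T01 <-].
apply: (@le_trans _ _ ((root4 T `^ b)%:E * (C * root4 T `^ (- b))%:E)%E).
  apply: lee_wpmul2l; first by rewrite lee_fin ltW// p0.
  by apply: ge_ereal_sup => _ [x _ <-]; rewrite lee_fin h.
by rewrite -EFinM lee_fin powRN mulrCA divff ?mulr1// gt_eqF// p0.
Qed.

Lemma holder_seminorm_le g a C y z : 0 < a -> (holder_seminorm a g <= C%:E)%E ->
  `|g y - g z| <= C * pdist y z `^ a.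
Proof.
move=> a0 h; have [->|yz] := eqVneq y z.
  by rewrite subrr normr0 pdistE subrr parnorm0 powR0 ?mulr0// gt_eqF.
rewrite -ler_pdivrMr; last by rewrite powR_gt0// pdistE parnorm_gt0// subr_eq0.
by rewrite -lee_fin; apply: le_trans h; apply: ereal_sup_ubound; exists (y, z).
Qed.

Lemma lt_pinfty_bound (X : \bar R) : (X < +oo)%E -> exists C : R, (X <= C%:E)%E.
Proof.
by case: X => [r _|//|_]; [exists r|exists 0; rewrite leNye].
Qed.

End norms.

Theorem lemma3p3 (R : realType) (alpha : R) (halpha : 2 / 3 < alpha < 1) :
  exists C : R, forall (psi : R -> schwartz R), is_kernel psi ->
  forall (v : R * R -> R * R -> R) (f : tempered_distribution R)
         (vf : R * R -> tempered_distribution R) (N N1 : R)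
         (u : R * R -> R) (M : R) (nu : R * R -> R),
  (forall x, (holder_seminorm alpha (v^~ x) < +oo)%E) ->
  (neg_norm psi alpha f < +oo)%E ->
  (forall x, (neg_norm psi alpha (vf x) < +oo)%E) ->
  (forall x x', (holder_seminorm alpha (fun y => (v y x - v y x')%R)
                   <= (N * pdist x x' `^ alpha)%:E)%E) ->
  (neg_norm psi alpha f <= N1%:E)%E ->
  (forall x x',
    (scaled_sup (2 - 2 * alpha)
       (fun T y => (commutator psi (v^~ x) f (vf x) T y
                    - commutator psi (v^~ x') f (vf x') T y)%R)
     <= (N * N1 * pdist x x' `^ alpha)%:E)%E) ->
  (forall x y,
    `|(u y - u x) - (v y x - v x x) - nu x * (y - x).1|
      <= M * pdist y x `^ (2 * alpha)) ->
  exists uf : tempered_distribution R,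
    unique (fun uf : tempered_distribution R =>
      (scaled_sup (2 - 3 * alpha)
         (fun T x => (commutator psi u f uf T x
                      - commutator psi (v^~ x) f (vf x) T x
                      - nu x * commutator psi fst f (distr_mulx1 f) T x)%R)
       <= (C * (M + N) * N1)%:E)%E) uf
    /\
    (fun_periodic u -> fun_periodic nu -> (forall x, fun_periodic (v^~ x)) ->
     distr_periodic f -> (forall x, distr_periodic (vf x)) ->
     (forall x, (holder_seminorm alpha (v^~ x) <= N%:E)%E) ->
     (forall x, (scaled_sup (2 - 2 * alpha) (commutator psi (v^~ x) f (vf x))
                   <= (N * N1)%:E)%E) ->
     (scaled_sup (2 - 2 * alpha) (commutator psi u f uf)
        <= (C * (M + N) * N1)%:E)%E).
Proof.
have /andP[ha1 ha2] := halpha.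
(* The constant is to be fixed before the kernel, yet consists of its moments: they are taken from a
   reference kernel. If no kernel exists, any constant will do. *)
have [[psi0 hpsi0]|nokernel] := pselect (exists psi0 : R -> schwartz R, is_kernel psi0); last first.
  by exists 0 => psi hpsi; case: nokernel; exists psi.
pose K m := kernel_moment psi0 m; pose th := 3 * alpha - 2.
pose q : R := root4 2 `^ th.
(* The constant of [germ_reconstruction] for the defect of [germ_defect], with the factor
   [(M + N) * N1] taken out. *)
pose C1 := q * (1 + K 0%N / (q - 1)) * (4 * (1 + 6 * (4 * K 1%N)) * K 2%N).
(* In the periodic bound, [1] pays for the commutator with [v], [4 * K 1] for the one with the
   coordinate, and [C1] for the reconstruction error. *)
exists (1 + 4 * K 1%N + C1) => psi hpsi v f vf N N1 u M nu hv hf hvf hN hN1 hA Hu.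
(* The kernel is unique, so the constants do not depend on [psi]. *)
have KE m : kernel_moment psi m = K m.
  by apply: eq_plane_integral => z; rewrite (kernel_unique hpsi hpsi0).
have th0 : 0 < th by rewrite /th; lra.
have tha : th <= alpha by rewrite /th; lra.
have b1 : 2 * alpha - 2 <= alpha - 1 by lra.
have b2 : 2 * alpha - 2 <= th by rewrite /th; lra.
have th2 : th <= 2 by rewrite /th; lra.
have a0 : 0 < alpha by lra.
(* The signs of [M] and [N] are read off at two points at distance one, that of [N1] at time one. *)
have e1 : pdist (1, 0) 0 = 1 :> R.
  by rewrite /pdist/= !subr0 normr1 normr0 sqrtr0 addr0.
have Hf T y : 0 < T <= 1 -> `|mollify psi f T y| <= N1 * root4 T `^ (alpha - 2).
  by move=> T01; have /scaled_sup_leP/(_ T y T01) := hN1; rewrite (opprB 2).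
have M0 : 0 <= M.
  by have := Hu 0 (1, 0); rewrite e1 powR1 mulr1; exact: le_trans.
have N0 : 0 <= N.
  have := holder_seminorm_le (1, 0) 0 a0 (hN (1, 0) 0).
  by rewrite e1 powR1 !mulr1; exact: le_trans.
have N10 : 0 <= N1.
  by have := Hf 1 0; rewrite ltr01 lexx root4_1 powR1 mulr1 => /(_ isT); exact: le_trans.
have Hvx x : exists C, forall y z, `|v y x - v z x| <= C * pdist y z `^ alpha.
  have [C hC] := lt_pinfty_bound (hv x); exists C => y z.
  exact: (@holder_seminorm_le _ (v^~ x)).
have Hvf x : exists C, forall T y, 0 < T <= 1 ->
    `|mollify psi (vf x) T y| <= C * root4 T `^ (alpha - 2).
  have [C /scaled_sup_leP hC] := lt_pinfty_bound (hvf x); exists C => T y T01.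
  by have := hC T y T01; rewrite (opprB 2).
have Hv x x' y z : `|(v y x - v y x') - (v z x - v z x')| <=
    N * pdist x x' `^ alpha * pdist y z `^ alpha.
  exact: (@holder_seminorm_le _ (fun y => v y x - v y x')).
have HA x x' T y : 0 < T <= 1 ->
  `|commutator psi (v^~ x) f (vf x) T y - commutator psi (v^~ x') f (vf x') T y|
    <= N * N1 * pdist x x' `^ alpha * root4 T `^ (2 * alpha - 2).
  by move=> T01; have /scaled_sup_leP/(_ T y T01) := hA x x'; rewrite (opprB 2).
pose G := germ psi v f vf u nu.
have [Cg Cg0 gG] := germ_growth ha1 ha2 hpsi M0 N0 N10 Hvx Hf Hvf Hv HA Hu.
have pG t (t01 : 0 < t <= 1) := germ_poly ha1 ha2 hpsi M0 N0 N10 Hvx Hf Hvf Hv HA Hu t01.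
pose D := 4 * (1 + 6 * (4 * K 1%N)) * K 2%N * ((M + N) * N1).
have K0 m : 0 <= K m by exact: kernel_moment_ge0.
have D0 : 0 <= D by rewrite !mulr_ge0// ?addr_ge0// !mulr_ge0.
have dG s t x : 0 < t <= 1 -> 0 < s <= 2 * t ->
    `|plane_conv (psi s) (G t) x - G (s + t) x| <= D * root4 t `^ th.
  move=> t01 st; have := germ_defect ha1 ha2 hpsi M0 N0 N10 Hvx Hf Hvf Hv HA Hu x t01 st.
  rewrite !KE -/th /D => /le_trans; apply; rewrite le_eqVlt; apply/orP; left; apply/eqP; ring.
have cG x T (T0 : 0 < T) := germ_time_continuity v f vf u nu hpsi x T0.
have [uf Huf] := germ_reconstruction hpsi th0 tha th2 Cg0 D0 pG gG dG cG.
have HG T x : 0 < T <= 1 -> `|G T x - mollify psi uf T x| <= C1 * (M + N) * N1 * root4 T `^ th.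
  move=> T01; rewrite distrC; have := Huf T x T01.
  by rewrite KE -/q /C1 /D !mulrA.
have MN0 : 0 <= (M + N) * N1 by rewrite mulr_ge0// addr_ge0.
have GE (w : tempered_distribution R) T x : commutator psi u f w T x
    - commutator psi (v^~ x) f (vf x) T x
    - nu x * commutator psi fst f (distr_mulx1 f) T x = G T x - mollify psi w T x.
  by rewrite /G /germ /commutator; ring.
have q1 : 1 < q by apply: powR_gt1 => //; apply: powR_gt1; rewrite ?invr_gt0 ?ltr1n.
have C10 : 0 <= C1.
  have q0 : 0 <= q by exact: powR_ge0.
  have h : 0 <= K 0%N / (q - 1) by rewrite divr_ge0// subr_ge0 ltW.
  by rewrite !mulr_ge0// addr_ge0// !mulr_ge0.
have C1le (P : R) : 0 <= P -> C1 * (M + N) * N1 * P <= (1 + 4 * K 1%N + C1) * (M + N) * N1 * P.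
  move=> P0; rewrite ler_wpM2r// -!(mulrA _ (M + N) N1) ler_wpM2r//.
  by rewrite lerDr addr_ge0// mulr_ge0.
exists uf; split; first split.
- apply/scaled_sup_leP => T x T01; rewrite GE (opprB 2); apply: le_trans (HG T x T01) _.
  exact/C1le/powR_ge0.
(* Both candidates are compared with the same germ, so their mollifications differ by at most twice
   the bound. *)
- move=> uf' /scaled_sup_leP h'.
  apply: (@mollify_inj _ _ hpsi th th0 th2 _ _ (2 * ((1 + 4 * K 1%N + C1) * (M + N) * N1))) => T x T01.
  rewrite (_ : mollify psi uf T x - mollify psi uf' T x =
    (G T x - mollify psi uf' T x) - (G T x - mollify psi uf T x)); last by ring.
  apply: le_trans (ler_normB _ _) _; rewrite -mulrA mulr2n mulrDl !mul1r.
  apply: lerD; first by have := h' T x T01; rewrite GE (opprB 2).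
  by apply: le_trans (HG T x T01) _; exact/C1le/powR_ge0.
move=> pu _ pv _ _ _ hvA; apply/scaled_sup_leP => T x T01; rewrite (opprB 2).
have /andP[T0 T1] := T01.
(* As [T <= 1], the exponents [alpha - 1] and [3 * alpha - 2] may be lowered to [2 * alpha - 2]. *)
have rho_le b c : c <= b -> root4 T `^ b <= root4 T `^ c.
  by apply: ger_powR_le1; rewrite root4_gt0//= root4_le1// T1 ltW.
set P := root4 T `^ (2 * alpha - 2).
have P0 : 0 <= P by exact: powR_ge0.
(* Periodicity kills the increments of [u] and [v] at [y = x + e_1]. *)
have nuM : `|nu x| <= M.
  have := Hu x (x + unit_vec R false).
  have e : pdist (x + unit_vec R false) x = 1.
    by rewrite pdistE addrAC subrr add0r -[unit_vec _ _]subr0 -pdistE e1.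
  rewrite pu (pv x false x) !subrr sub0r normrN e powR1 mulr1.
  by rewrite addrAC subrr add0r mulr1.
have hA' : `|commutator psi (v^~ x) f (vf x) T x| <= N * N1 * P.
  by have /scaled_sup_leP/(_ T x T01) := hvA x; rewrite (opprB 2).
have hB : `|nu x * commutator psi fst f (distr_mulx1 f) T x| <= M * (4 * K 1%N * N1 * P).
  rewrite normrM; apply: ler_pM => //.
  apply: le_trans (commutator_coord1_bound hpsi x T01 ha2 N10 (ltW a0) Hf) _.
  rewrite KE; apply: ler_wpM2l; last exact: rho_le.
  exact: mulr_ge0 (mulr_ge0 (ler0n R 4) (K0 1%N)) N10.
have hG : `|G T x - mollify psi uf T x| <= C1 * (M + N) * N1 * P.
  apply: le_trans (HG T x T01) _; apply: ler_wpM2l; last exact: rho_le.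
  exact: mulr_ge0 (mulr_ge0 C10 (addr_ge0 M0 N0)) N10.
rewrite (_ : commutator psi u f uf T x = (G T x - mollify psi uf T x) +
  commutator psi (v^~ x) f (vf x) T x + nu x * commutator psi fst f (distr_mulx1 f) T x); last first.
  by rewrite -GE; ring.
apply: le_trans (ler_normD _ _) _; apply: le_trans (lerD (ler_normD _ _) (lexx _)) _.
apply: le_trans (lerD (lerD hG hA') hB) _.
have i1 : 0 <= M * N1 * P by rewrite !mulr_ge0.
have i2 : 0 <= 4 * K 1%N * (N * N1 * P) by rewrite !mulr_ge0.
rewrite -subr_ge0 [leRHS](_ : _ = M * N1 * P + 4 * K 1%N * (N * N1 * P)); last by ring.
exact: addr_ge0.
Qed.
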